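(* Let $f_1,\dots,f_n$ be non-constant entire functions on $\mathbb{C}^m$ with $m(r,f_i/f_1)=S(r,f_1)$ for each $i=1,\dots,n$. Let $$G(w_1,\dots,w_n)=\sum_{|I|=0}^{\infty}a_I(z)\,w_1^{i_1}\cdots w_n^{i_n}$$ be a nonzero power series in $w=(w_1,\dots,w_n)$ whose coefficients $a_I$ are entire functions on $\mathbb{C}^m$ satisfying $m\big(r,\sum_{|I|\ge0}|a_I|\big)=S(r,f_1)$, and such that $G(z,f_1(z),\dots,f_n(z))$ converges for all $z$. If $\delta(0,f_1)>0$ and $G(f_1,\dots,f_n)\equiv0$, then there exists a nonzero polynomial $P(w_1,\dots,w_n)$ whose coefficients are polynomials in some of the $a_I$ (hence small functions of $f_1$) such that $P(f_1,\dots,f_n)\equiv0$.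
   Context: Multi-index $I=(i_1,\dots,i_n)$ with $|I|=i_1+\dots+i_n$ and $w^I=w_1^{i_1}\cdots w_n^{i_n}$. Nevanlinna theory on $\mathbb{C}^m$: $m(r,\varphi)$ is the average of $\log^+|\varphi|$ over the sphere of radius $r$ (defined likewise for a nonnegative function $\varphi$ such as $\sum|a_I|$), $T(r,f)$ the characteristic, $\delta(0,f)=\liminf_{r\to\infty}m(r,1/f)/T(r,f)$. $S(r,f)$ denotes any quantity $o(T(r,f))$ as $r\to\infty$ outside a possible exceptional set of finite linear measure; a small function of $f$ is a meromorphic $b$ with $T(r,b)=S(r,f)$. *)

(* Defs.v *)
From HB Require Import structures.
From mathcomp Require Import all_boot all_order all_algebra.
From mathcomp Require Import all_classical all_reals all_analysis.
From mathcomp.real_closed Require Export complex.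
Export Order.TTheory GRing.Theory Num.Theory.
Export numFieldNormedType.Exports.

Set Implicit Arguments.
Unset Strict Implicit.
Unset Printing Implicit Defensive.

Local Open Scope classical_set_scope.
Local Open Scope ring_scope.

Section Nevanlinna.
Variable R : realType.

Definition cabs (z : R[i]) : R := let: (x +i* y)%C := z in Num.sqrt (x ^+ 2 + y ^+ 2).

(* entire (holomorphic) function on C^m: complex-Frechet differentiable
   everywhere (the differential is R[i]-linear). *)
Definition entire (m : nat) (f : 'rV[R[i]]_m -> R[i]) : Prop :=
  forall z, differentiable (f : 'rV[R[i]]_m -> R[i]^o) z.

Definition nonconstant (m : nat) (f : 'rV[R[i]]_m -> R[i]) : Prop :=
  ~ (exists c : R[i], forall z, f z = c).

Fixpoint iter_int (k : nat) (F : seq R -> \bar R) : \bar R :=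
  match k with
  | 0 => F [::]
  | k.+1 => (\int[@lebesgue_measure R]_(t in setT) iter_int k (fun s => F (t :: s)))%E
  end.

Definition vec_of (m : nat) (s : seq R) : 'rV[R[i]]_m :=
  \row_(j < m) (nth 0 s (2 * j) +i* nth 0 s (2 * j).+1)%C.

Definition vnorm (m : nat) (z : 'rV[R[i]]_m) : R :=
  Num.sqrt (\sum_(j < m) cabs (z 0 j) ^+ 2).

(* normalized (probability) surface measure on the unit sphere of C^m,
   realized as the cone measure: the average of g over the unit sphere is
   (1/vol B) * \int_{B \ 0} g(x/|x|) dx, B the unit ball of R^(2m). *)
Definition sphere_avg (m : nat) (g : 'rV[R[i]]_m -> \bar R) : \bar R :=
  (iter_int (2 * m) (fun s => let x := vec_of m s in
     if (0 < vnorm x <= 1)%R then g ((((vnorm x)^-1)%:C)%C *: x) else 0%E)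
   / iter_int (2 * m) (fun s => if (vnorm (vec_of m s) <= 1)%R then 1%E else 0%E))%E.

Definition logplus (x : R) : R := if 1 < x then ln x else 0.
Definition elogplus (x : \bar R) : \bar R :=
  match x with
  | +oo%E => +oo%E
  | x%:E => (logplus x)%:E
  | -oo%E => 0%E
  end.

Definition mprox_e (m : nat) (r : R) (phi : 'rV[R[i]]_m -> \bar R) : \bar R :=
  sphere_avg (fun zeta => elogplus (phi ((r%:C)%C *: zeta))).

Definition mprox (m : nat) (r : R) (f : 'rV[R[i]]_m -> R[i]) : \bar R :=
  mprox_e r (fun z => (cabs (f z))%:E).

(* Characteristic of an entire function: T(r,f) = m(r,f) + N(r,oo) = m(r,f)
   (an entire function has no poles). *)
Definition Tchar (m : nat) (f : 'rV[R[i]]_m -> R[i]) (r : R) : \bar R := mprox r f.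

Definition small_rel (T : R -> \bar R) (phi : R -> \bar R) : Prop :=
  exists E : set R, measurable E /\ (@lebesgue_measure R E < +oo)%E /\
    forall eps : R, 0 < eps -> exists r0 : R, forall r : R,
      r0 < r -> ~ E r -> (`|phi r| <= eps%:E * T r)%E.

Definition liminf_pinfty (h : R -> \bar R) : \bar R :=
  ereal_sup [set ereal_inf [set h r | r in [set r | r0 <= r]] | r0 in setT].

Definition deficiency0 (m : nat) (f : 'rV[R[i]]_m -> R[i]) : \bar R :=
  liminf_pinfty (fun r => (mprox r (fun z => ((f z)^-1)%R) / Tchar f r)%E).

Definition multi_of (n d : nat) (I : {ffun 'I_n -> 'I_d}) : {ffun 'I_n -> nat} :=
  [ffun i => nat_of_ord (I i)].

Definition monom (n : nat) (w : 'I_n -> R[i]) (I : {ffun 'I_n -> nat}) : R[i] :=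
  \prod_(i < n) w i ^+ I i.

Definition hpart (m n : nat) (a : {ffun 'I_n -> nat} -> 'rV[R[i]]_m -> R[i])
    (z : 'rV[R[i]]_m) (w : 'I_n -> R[i]) (d : nat) : R[i] :=
  \sum_(I : {ffun 'I_n -> 'I_d.+1} | (\sum_(i < n) (I i : nat))%N == d)
     a (multi_of I) z * monom w (multi_of I).

Definition abs_coef_sum (m n : nat) (a : {ffun 'I_n -> nat} -> 'rV[R[i]]_m -> R[i])
    (z : 'rV[R[i]]_m) : \bar R :=
  (\sum_(0 <= d <oo)
     (\sum_(I : {ffun 'I_n -> 'I_d.+1} | (\sum_(i < n) (I i : nat))%N == d)
        cabs (a (multi_of I) z))%:E)%E.

Inductive poly_in (m n : nat) (a : {ffun 'I_n -> nat} -> 'rV[R[i]]_m -> R[i])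
  : ('rV[R[i]]_m -> R[i]) -> Prop :=
  | poly_in_cst (c : R[i]) : poly_in a (fun _ => c)
  | poly_in_coef (I : {ffun 'I_n -> nat}) : poly_in a (a I)
  | poly_in_add g h : poly_in a g -> poly_in a h -> poly_in a (fun z => g z + h z)
  | poly_in_mul g h : poly_in a g -> poly_in a h -> poly_in a (fun z => g z * h z).

End Nevanlinna.

(* Main.v *)
Require Import Defs.
From HB Require Import structures.
From mathcomp Require Import all_boot all_order all_algebra.
From mathcomp Require Import all_classical all_reals all_analysis.
From mathcomp Require Import measurable_realfun.
From mathcomp.real_closed Require Import complex.
From mathcomp Require Import ring lra zify.
Import Order.TTheory GRing.Theory Num.Theory.
Import numFieldNormedType.Exports.
Set Implicit Arguments.
Unset Strict Implicit.
Unset Printing Implicit Defensive.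
Local Open Scope classical_set_scope.
Local Open Scope ring_scope.

(** Write [T(r)] for the characteristic of [f_1] and [S(r)] for the small terms. By Siegel-type
    linear algebra there is, for every integer [q], a nonzero polynomial [U] with coefficients
    polynomial in the [a_I] such that the product [U G] has no monomial in the box [[0, q Y)^n]
    outside the much smaller box [[0, Y)^n]; its part [P] inside the latter is not zero.
    Since [G(f) = 0], [P(f)] equals minus the sum of the terms of [U G] outside the large box,
    so that [|P(f)|] is at most [|f_1|^(q Y)], up to small factors, where the [f_i] are small.
    If [P(f)] were not identically zero, this and the inequality [m(r, 1/P(f)) <= m(r, P(f)) +
    O(1)] would give [q Y m(r, 1/f_1) <= m(r, P(f)) + S(r) <= n Y T(r) + S(r)], which for large
    [q] contradicts [delta(0, f_1) > 0], because [T(r)] tends to infinity.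

    The inequality between [m(r, 1/g)] and [m(r, g)] replaces Jensen's formula: it is derived
    from the sub-mean value property of [log^+ |g|].  This property follows from the maximum
    principle applied to the products, over subsets [S] of the [N]-th roots of unity, of the
    functions [l |-> g (z + l w v)], [w] in [S], after averaging over the sphere and letting [N]
    tend to infinity.  The maximum principle is obtained from Goursat's lemma on a homotopy
    contracting a circle to a point. *)

(** The linear algebra is a count. With X = q Y there are X^n - Y^n conditions and (X - e)^n
    unknowns, where e bounds the degree of a lowest nonzero coefficient of G; the loss, at most n e
    X^(n-1), is of lower order than Y^n as Y grows. The margin e keeps the lowest term of U G inside
    the large box, hence inside the small one, so that P is not the zero polynomial. On the analytic
    side the obstacle is the zeros: log |g| is unbounded below, while the integrals are handled for
    nonnegative functions only. So log^+ (1/|g|) is cut at height -log t, and log^+ |g| - log t is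
    the sum of this cut function and of log^+ |g/t|. Both are bounded on compact sets, g/t is again
    entire, and the bounds obtained do not depend on t, so that monotone convergence removes the
    cut. The same bounds show that the zeros of f_1 on a sphere are negligible; there f_i/f_1 is 0
    by convention and carries no information. *)

Local Notation Re := complex.Re.
Local Notation Im := complex.Im.

(** * The maximum principle *)

Section RectangleFunctional.
Variable R : realType.
Implicit Types A B : R -> R -> R.

Definition rect_inc A B (s s' t t' : R) : R :=
  (A t s' - A t s) - (A t' s' - A t' s) + (B s' t' - B s' t) - (B s t' - B s t).

(* Goursat's bisection argument, [rect_inc A B] being the integral along the boundary of a
   rectangle of the form whose primitives along its sides are [A t] and [B s]. *)
Lemma rect_inc_eq0 A B (s t ls lt : R) : 0 <= ls -> 0 <= lt ->
  (forall p q, s <= p <= s + ls -> t <= q <= t + lt ->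
    forall e : R, 0 < e -> exists2 d : R, 0 < d & forall s' t' h : R, 0 < h -> h < d ->
      s <= s' -> s' + ls * h <= s + ls -> t <= t' -> t' + lt * h <= t + lt ->
      s' <= p <= s' + ls * h -> t' <= q <= t' + lt * h ->
      `|rect_inc A B s' (s' + ls * h) t' (t' + lt * h)| <= e * h ^+ 2) ->
  rect_inc A B s (s + ls) t (t + lt) = 0.
Proof.
move=> ls0 lt0 loc; apply/eqP/negPn/negP => I0.
pose I (x : R * R) n : R := `|rect_inc A B x.1 (x.1 + ls * 2^-1 ^+ n)
  x.2 (x.2 + lt * 2^-1 ^+ n)|.
pose c : R := `|rect_inc A B s (s + ls) t (t + lt)|.
have c0 : 0 < c by rewrite normr_gt0.
(* One of the four quarters carries at least a quarter of the increment. The bound on the parent is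
   a premise, so that [choice] applies to every rectangle. *)
have step n (x : R * R) : exists y : R * R,
    c * 4^-1 ^+ n <= I x n ->
    [/\ c * 4^-1 ^+ n.+1 <= I y n.+1, x.1 <= y.1, x.2 <= y.2,
      y.1 + ls * 2^-1 ^+ n.+1 <= x.1 + ls * 2^-1 ^+ n
     & y.2 + lt * 2^-1 ^+ n.+1 <= x.2 + lt * 2^-1 ^+ n].
  pose h := (2^-1 : R) ^+ n.+1.
  have h2 : (2^-1 : R) ^+ n = h + h by rewrite /h exprS; lra.
  have h0 : 0 <= h by rewrite exprn_ge0 // invr_ge0.
  have lh : 0 <= ls * h by rewrite mulr_ge0.
  have th : 0 <= lt * h by rewrite mulr_ge0.
  have [cx|] := pselect (c * 4^-1 ^+ n <= I x n); last by exists x.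
  have := cx; rewrite {1}/I h2 !mulrDr !addrA => cx'.
  have [H1|H1] := leP (c * 4^-1 ^+ n.+1) (I x n.+1).
    by exists x => _; rewrite -/h; split=> //; lra.
  have [H2|H2] := leP (c * 4^-1 ^+ n.+1) (I (x.1 + ls * h, x.2) n.+1).
    by exists (x.1 + ls * h, x.2) => _; rewrite -/h; split=> //=; lra.
  have [H3|H3] := leP (c * 4^-1 ^+ n.+1) (I (x.1, x.2 + lt * h) n.+1).
    by exists (x.1, x.2 + lt * h) => _; rewrite -/h; split=> //=; lra.
  have [H4|H4] := leP (c * 4^-1 ^+ n.+1) (I (x.1 + ls * h, x.2 + lt * h) n.+1).
    by exists (x.1 + ls * h, x.2 + lt * h) => _; rewrite -/h; split=> //=; lra.
  exfalso; move: cx'; rewrite leNgt => /negP; apply.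
  move: H1 H2 H3 H4; rewrite /I /= -/h exprS.
  set a1 := rect_inc _ _ _ _ _ _; set a2 := rect_inc _ _ _ _ _ _.
  set a3 := rect_inc _ _ _ _ _ _; set a4 := rect_inc _ _ _ _ _ _ => H1 H2 H3 H4.
  have -> : rect_inc A B x.1 (x.1 + ls * h + ls * h) x.2 (x.2 + lt * h + lt * h)
    = a1 + a2 + a3 + a4 by rewrite /a1 /a2 /a3 /a4 /rect_inc; ring.
  have := ler_normD (a1 + a2 + a3) a4; have := ler_normD (a1 + a2) a3.
  have := ler_normD a1 a2; lra.
have /choice [g gP] : forall nx : nat * (R * R), exists y : R * R,
    c * 4^-1 ^+ nx.1 <= I nx.2 nx.1 ->
    [/\ c * 4^-1 ^+ nx.1.+1 <= I y nx.1.+1, nx.2.1 <= y.1, nx.2.2 <= y.2,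
      y.1 + ls * 2^-1 ^+ nx.1.+1 <= nx.2.1 + ls * 2^-1 ^+ nx.1
     & y.2 + lt * 2^-1 ^+ nx.1.+1 <= nx.2.2 + lt * 2^-1 ^+ nx.1].
  by case=> n x; exact: step.
pose x := fix x n := if n is n'.+1 then g (n', x n') else (s, t).
have xP n : c * 4^-1 ^+ n <= I (x n) n.
  elim: n => [|n IH]; first by rewrite /I /= !expr0 !mulr1 lexx.
  by have [] := gP (n, x n) IH.
have mono1 n k : (n <= k)%N -> (x n).1 <= (x k).1 /\ (x n).2 <= (x k).2.
  elim: k => [|k IH]; first by rewrite leqn0 => /eqP ->.
  rewrite leq_eqVlt => /orP[/eqP->//|/IH[H1 H2]].
  have [_ H3 H4 _ _] := gP (k, x k) (xP k).
  by split; [apply: le_trans H1 H3|apply: le_trans H2 H4].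
have mono2 n k : (n <= k)%N -> (x k).1 + ls * 2^-1 ^+ k <= (x n).1 + ls * 2^-1 ^+ n /\
    (x k).2 + lt * 2^-1 ^+ k <= (x n).2 + lt * 2^-1 ^+ n.
  elim: k => [|k IH]; first by rewrite leqn0 => /eqP ->.
  rewrite leq_eqVlt => /orP[/eqP->//|/IH[H1 H2]].
  have [_ _ _ H3 H4] := gP (k, x k) (xP k).
  by split; [apply: le_trans H3 H1|apply: le_trans H4 H2].
have pw k : 0 <= (2^-1 : R) ^+ k by rewrite exprn_ge0 // invr_ge0.
have ub1 n k : (x k).1 <= (x n).1 + ls * 2^-1 ^+ n.
  have [/mono1[H _]|/ltnW/mono2[H _]] := leqP k n.
    by apply: (le_trans H); rewrite lerDl mulr_ge0.
  by apply: le_trans H; rewrite lerDl mulr_ge0.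
have ub2 n k : (x k).2 <= (x n).2 + lt * 2^-1 ^+ n.
  have [/mono1[_ H]|/ltnW/mono2[_ H]] := leqP k n.
    by apply: (le_trans H); rewrite lerDl mulr_ge0.
  by apply: le_trans H; rewrite lerDl mulr_ge0.
(* The nested rectangles share [(p, q)], the supremum of their lower left corners. *)
pose p := sup (range (fun n => (x n).1)); pose q := sup (range (fun n => (x n).2)).
have pP n : (x n).1 <= p <= (x n).1 + ls * 2^-1 ^+ n.
  apply/andP; split.
    by apply: ub_le_sup; [exists (s + ls) => _ [k _ <-]; have := ub1 0%N k; rewrite expr0 mulr1 | exists n].
  by apply: ge_sup; [exists (x 0%N).1, 0%N | move=> _ [k _ <-]].
have qP n : (x n).2 <= q <= (x n).2 + lt * 2^-1 ^+ n.
  apply/andP; split.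
    by apply: ub_le_sup; [exists (t + lt) => _ [k _ <-]; have := ub2 0%N k; rewrite expr0 mulr1 | exists n].
  by apply: ge_sup; [exists (x 0%N).2, 0%N | move=> _ [k _ <-]].
have pst := pP 0%N; have qst := qP 0%N; rewrite /= expr0 !mulr1 in pst qst.
(* At scale [2^-1 ^+ n] the tolerance [c / 2] gives at most half of the lower bound [c * 4^-1 ^+ n],
   because [4^-1 ^+ n] is the square of the scale. *)
have [d d0 dP] := loc p q pst qst (c / 2) (divr_gt0 c0 (ltr0Sn R 1)).
have [n nd] : exists n, (2^-1 : R) ^+ n < d.
  have /cvgrPdist_lt/(_ d d0) [n _ H] : (fun n => (2^-1 : R) ^+ n) @ \oo --> (0 : R).
    by apply: cvg_expr; rewrite ger0_norm ?invr_ge0// invf_lt1// ltr1n.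
  by exists n; have := H n (leqnn n); rewrite /= sub0r normrN ger0_norm.
have p0 : 0 < (2^-1 : R) ^+ n by rewrite exprn_gt0 // invr_gt0.
have [s1 t1] := mono1 0%N n (leq0n n); have [s2 t2] := mono2 0%N n (leq0n n).
rewrite expr0 !mulr1 in s2 t2.
have := dP (x n).1 (x n).2 _ p0 nd s1 s2 t1 t2 (pP n) (qP n).
apply/negP; rewrite -ltNge; apply: lt_le_trans (xP n).
rewrite -exprM mulnC exprM.
have -> : (2^-1 : R) ^+ 2 = 4^-1 by rewrite exprVn; congr (_^-1); ring.
by rewrite ltr_pM2r; [rewrite ltr_pdivrMr; lra | rewrite exprn_gt0// invr_gt0].
Qed.

End RectangleFunctional.

(** * The real-valued modulus on the complex numbers *)

Section ComplexModulus.
Variable R : realType.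
Implicit Types z w : R[i].

Lemma cabsE z : `|z| = (cabs z)%:C%C.
Proof. by case: z. Qed.

Lemma cabs_ge0 z : 0 <= cabs z.
Proof. by case: z => x y; exact: sqrtr_ge0. Qed.

Lemma cabsM z w : cabs (z * w) = cabs z * cabs w.
Proof. exact: Normc.normcM. Qed.

Lemma cabsV z : cabs z^-1 = (cabs z)^-1.
Proof. exact: Normc.normcV. Qed.

Lemma cabsD z w : cabs (z + w) <= cabs z + cabs w.
Proof. exact: le_normcD. Qed.

Lemma cabsN z : cabs (- z) = cabs z.
Proof. by case: z => x y; rewrite /cabs /= !sqrrN. Qed.

Lemma cabsB z w : cabs (z - w) <= cabs z + cabs w.
Proof. by rewrite -(cabsN w) cabsD. Qed.

Lemma cabs_distC z w : cabs (z - w) = cabs (w - z).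
Proof. by rewrite -cabsN opprB. Qed.

Lemma cabs_ge z w : cabs z - cabs w <= cabs (z - w).
Proof. by rewrite lerBlDr -{1}(subrK w z) cabsD. Qed.

Lemma cabs0 : cabs (0 : R[i]) = 0.
Proof. exact: Normc.normc0. Qed.

Lemma cabs1 : cabs (1 : R[i]) = 1.
Proof. exact: Normc.normc1. Qed.

Lemma cabs_eq0 z : (cabs z == 0) = (z == 0).
Proof.
apply/eqP/eqP => [|->]; last exact: cabs0.
exact: Normc.eq0_normc.
Qed.

Lemma cabs_gt0 z : (0 < cabs z) = (z != 0).
Proof. by rewrite lt_neqAle cabs_ge0 andbT eq_sym cabs_eq0. Qed.

Lemma cabs_real (x : R) : cabs (x%:C)%C = `|x|.
Proof. by rewrite /cabs /= expr0n addr0 sqrtr_sqr. Qed.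

Lemma cabsX z n : cabs (z ^+ n) = cabs z ^+ n.
Proof. by elim: n => [|n IH]; rewrite ?cabs1 // !exprS cabsM IH. Qed.

Lemma cabs_prod (I : Type) (s : seq I) (P : pred I) (F : I -> R[i]) :
  cabs (\prod_(i <- s | P i) F i) = \prod_(i <- s | P i) cabs (F i).
Proof. by apply: (big_morph _ cabsM cabs1). Qed.

Lemma cabs_sum (I : Type) (s : seq I) (P : pred I) (F : I -> R[i]) :
  cabs (\sum_(i <- s | P i) F i) <= \sum_(i <- s | P i) cabs (F i).
Proof.
elim/big_rec2: _ => [|i y1 y2 _ H]; first by rewrite cabs0.
by apply: le_trans (cabsD _ _) _; rewrite lerD2l.
Qed.

Lemma Re_cabs z : `|Re z| <= cabs z.
Proof.
by case: z => x y /=; rewrite -sqrtr_sqr ler_wsqrtr // lerDl sqr_ge0.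
Qed.

Lemma Im_cabs z : `|Im z| <= cabs z.
Proof.
by case: z => x y /=; rewrite -sqrtr_sqr ler_wsqrtr // lerDr sqr_ge0.
Qed.

Lemma cabs_ReIm z : cabs z <= `|Re z| + `|Im z|.
Proof.
have {1}-> : z = (Re z)%:C%C + ((0 +i* 1)%C * (Im z)%:C%C).
  by case: z => x y; rewrite /=; simpc.
apply: le_trans (cabsD _ _) _; rewrite cabsM !cabs_real.
by rewrite /cabs /= expr0n add0r expr1n sqrtr1 mul1r.
Qed.

(** The order of [R[i]] is partial, so the limit is restated with real bounds. The derivative is a
    limit off [z], whence the separate case [w = z]. *)
Lemma derivable_approx (F : R[i] -> R[i]) z :
  derivable (F : R[i]^o -> R[i]^o) z 1 ->
  exists D, forall e : R, 0 < e -> exists2 d : R, 0 < d &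
    forall w, cabs (w - z) < d ->
      cabs (F w - F z - D * (w - z)) <= e * cabs (w - z).
Proof.
move=> /cvg_ex[D FD]; exists D => e e0.
have e0' : (0 : R[i]) < e%:C%C by rewrite (ltcR 0).
move/cvgrPdist_le/(_ _ e0') : FD; rewrite near_withinE /=.
case/nbhs_ballP => d /= d0 H.
have [d' d'E] : exists d' : R, d = d'%:C%C.
  by apply/complex_realP; rewrite gtr0_real.
exists d'; first by rewrite d'E (ltcR 0) in d0.
move=> w wz; have [->|nwz] := eqVneq w z.
  by rewrite !subrr mulr0 subr0 cabs0 mulr0.
have nz : w - z != 0 by rewrite subr_eq0.
have := H (w - z); rewrite /ball /= sub0r normrN cabsE d'E ltcR => /(_ wz nz).
rewrite cabsE lecR /= scaler1 subrK => K.
have -> : F w - F z - D * (w - z) = - ((D - (w - z)^-1 *: (F w - F z)) * (w - z)).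
  by rewrite mulrBl [in RHS]/GRing.scale /= mulrAC mulVf // mul1r opprB.
by rewrite cabsN cabsM ler_pM2r // cabs_gt0.
Qed.

End ComplexModulus.

(** * Primitives and mean value bounds along edges *)

Section ContourIntegrals.
Variable R : realType.

(** The integral from [a] is differentiated only to the right of [a]; users take [a] strictly below
    the interval of interest. *)
Lemma primitive_exists (f : R -> R) (a : R) : continuous f ->
  exists P : R -> R, forall x, a < x -> is_derive x 1 P (f x).
Proof.
move=> cf; exists (fun x => \int[@lebesgue_measure R]_(t in `[a, x]) f t)%R => x ax.
have xu : x < x + 1 by rewrite ltrDl.
have fi : (@lebesgue_measure R).-integrable `[a, x + 1] (EFin \o f).
  apply: continuous_compact_integrable; first exact: segment_compact.
  exact: continuous_subspaceT.
have [dF eF] := continuous_FTC1_closed xu fi ax (cf x).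
by apply: DeriveDef; rewrite // -eF derive1E.
Qed.

Lemma mv_bound (f df : R -> R) (a b K : R) : a <= b ->
  (forall x, a <= x <= b -> is_derive x 1 f (df x)) ->
  (forall x, a <= x <= b -> `|df x| <= K) -> `|f b - f a| <= K * (b - a).
Proof.
move=> ab fd dK.
have cf : {within `[a, b], continuous f}.
  apply: derivable_within_continuous => x; rewrite in_itv /= => /fd xd.
  exact: ex_derive.
have [c + ->] : exists2 c, c \in `[a, b]%R & f b - f a = df c * (b - a).
  apply: MVT_segment => // x; rewrite in_itv /= => /andP[ax xb].
  by apply: fd; rewrite !ltW.
rewrite in_itv /= => /dK cK; rewrite normrM (ger0_norm (x := b - a)) ?subr_ge0 //.
by rewrite ler_wpM2r // subr_ge0.
Qed.

Lemma mv_lower (f df : R -> R) (a b K : R) : a <= b ->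
  (forall x, a <= x <= b -> is_derive x 1 f (df x)) ->
  (forall x, a <= x <= b -> K <= df x) -> K * (b - a) <= f b - f a.
Proof.
move=> ab fd dK.
have cf : {within `[a, b], continuous f}.
  apply: derivable_within_continuous => x; rewrite in_itv /= => /fd xd.
  exact: ex_derive.
have [c + ->] : exists2 c, c \in `[a, b]%R & f b - f a = df c * (b - a).
  apply: MVT_segment => // x; rewrite in_itv /= => /andP[ax xb].
  by apply: fd; rewrite !ltW.
by rewrite in_itv /= => /dK cK; rewrite ler_wpM2r // subr_ge0.
Qed.

Definition ccont_at (F : R[i] -> R[i]) (z : R[i]) := forall e : R, 0 < e ->
  exists2 d : R, 0 < d & forall w, cabs (w - z) < d -> cabs (F w - F z) < e.

Lemma derivable_ccont_at (F : R[i] -> R[i]) z :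
  derivable (F : R[i]^o -> R[i]^o) z 1 -> ccont_at F z.
Proof.
case/derivable_approx => D HD e e0.
have [d d0 dP] := HD 1 ltr01.
have D1 : 0 < cabs D + 1 by rewrite ltr_wpDl // cabs_ge0.
exists (Num.min d (e / (cabs D + 1))).
  by rewrite lt_min d0 divr_gt0.
move=> w; rewrite lt_min => /andP[/dP wd]; rewrite ltr_pdivlMr // => we.
apply: le_lt_trans we; rewrite mulrDr mulr1 [leRHS]addrC.
have -> : F w - F z = (F w - F z - D * (w - z)) + D * (w - z) by rewrite subrK.
apply: le_trans (cabsD _ _) _; rewrite cabsM [cabs D * _]mulrC lerD2r.
by rewrite mul1r in wd.
Qed.

Lemma ccont_comp (F : R[i] -> R[i]) (g : R -> R[i]) (t : R) :
  ccont_at F (g t) -> {for t, continuous (fun u => Re (g u))} ->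
  {for t, continuous (fun u => Im (g u))} ->
  {for t, continuous (fun u => Re (F (g u)))} /\ {for t, continuous (fun u => Im (F (g u)))}.
Proof.
move=> cF cR cI.
have H (e : R) : 0 < e -> \forall u \near t, cabs (F (g u) - F (g t)) < e.
  move=> e0; have [d d0 dP] := cF e e0.
  have d2 : 0 < d / 2 by rewrite divr_gt0.
  move: (cR); move=> /cvgrPdist_lt/(_ _ d2) nR.
  move: (cI); move=> /cvgrPdist_lt/(_ _ d2) nI.
  near=> u; apply: dP; apply: le_lt_trans (cabs_ReIm _) _.
  have hR : `|Re (g t) - Re (g u)| < d / 2 by near: u.
  have hI : `|Im (g t) - Im (g u)| < d / 2 by near: u.
  rewrite distrC in hR; rewrite distrC in hI.
  rewrite [Re _]raddfB [Im _]raddfB /=; rewrite (splitr d); exact: ltrD.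
split; apply/cvgrPdist_lt => e e0; near=> u => /=.
- rewrite distrC -[_ - _](raddfB (@Re R)); apply: le_lt_trans (Re_cabs _) _.
  by near: u; exact: H.
- rewrite distrC -[_ - _](raddfB (@Im R)); apply: le_lt_trans (Im_cabs _) _.
  by near: u; exact: H.
Unshelve. all: by end_near. Qed.

End ContourIntegrals.

Section WeakMaximum.
Variable R : realType.

(* imaginary part of the primitive of [al + be * (w - z)] vanishing at [z] *)
Definition affine_prim (al be z w : R[i]) : R :=
  Im (al * (w - z)) + Im (be * (w - z) ^+ 2) / 2.

Lemma is_derive_affine_prim (al be z : R[i]) (g : R -> R[i]) (u : R) (dg : R[i]) :
  is_derive u 1 (fun v => Re (g v)) (Re dg) ->
  is_derive u 1 (fun v => Im (g v)) (Im dg) ->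
  is_derive u 1 (fun v => affine_prim al be z (g v))
    (Im ((al + be * (g u - z)) * dg)).
Proof.
move=> dR dI.
pose X : R -> R := (fun v => Re (g v)) - cst (Re z).
pose Y : R -> R := (fun v => Im (g v)) - cst (Im z).
have -> : (fun v => affine_prim al be z (g v)) =
   Re al \*: Y + Im al \*: X + Re be \*: (X * Y) + (Im be / 2) \*: (X * X - Y * Y).
  apply/funext => v; rewrite /affine_prim /X /Y {X Y} !fctE /=.
  case: al be z (g v) => [a1 a2] [b1 b2] [z1 z2] [x y]; rewrite expr2.
  by simpc => /=; rewrite /GRing.scale /=; field.
apply: is_derive_eq; rewrite /X /Y {X Y} !fctE.
case: al be z (g u) dg dR dI => [a1 a2] [b1 b2] [z1 z2] [x y] [dx dy] _ _ /=.
by rewrite /GRing.scale /=; simpc => /=; field.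
Qed.

(** Replacing [G] by its affine approximation changes the integrand by at most [e * k * L]. The
    affine form has a primitive, so its contributions cancel over the four edges of a rectangle. *)
Lemma contour_edge (G : R[i] -> R[i]) (g dg : R -> R[i]) (P : R -> R) (t0 t1 : R)
    (al be z : R[i]) (e k L : R) : t0 <= t1 -> 0 <= e ->
  (forall u, t0 <= u <= t1 -> is_derive u 1 P (Im (G (g u) * dg u))) ->
  (forall u : R, is_derive u 1 (fun v => Re (g v)) (Re (dg u))) ->
  (forall u : R, is_derive u 1 (fun v => Im (g v)) (Im (dg u))) ->
  (forall u, t0 <= u <= t1 ->
     cabs (G (g u) - al - be * (g u - z)) <= e * cabs (g u - z)) ->
  (forall u, t0 <= u <= t1 -> cabs (g u - z) <= k) ->
  (forall u, t0 <= u <= t1 -> cabs (dg u) <= L) ->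
  `|(P t1 - P t0) - (affine_prim al be z (g t1) - affine_prim al be z (g t0))|
     <= e * k * L * (t1 - t0).
Proof.
move=> t01 e0 dP dR dI Ge gk dL.
pose f : R -> R := P - (fun v => affine_prim al be z (g v)).
have -> : P t1 - P t0 - (affine_prim al be z (g t1) - affine_prim al be z (g t0))
  = f t1 - f t0 by rewrite /f !fctE; ring.
pose df u := Im ((G (g u) - al - be * (g u - z)) * dg u).
apply: (@mv_bound _ f df) => // u ut.
- have H1 := dP u ut; have H2 := is_derive_affine_prim al be z (dR u) (dI u).
  apply: is_derive_eq; rewrite /df -[LHS](raddfB (@Im R)) -mulrBl.
  by congr (Im (_ * _)); rewrite opprD addrA.
- apply: le_trans (Im_cabs _) _; rewrite cabsM.
  apply: ler_pM; [exact: cabs_ge0|exact: cabs_ge0| |exact: dL].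
  by apply: le_trans (Ge u ut) _; rewrite ler_wpM2l // gk.
Qed.

End WeakMaximum.

Section StarHomotopy.
Variable R : realType.

Definition circ (r t : R) : R[i] := (r * cos t +i* (r * sin t))%C.

(* homotopy contracting the circle of radius [r] to [z0] as [s] goes to [-oo] *)
Definition star (z0 : R[i]) (r s t : R) : R[i] :=
  z0 + (expR s)%:C%C * (circ r t - z0).

Definition star_ds (z0 : R[i]) (r s t : R) : R[i] :=
  (expR s)%:C%C * (circ r t - z0).

Definition star_dt (r s t : R) : R[i] :=
  (expR s)%:C%C * ((0 +i* 1)%C * circ r t).

Lemma cabs_circ r t : 0 <= r -> cabs (circ r t) = r.
Proof.
move=> r0; rewrite /cabs /= !exprMn -mulrDr cos2Dsin2 mulr1 sqrtr_sqr.
by rewrite ger0_norm.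
Qed.

Lemma is_derive_star_s z0 r t (s : R) :
  is_derive s 1 (fun v => Re (star z0 r v t)) (Re (star_ds z0 r s t)) /\
  is_derive s 1 (fun v => Im (star z0 r v t)) (Im (star_ds z0 r s t)).
Proof.
case: z0 => x y; split.
- have -> : (fun v => Re (star (x +i* y)%C r v t)) =
    cst x + (r * cos t - x) \*: expR.
    by apply/funext => v; rewrite !fctE /=; simpc => /=; rewrite /GRing.scale /=; ring.
  apply: is_derive_eq.
  by rewrite /=; simpc => /=; rewrite /GRing.scale /=; ring.
- have -> : (fun v => Im (star (x +i* y)%C r v t)) =
    cst y + (r * sin t - y) \*: expR.
    by apply/funext => v; rewrite !fctE /=; simpc => /=; rewrite /GRing.scale /=; ring.
  apply: is_derive_eq.
  by rewrite /=; simpc => /=; rewrite /GRing.scale /=; ring.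
Qed.

Lemma is_derive_star_t z0 r s (t : R) :
  is_derive t 1 (fun v => Re (star z0 r s v)) (Re (star_dt r s t)) /\
  is_derive t 1 (fun v => Im (star z0 r s v)) (Im (star_dt r s t)).
Proof.
case: z0 => x y; split.
- have -> : (fun v => Re (star (x +i* y)%C r s v)) =
    cst (x - expR s * x) + (expR s * r) \*: cos.
    by apply/funext => v; rewrite !fctE /=; simpc => /=; rewrite /GRing.scale /=; ring.
  apply: is_derive_eq.
  by rewrite /=; simpc => /=; rewrite /GRing.scale /=; ring.
- have -> : (fun v => Im (star (x +i* y)%C r s v)) =
    cst (y - expR s * y) + (expR s * r) \*: sin.
    by apply/funext => v; rewrite !fctE /=; simpc => /=; rewrite /GRing.scale /=; ring.
  apply: is_derive_eq.
  by rewrite /=; simpc => /=; rewrite /GRing.scale /=; ring.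
Qed.

Lemma is_derive_continuous (f : R -> R) (t df : R) :
  is_derive t 1 f df -> {for t, continuous f}.
Proof. by move=> h; apply: differentiable_continuous; apply/derivable1_diffP; apply: ex_derive. Qed.

Lemma star_lip z0 r s t s' t' : cabs z0 < r -> s <= 0 -> s' <= 0 ->
  cabs (star z0 r s t - star z0 r s' t') <= 2 * r * (`|s - s'| + `|t - t'|).
Proof.
move=> z0r s0 s0'; have r0 : 0 <= r by rewrite (le_trans (cabs_ge0 z0)) // ltW.
have lip (f df : R -> R) (K a b : R) :
    (forall x : R, is_derive x 1 f (df x)) ->
    (forall x, x <= Num.max a b -> `|df x| <= K) ->
    `|f a - f b| <= K * `|a - b|.
  move=> fd dK; have [ab|ab] := leP a b.
    rewrite distrC (distrC a) (ger0_norm (x := b - a)) ?subr_ge0 //.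
    by apply: (@mv_bound _ f df) => // x /andP[_ xb]; apply: dK; rewrite le_max xb orbT.
  rewrite (ger0_norm (x := a - b)); last by rewrite subr_ge0 ltW.
  by apply: (@mv_bound _ f df) => //; [exact: ltW | move=> x /andP[_ xb]; apply: dK; rewrite le_max xb].
have le : `|expR s - expR s'| <= `|s - s'|.
  rewrite -[leRHS]mul1r; apply: (lip expR expR) => x.
    by rewrite le_max => /orP xs; rewrite ger0_norm ?expR_ge0 // expR_le1; case: xs => /le_trans; apply.
have lc : `|cos t - cos t'| <= `|t - t'|.
  rewrite -[leRHS]mul1r; apply: (lip cos (fun x => - sin x)) => x.
  by rewrite normrN ler_norml sin_geN1 sin_le1.
have ls : `|sin t - sin t'| <= `|t - t'|.
  rewrite -[leRHS]mul1r; apply: (lip sin cos) => x.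
  by rewrite ler_norml cos_geN1 cos_le1.
have -> : star z0 r s t - star z0 r s' t' =
   (expR s - expR s')%:C%C * (circ r t - z0) + (expR s')%:C%C * (circ r t - circ r t').
  by rewrite /star rmorphB /=; ring.
apply: le_trans (cabsD _ _) _; rewrite !cabsM !cabs_real mulrDr; apply: lerD.
- rewrite mulrC; apply: ler_pM => //; first exact: cabs_ge0.
  by apply: le_trans (cabsB _ _) _; rewrite cabs_circ // mulr2n mulrDl mul1r lerD2l ltW.
- rewrite -[leRHS]mul1r; apply: ler_pM => //; first exact: cabs_ge0.
    by rewrite ger0_norm ?expR_ge0 // expR_le1.
  apply: le_trans (cabs_ReIm _) _; rewrite /= -!mulrBr !normrM (ger0_norm r0).
  rewrite -mulrDr [2 * r]mulrC -mulrA ler_wpM2l //; lra.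
Qed.

End StarHomotopy.

(** * A Cauchy estimate, with a constant, on a disc *)

Section MaximumPrinciple.
Variable R : realType.

Definition holo (F : R[i] -> R[i]) := forall z, derivable (F : R[i]^o -> R[i]^o) z 1.

Lemma star_neq (z0 : R[i]) (r s t : R) : cabs z0 < r -> star z0 r s t - z0 != 0.
Proof.
move=> z0r; have r0 : 0 <= r by rewrite (le_trans (cabs_ge0 z0)) // ltW.
rewrite /star addrC addKr -cabs_gt0 cabsM cabs_real mulr_gt0 //.
  by rewrite normr_gt0 gt_eqF // expR_gt0.
by apply: lt_le_trans (cabs_ge _ _); rewrite cabs_circ // subr_gt0.
Qed.

Lemma circ_sub (z0 : R[i]) (r t : R) : cabs z0 < r -> r - cabs z0 <= cabs (circ r t - z0).
Proof.
move=> z0r; have r0 : 0 <= r by rewrite (le_trans (cabs_ge0 z0)) // ltW.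
by apply: le_trans (cabs_ge _ _); rewrite cabs_circ.
Qed.

(** For [c = circ r t], twice the real part of [c] times the conjugate of [c - z0] exceeds
    [|c - z0|^2] by exactly [|c|^2 - |z0|^2]. *)
Lemma Re_circ_div (z0 : R[i]) (r t : R) : cabs z0 < r ->
  2^-1 <= Re (circ r t / (circ r t - z0)).
Proof.
move=> z0r; have r0 : 0 <= r by rewrite (le_trans (cabs_ge0 z0)) // ltW.
have : circ r t - z0 != 0.
  by rewrite -cabs_gt0; apply: lt_le_trans (circ_sub _ z0r); rewrite subr_gt0.
have : cabs z0 ^+ 2 <= cabs (circ r t) ^+ 2.
  by rewrite cabs_circ // ler_sqr ?nnegrE ?cabs_ge0 // ltW.
case: (circ r t) z0 {z0r} => [a b] [x y].
rewrite /cabs !sqr_sqrtr ?addr_ge0 ?sqr_ge0 // => le ne.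
rewrite eq_complex /= negb_and in ne.
have q0 : 0 < (a - x) ^+ 2 + (b - y) ^+ 2.
  rewrite lt_neqAle addr_ge0 ?sqr_ge0 // andbT eq_sym paddr_eq0 ?sqr_ge0 //.
  by rewrite !sqrf_eq0 negb_and.
have -> : Re ((a +i* b)%C / ((a +i* b)%C - (x +i* y)%C)) =
    (a * (a - x) + b * (b - y)) / ((a - x) ^+ 2 + (b - y) ^+ 2).
  have -> : ((a +i* b)%C - (x +i* y)%C)^-1 =
    ((a - x) / ((a - x) ^+ 2 + (b - y) ^+ 2) +i*
      (- ((b - y) / ((a - x) ^+ 2 + (b - y) ^+ 2))))%C by [].
  by simpc => /=; rewrite !mulrA -?mulNr -?mulrDl; ring.
rewrite ler_pdivlMr //; nra.
Qed.

Lemma derivable_kernel (F : R[i] -> R[i]) z0 w : holo F -> w - z0 != 0 ->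
  derivable ((fun z => F z / (z - z0)) : R[i]^o -> R[i]^o) w 1.
Proof.
move=> hF wz; apply: derivableM; first exact: hF.
by apply: derivableV => //; apply: derivableB.
Qed.

(** The integral over [t] of the real part of [F (star z0 r s t) * circ / (circ - z0)] does not
    depend on [s]. At [s = 0] it is at most [2 pi * C * M]; as [s] goes to [-oo] its integrand tends
    to [F z0], a nonnegative real, times a kernel of real part at least 1/2. A lower bound on the
    kernel replaces the exact value of its integral, at the price of the factor [2 * C]. *)
Lemma weak_max_real (F : R[i] -> R[i]) (z0 : R[i]) (r M : R) : holo F ->
  cabs z0 < r -> (forall t, 0 <= t -> cabs (F (circ r t)) <= M) ->
  F z0 = (cabs (F z0))%:C%C ->
  cabs (F z0) <= 2 * (r / (r - cabs z0)) * M.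
Proof.
move=> hF z0r FM Fz0; have r0 : 0 <= r by rewrite (le_trans (cabs_ge0 z0)) // ltW.
pose C := r / (r - cabs z0).
have rz : 0 < r - cabs z0 by rewrite subr_gt0.
have C0 : 0 <= C by rewrite divr_ge0 // ltW.
have M0 : 0 <= M by apply: le_trans (FM 0 (lexx 0)); exact: cabs_ge0.
pose G z := F z / (z - z0).
have Gd s t : derivable (G : R[i]^o -> R[i]^o) (star z0 r s t) 1.
  by apply: derivable_kernel => //; exact: star_neq.
pose a t s := Im (G (star z0 r s t) * star_ds z0 r s t).
pose b s t := Im (G (star z0 r s t) * star_dt r s t).
have ca t : continuous (a t).
  move=> s; have [dR dI] := is_derive_star_s z0 r t s.
  have [cR cI] := ccont_comp (g := fun u => star z0 r u t) (derivable_ccont_at (Gd s t))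
    (is_derive_continuous dR) (is_derive_continuous dI).
  have -> : a t = (fun u => Re (G (star z0 r u t))) * (expR * cst (Im (circ r t - z0)))
       + (fun u => Im (G (star z0 r u t))) * (expR * cst (Re (circ r t - z0))).
    apply/funext => u; rewrite /a /star_ds !fctE.
    case: (G _) (circ r t - z0) => [g1 g2] [q1 q2]; simpc => /=; ring.
  apply: continuousD; apply: continuousM => //; apply: continuousM;
    solve [exact: cvg_cst | exact: continuous_expR].
have cb s : continuous (b s).
  move=> t; have [dR dI] := is_derive_star_t z0 r s t.
  have [cR cI] := ccont_comp (g := fun u => star z0 r s u) (derivable_ccont_at (Gd s t))
    (is_derive_continuous dR) (is_derive_continuous dI).
  have -> : b s = (fun u => Re (G (star z0 r s u))) * (cos * cst (expR s * r))
       - (fun u => Im (G (star z0 r s u))) * (sin * cst (expR s * r)).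
    apply/funext => u; rewrite /b /star_dt !fctE /circ.
    case: (G _) => [g1 g2]; simpc => /=; ring.
  apply: continuousB; apply: continuousM => //; apply: continuousM;
    solve [exact: cvg_cst | exact: continuous_cos | exact: continuous_sin].
(* Primitives are picked for all integrands at once, since [A] and [B] have to be functions of [t]
   and [s]. *)
have /choice [prim primP] : forall fa : (R -> R) * R, exists P : R -> R,
    continuous fa.1 -> forall x : R, fa.2 < x -> is_derive x 1 P (fa.1 x).
  move=> [f u]; have [cf|ncf] := pselect (continuous f).
    by have [P HP] := primitive_exists u cf; exists P.
  by exists f.
(* Goursat's lemma for [s] in [[-L, 0]] and [t] in [[0, 2 pi]]: the sides [t = 0] and [t = 2 pi]
   cancel by periodicity, which leaves equal integrals over the two circles. *)
have hB (L : R) : 0 <= L -> exists B : R -> R -> R,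
    (forall s (t : R), 0 <= t <= pi *+ 2 -> is_derive t 1 (B s) (b s t)) /\
    B 0 (pi *+ 2) - B 0 0 = B (- L) (pi *+ 2) - B (- L) 0.
  move=> L0; pose A t := prim (a t, - L - 1); pose B s := prim (b s, -1).
  have dA (t s : R) : - L <= s -> is_derive s 1 (A t) (a t s).
    move=> Ls; apply: (primP (a t, - L - 1) (ca t)) => /=; lra.
  have dB (s t : R) : 0 <= t -> is_derive t 1 (B s) (b s t).
    move=> Ls; apply: (primP (b s, -1) (cb s)) => /=; lra.
  exists B; split; first by move=> s t /andP[t0 _]; exact: dB.
  have A2pi : A (pi *+ 2) = A 0.
    by rewrite /A /a /star /star_ds /circ -(add0r (pi *+ 2)) cosD2pi sinD2pi.
  have pi0 : 0 <= (pi : R) *+ 2 by rewrite mulrn_wge0 // pi_ge0.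
  suff : rect_inc A B (- L) (- L + L) 0 (0 + pi *+ 2) = 0.
    rewrite /rect_inc addNr add0r A2pi subrr; lra.
  apply: rect_inc_eq0 => // p q pP qP e e0.
  rewrite addNr in pP; rewrite add0r in qP.
  have [D HD] := derivable_approx (Gd p q).
  (* [K * h] bounds the distance from [z] to the image of a rectangle of scale [h], and the images
     of the four edges have total length at most [2 * K * h]. Hence the product [2 * K * K] in
     [e1]. *)
  pose K := 2 * r * (L + pi *+ 2) : R.
  have Lpi : 0 <= L + pi *+ 2 by rewrite addr_ge0.
  have K0 : 0 <= K by rewrite !mulr_ge0.
  pose e1 := e / (2 * K * K + 1).
  have KK : 0 < 2 * K * K + 1 by rewrite ltr_wpDl // !mulr_ge0.
  have e10 : 0 < e1 by rewrite divr_gt0.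
  have [d d0 dP] := HD _ e10.
  have K1 : 0 < K + 1 by rewrite ltr_wpDl.
  exists (d / (K + 1)); first by rewrite divr_gt0.
  move=> s t h h0; rewrite ltr_pdivlMr // => hd Ls s0 t0 t2pi sp tq.
  rewrite addNr in s0; rewrite add0r in t2pi.
  pose z := star z0 r p q.
  have Lh : 0 <= L * h by rewrite mulr_ge0 // ltW.
  have ph : 0 <= pi *+ 2 * h by rewrite mulr_ge0 // ltW.
  have near (u v : R) : s <= u <= s + L * h -> t <= v <= t + pi *+ 2 * h ->
      cabs (star z0 r u v - z) <= K * h.
    move=> us vt; apply: le_trans (star_lip _ _ z0r _ _) _; [lra|lra|].
    rewrite /K -(mulrA (2 * r)) ler_wpM2l //; first by rewrite mulr_ge0.
    have : `|u - p| <= L * h by rewrite ler_norml; lra.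
    have : `|v - q| <= pi *+ 2 * h by rewrite ler_norml; lra.
    rewrite mulrDl; lra.
  have appr (u v : R) : s <= u <= s + L * h -> t <= v <= t + pi *+ 2 * h ->
      cabs (G (star z0 r u v) - G z - D * (star z0 r u v - z)) <=
        e1 * cabs (star z0 r u v - z).
    move=> us vt; apply: dP; apply: le_lt_trans (near _ _ us vt) _.
    apply: le_lt_trans hd; rewrite mulrDr mulr1 mulrC lerDl; exact: ltW.
  have dsb (u v : R) : s <= u <= s + L * h -> cabs (star_ds z0 r u v) <= 2 * r.
    move=> us; rewrite cabsM cabs_real (ger0_norm (expR_ge0 _)) -[leRHS]mul1r.
    apply: ler_pM; rewrite ?expR_ge0 ?cabs_ge0 ?expR_le1 //; first lra.
    by apply: le_trans (cabsB _ _) _; rewrite cabs_circ // mulr2n mulrDl mul1r lerD2l ltW.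
  have dtb (u v : R) : s <= u <= s + L * h -> cabs (star_dt r u v) <= 2 * r.
    move=> us; rewrite !cabsM cabs_real (ger0_norm (expR_ge0 _)) -[leRHS]mul1r.
    apply: ler_pM; rewrite ?expR_ge0 ?mulr_ge0 ?cabs_ge0 ?expR_le1 //; first lra.
    rewrite cabs_circ // /cabs /= expr0n add0r expr1n sqrtr1 mul1r; lra.
  have edgeA (v : R) : t <= v <= t + pi *+ 2 * h ->
    `|(A v (s + L * h) - A v s) - (affine_prim (G z) D z (star z0 r (s + L * h) v) -
        affine_prim (G z) D z (star z0 r s v))| <= e1 * (K * h) * (2 * r) * (L * h).
    move=> vt; rewrite [X in _ <= _ * X](_ : _ = s + L * h - s); last by rewrite addrC addKr.
    have Hs : s <= s + L * h by rewrite lerDl.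
    have H := @contour_edge R G (fun u => star z0 r u v) (fun u => star_ds z0 r u v)
      (A v) s (s + L * h) (G z) D z e1 (K * h) (2 * r) Hs (ltW e10).
    have {}H := H (fun u us => dA v u (le_trans Ls (proj1 (andP us)))).
    have {}H := H (fun u => (is_derive_star_s z0 r v u).1)
      (fun u => (is_derive_star_s z0 r v u).2).
    exact: (H (fun u us => appr u v us vt) (fun u us => near u v us vt)
      (fun u us => dsb u v us)).
  have edgeB (u : R) : s <= u <= s + L * h ->
    `|(B u (t + pi *+ 2 * h) - B u t) -
       (affine_prim (G z) D z (star z0 r u (t + pi *+ 2 * h)) -
        affine_prim (G z) D z (star z0 r u t))| <=
      e1 * (K * h) * (2 * r) * (pi *+ 2 * h).
    move=> us; rewrite [X in _ <= _ * X](_ : _ = t + pi *+ 2 * h - t); last by rewrite addrC addKr.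
    have Ht : t <= t + pi *+ 2 * h by rewrite lerDl.
    have H := @contour_edge R G (fun v => star z0 r u v) (fun v => star_dt r u v)
      (B u) t (t + pi *+ 2 * h) (G z) D z e1 (K * h) (2 * r) Ht (ltW e10).
    have {}H := H (fun v vt => dB u v (le_trans t0 (proj1 (andP vt)))).
    have {}H := H (fun v => (is_derive_star_t z0 r u v).1)
      (fun v => (is_derive_star_t z0 r u v).2).
    exact: (H (fun v vt => appr u v us vt) (fun v vt => near u v us vt)
      (fun v vt => dtb u v us)).
  have t1 : t <= t <= t + pi *+ 2 * h by lra.
  have t2 : t <= t + pi *+ 2 * h <= t + pi *+ 2 * h by lra.
  have s1 : s <= s <= s + L * h by lra.
  have s2 : s <= s + L * h <= s + L * h by lra.
  move: (edgeA _ t1) (edgeA _ t2) (edgeB _ s1) (edgeB _ s2).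
  set x1 := (X in `|X|); set x2 := (X in _ -> `|X| <= _ -> _).
  set x3 := (X in _ -> _ -> `|X| <= _ -> _).
  set x4 := (X in _ -> _ -> _ -> `|X| <= _ -> _) => X1 X2 X3 X4.
  have -> : rect_inc A B s (s + L * h) t (t + pi *+ 2 * h) = x1 - x2 + x4 - x3.
    by rewrite /rect_inc /x1 /x2 /x3 /x4; ring.
  have tot : e1 * (K * h) * (2 * r) * (L * h) + e1 * (K * h) * (2 * r) * (L * h) +
     e1 * (K * h) * (2 * r) * (pi *+ 2 * h) + e1 * (K * h) * (2 * r) * (pi *+ 2 * h)
     <= e * h ^+ 2.
    have -> : e1 * (K * h) * (2 * r) * (L * h) + e1 * (K * h) * (2 * r) * (L * h) +
     e1 * (K * h) * (2 * r) * (pi *+ 2 * h) + e1 * (K * h) * (2 * r) * (pi *+ 2 * h)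
     = e1 * (2 * K * K) * h ^+ 2 by rewrite /K; ring.
    rewrite ler_wpM2r ?sqr_ge0 // /e1 mulrAC ler_pdivrMr // ler_wpM2l ?(ltW e0) //.
    by rewrite lerDl.
  have := ler_normB (x1 - x2 + x4) x3; have := ler_normD (x1 - x2) x4.
  have := ler_normB x1 x2; lra.
have low (e L : R) : 0 < e -> 0 <= L ->
    (forall w, cabs (w - z0) <= 2 * r * expR (- L) -> cabs (F w - F z0) <= e) ->
    cabs (F z0) / 2 - e * C <= M * C.
  move=> e0 L0 Fe; have [B [dB BE]] := hB L L0.
  have pi0 : 0 < (pi : R) *+ 2 by rewrite mulrn_wgt0 // pi_gt0.
  have cq t : cabs (circ r t / (circ r t - z0)) <= C.
    rewrite cabsM cabsV cabs_circ // ler_wpM2l // lef_pV2 ?posrE //.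
      exact: circ_sub.
    by apply: lt_le_trans (circ_sub _ z0r).
  (* The factors [expR s] of [star_dt] and of [star - z0] cancel, so the kernel is the same on all
     the circles; this is why the homotopy is exponential in [s]. *)
  have bE s t : b s t = Re (F (star z0 r s t) * (circ r t / (circ r t - z0))).
    have es : (expR s)%:C%C != 0 :> R[i] by rewrite eq_complex /= negb_and gt_eqF ?expR_gt0.
    have qn : circ r t - z0 != 0.
      by rewrite -cabs_gt0; apply: lt_le_trans (circ_sub _ z0r).
    rewrite /b /G /star_dt {2}/star addrC addKr.
    have -> : F (star z0 r s t) / ((expR s)%:C%C * (circ r t - z0)) *
      ((expR s)%:C%C * ((0 +i* 1)%C * circ r t)) =
      F (star z0 r s t) * (circ r t / (circ r t - z0)) * (0 +i* 1)%C.
      by field; rewrite es qn.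
    by rewrite ImiRe.
  rewrite -(ler_pM2r pi0) -[X in _ <= _ * X]subr0 -[X in _ * X <= _]subr0.
  apply: (@le_trans _ _ (B 0 (pi *+ 2) - B 0 0)).
    rewrite BE; apply: (@mv_lower _ (B (- L)) (b (- L))); [exact: ltW|move=> t _].
    rewrite bE.
    have -> : F (star z0 r (- L) t) * (circ r t / (circ r t - z0)) =
       F z0 * (circ r t / (circ r t - z0)) +
       (F (star z0 r (- L) t) - F z0) * (circ r t / (circ r t - z0)) by ring.
    rewrite raddfD /=; apply: lerD.
      rewrite {2}Fz0; have := Re_circ_div t z0r.
      case: (circ r t / _) => [x y] /= h; rewrite mul0r subr0.
      by rewrite ler_wpM2l // cabs_ge0.
    rewrite lerNl; apply: le_trans (ler_norm _) _; rewrite normrN.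
    apply: le_trans (Re_cabs _) _; rewrite cabsM; apply: ler_pM; rewrite ?cabs_ge0 //.
    apply: Fe; rewrite /star addrC addKr cabsM cabs_real ger0_norm ?expR_ge0 //.
    rewrite mulrC ler_wpM2r ?expR_ge0 //.
    by apply: le_trans (cabsB _ _) _; rewrite cabs_circ // mulr2n mulrDl mul1r lerD2l ltW.
  apply: le_trans (ler_norm _) _.
  apply: (@mv_bound _ (B 0) (b 0)); first exact: ltW.
  move=> t /andP[t0 _]; rewrite bE; apply: le_trans (Re_cabs _) _; rewrite cabsM.
  apply: ler_pM; rewrite ?cabs_ge0 //.
  by rewrite /star expR0 mul1r addrC subrK; exact: FM.
rewrite -/C -mulrA [C * M]mulrC; apply/ler_addgt0Pr => e e0.
have C1 : 0 < 2 * C + 1 by rewrite ltr_wpDl // mulr_ge0.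
have [d d0 dP] := derivable_ccont_at (hF z0) (divr_gt0 e0 C1).
have r1 : 0 < 2 * r + 1 by rewrite ltr_wpDl // mulr_ge0.
(* [x] is the value of [expR (- L)]: being at most 1 it gives [0 <= L], and the other bound puts the
   inner circle within [d] of [z0]. *)
pose x := Num.min 1 (d / (2 * r + 1)).
have x0 : 0 < x by rewrite lt_min ltr01 divr_gt0.
have x1 : x <= 1 by rewrite ge_min lexx.
have := low (e / (2 * C + 1)) (- ln x) (divr_gt0 e0 C1).
rewrite oppr_ge0 ln_le0 // opprK lnK // => /(_ isT).
have H w : cabs (w - z0) <= 2 * r * x -> cabs (F w - F z0) <= e / (2 * C + 1).
  move=> wx; apply/ltW/dP; apply: le_lt_trans wx _.
  have : x <= d / (2 * r + 1) by rewrite ge_min lexx orbT.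
  rewrite ler_pdivlMr //; lra.
move=> /(_ H); have : e / (2 * C + 1) * C * 2 <= e.
  rewrite (_ : _ * 2 = e * (2 * C) / (2 * C + 1)); last by ring.
  by rewrite ler_pdivrMr // ler_wpM2l ?(ltW e0) // lerDl.
lra.
Qed.

End MaximumPrinciple.

(** * The maximum principle for sums over roots of unity *)

Section RotatedSums.
Variable R : realType.

Lemma holo_prod (I : finType) (P : pred I) (F : I -> R[i] -> R[i]) :
  (forall i, holo (F i)) -> holo (fun z => \prod_(i | P i) F i z).
Proof.
move=> hF z; elim: (index_enum I) => [|i s IH].
  have -> : (fun z => \prod_(i <- [::] | P i) F i z) = fun=> 1.
    by apply/funext => w; rewrite big_nil.
  exact: derivable_cst.
case Pi : (P i); last first.
  have -> : (fun z => \prod_(i <- i :: s | P i) F i z) =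
      fun z => \prod_(i <- s | P i) F i z.
    by apply/funext => w; rewrite big_cons Pi.
  exact: IH.
have -> : (fun z => \prod_(i <- i :: s | P i) F i z) =
    fun z => F i z * \prod_(i <- s | P i) F i z.
  by apply/funext => w; rewrite big_cons Pi.
exact: (derivableM (hF i z) IH).
Qed.

Lemma holo_exp (F : R[i] -> R[i]) n : holo F -> holo (fun z => F z ^+ n).
Proof.
move=> hF z; elim: n => [|n IH]; first exact: derivable_cst.
have -> : (fun z => F z ^+ n.+1) = fun z => F z * F z ^+ n.
  by apply/funext => w; rewrite exprS.
exact: (derivableM (hF z) IH).
Qed.

(** A constant factor of modulus 1 makes the value at [z0] a nonnegative real. *)
Lemma weak_max (F : R[i] -> R[i]) (z0 : R[i]) (r M : R) : holo F ->
  cabs z0 < r -> (forall t, 0 <= t -> cabs (F (circ r t)) <= M) ->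
  cabs (F z0) <= 2 * (r / (r - cabs z0)) * M.
Proof.
move=> hF z0r FM.
have [F0|F0] := eqVneq (F z0) 0.
  rewrite F0 cabs0 !mulr_ge0 //.
  - by rewrite (le_trans (cabs_ge0 z0)) // ltW.
  - by rewrite invr_ge0 subr_ge0 ltW.
  - by apply: le_trans (FM 0 (lexx 0)); exact: cabs_ge0.
pose c := (cabs (F z0))%:C%C / F z0.
have c1 : cabs c = 1.
  by rewrite cabsM cabsV cabs_real ger0_norm ?cabs_ge0 // mulfV // cabs_eq0.
have hc : holo (fun z => c * F z).
  move=> z; have hcst : derivable (fun=> c : R[i]^o) z 1 by exact: derivable_cst.
  exact: (derivableM hcst (hF z)).
have cM t : 0 <= t -> cabs (c * F (circ r t)) <= M.
  by move=> t0; rewrite cabsM c1 mul1r; exact: FM.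
have cx z : cabs (c * F z) = cabs (F z) by rewrite cabsM c1 mul1r.
have cF : c * F z0 = (cabs (c * F z0))%:C%C by rewrite cx /c mulfVK.
by rewrite -(cx z0); exact: (weak_max_real hc z0r cM cF).
Qed.

(* Applying the weak bound to the powers of [F] removes the constant. *)
Lemma max_principle (F : R[i] -> R[i]) (z0 : R[i]) (r M : R) : holo F ->
  cabs z0 < r -> (forall t, 0 <= t -> cabs (F (circ r t)) <= M) ->
  cabs (F z0) <= M.
Proof.
move=> hF z0r FM; have [//|Mx] := leP (cabs (F z0)) M; exfalso.
have M0 : 0 <= M by apply: le_trans (FM 0 (lexx 0)); exact: cabs_ge0.
have x0 : 0 < cabs (F z0) by exact: le_lt_trans Mx.
pose C := 2 * (r / (r - cabs z0)).
have C0 : 0 <= C.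
  rewrite !mulr_ge0 ?invr_ge0 ?subr_ge0 ?(ltW z0r) //.
  by rewrite (le_trans (cabs_ge0 z0)) // ltW.
have pw n : 1 <= C * (M / cabs (F z0)) ^+ n.
  have H : cabs (F z0) ^+ n <= C * M ^+ n.
    have Fn t : 0 <= t -> cabs (F (circ r t) ^+ n) <= M ^+ n.
      by move=> t0; rewrite cabsX lerXn2r ?nnegrE ?cabs_ge0 // FM.
    by rewrite -cabsX; exact: (weak_max (holo_exp (n := n) hF) z0r Fn).
  by rewrite expr_div_n mulrA ler_pdivlMr ?exprn_gt0 // mul1r.
have /cvgrPdist_lt : (fun n => (M / cabs (F z0)) ^+ n) @ \oo --> (0 : R).
  by apply: cvg_expr; rewrite ger0_norm ?divr_ge0 ?cabs_ge0 // ltr_pdivrMr // mul1r.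
have C1 : 0 < C + 1 by rewrite ltr_wpDl.
move=> /(_ (C + 1)^-1); rewrite invr_gt0 => /(_ C1) [n _ /(_ n (leqnn n))] /=.
rewrite sub0r normrN ger0_norm ?exprn_ge0 ?divr_ge0 ?cabs_ge0 // => lt.
have := pw n; apply/negP; rewrite -ltNge.
have : C * (M / cabs (F z0)) ^+ n <= C * (C + 1)^-1 by rewrite ler_wpM2l // ltW.
move=> /le_lt_trans; apply; rewrite ltr_pdivrMr // mul1r; lra.
Qed.

Lemma logplus_ge0 (x : R) : 0 <= logplus x.
Proof. by rewrite /logplus; case: ltP => // x1; rewrite ln_ge0 // ltW. Qed.

Lemma logplusE (x : R) : logplus x = ln (Num.max 1 x).
Proof. by rewrite /logplus; case: ltP => x1; rewrite ?ln1. Qed.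

Lemma ln_prod (I : finType) (F : I -> R) : (forall i, 0 < F i) ->
  ln (\prod_i F i) = \sum_i ln (F i).
Proof.
move=> F0; suff [] : ln (\prod_i F i) = \sum_i ln (F i) /\ 0 < \prod_i F i by [].
elim/big_rec2: _ => [|i y1 y2 _ [E p]]; first by rewrite ln1.
by rewrite lnM ?posrE // E mulr_gt0.
Qed.

(* The product of the [max 1 |F k|] is the maximum of the moduli of the products of the
   subfamilies of [F]. *)
Lemma max_principle_logplus (I : finType) (F : I -> R[i] -> R[i]) (z0 : R[i])
    (r S : R) : (forall i, holo (F i)) -> cabs z0 < r ->
  (forall t, 0 <= t -> \sum_i logplus (cabs (F i (circ r t))) <= S) ->
  \sum_i logplus (cabs (F i z0)) <= S.
Proof.
move=> hF z0r FS.
have mx0 (x : R) : 0 < Num.max 1 x by rewrite lt_max ltr01.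
have lnE z : \sum_i logplus (cabs (F i z)) = ln (\prod_i Num.max 1 (cabs (F i z))).
  by rewrite ln_prod //; apply: eq_bigr => i _; rewrite logplusE.
have p0 z : 0 < \prod_i Num.max 1 (cabs (F i z)) by apply: prodr_gt0.
rewrite lnE -ler_expR lnK ?posrE //.
(* The subfamily whose product attains the maximum at [z0]; on the circle its product is still at
   most the product of all the [max 1 |F i|]. *)
pose P : pred I := fun i => 1 < cabs (F i z0).
have -> : \prod_i Num.max 1 (cabs (F i z0)) = cabs (\prod_(i | P i) F i z0).
  rewrite cabs_prod (bigID P) /= [X in _ * X]big1 ?mulr1.
    by apply: eq_bigr => i; rewrite /P => /ltW/max_idPr.
  by move=> i; rewrite /P -leNgt => /max_idPl.
apply: (max_principle (F := fun z => \prod_(i | P i) F i z) _ z0r).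
  exact: holo_prod.
move=> t t0; rewrite cabs_prod.
apply: (@le_trans _ _ (\prod_i Num.max 1 (cabs (F i (circ r t))))); last first.
  by rewrite -[leLHS]lnK ?posrE // ler_expR -lnE FS.
rewrite [leRHS](bigID P) /= -[leLHS]mulr1; apply: ler_pM.
- by apply: prodr_ge0 => i _; exact: cabs_ge0.
- by [].
- by apply: ler_prod => i _; rewrite cabs_ge0 le_max lexx orbT.
- elim/big_ind: _ => [//|x y x1 y1|i _]; first exact: mulr_ege1.
  by rewrite le_max lexx.
Qed.

Lemma circM (r s t u : R) : circ r t * circ s u = circ (r * s) (t + u).
Proof. by rewrite /circ cosD sinD; simpc; congr Complex; ring. Qed.

Lemma circD2pi (r t : R) : circ r (t + pi *+ 2) = circ r t.
Proof. by rewrite /circ cosD2pi sinD2pi. Qed.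

Lemma holo_scale (g : R[i] -> R[i]) (c : R[i]) : holo g -> holo (fun z => g (z * c)).
Proof.
move=> hg z; apply/derivable1_diffP.
have hs : differentiable ((fun z => z * c) : R[i]^o -> R[i]^o) z.
  apply/derivable1_diffP.
  have hcst : derivable (fun=> c : R[i]^o) z 1 by exact: derivable_cst.
  have hid : derivable (id : R[i]^o -> R[i]^o) z 1 by exact: derivable_id.
  exact: (derivableM hid hcst).
have hgz : differentiable (g : R[i]^o -> R[i]^o) (z * c).
  by apply/derivable1_diffP; exact: hg.
exact: (differentiable_comp hs hgz).
Qed.

Lemma entire_line (m : nat) (f : 'rV[R[i]]_m -> R[i]) (z v : 'rV[R[i]]_m) :
  entire f -> holo (fun l => f (z + l *: v)).
Proof.
move=> ef l; apply/derivable1_diffP.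
have hs : differentiable ((fun l => z + l *: v) : R[i]^o -> 'rV[R[i]]_m) l.
  apply: differentiableD; first exact: differentiable_cst.
  exact: differentiableZl.
exact: (differentiable_comp hs (ef _)).
Qed.

Definition root1 (N : nat) (k : nat) : R[i] := circ 1 (pi *+ 2 * (k%:R / N%:R)).

(** Rotating by [2 pi / N] permutes the roots cyclically; an induction step moves the last term to
    the front. *)
Lemma rotated_sum_periodic (N j : nat) (phi : R[i] -> R) (r t : R) : (0 < N)%N ->
  \sum_(k < N) phi (circ r (t + pi *+ 2 * (j%:R / N%:R)) * root1 N k) =
  \sum_(k < N) phi (circ r t * root1 N k).
Proof.
case: N => // N _; elim: j t => [|j IH] t; first by rewrite mul0r mulr0 addr0.
have -> : t + pi *+ 2 * (j.+1%:R / N.+1%:R) =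
  (t + pi *+ 2 * (1 / N.+1%:R)) + pi *+ 2 * (j%:R / N.+1%:R).
  by rewrite -addrA -mulrDr -mulrDl -natr1 [1 + _]addrC.
rewrite IH big_ord_recr big_ord_recl /= addrC; congr (_ + _).
  congr phi; rewrite /root1 !circM mul0r mulr0 addr0 -addrA -mulrDr -mulrDl nat1r.
  by rewrite mulfV ?pnatr_eq0 // !mulr1 circD2pi.
apply: eq_bigr => k _; congr phi.
by rewrite /root1 !circM -addrA -mulrDr -mulrDl nat1r.
Qed.

(** By periodicity the bound is only asked on an arc of angle [2 pi / N], short enough for
    continuity to replace [circ r t] by [r]. *)
Lemma rotated_sum_le (g : R[i] -> R[i]) (N : nat) (z0 : R[i]) (r S : R) :
  (0 < N)%N -> holo g -> cabs z0 < r ->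
  (forall t, 0 <= t <= pi *+ 2 / N%:R ->
     \sum_(k < N) logplus (cabs (g (circ r t * root1 N k))) <= S) ->
  \sum_(k < N) logplus (cabs (g (z0 * root1 N k))) <= S.
Proof.
move=> N0 hg z0r gS.
apply: (max_principle_logplus (F := fun (k : 'I_N) z => g (z * root1 N k)) _ z0r).
  by move=> k; exact: holo_scale.
move=> t t0.
have N0' : 0 < N%:R :> R by rewrite ltr0n.
have pi0 : 0 < pi *+ 2 :> R by rewrite mulrn_wgt0 // pi_gt0.
have p0 : 0 < (pi *+ 2 / N%:R : R) by rewrite divr_gt0.
pose j := Num.truncn (t / (pi *+ 2 / N%:R)).
have /andP[j1 j2] := truncn_itv (divr_ge0 t0 (ltW p0)); rewrite -/j in j1 j2.
rewrite ler_pdivlMr // in j1; rewrite ltr_pdivrMr // in j2.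
have -> : t = (t - pi *+ 2 * (j%:R / N%:R)) + pi *+ 2 * (j%:R / N%:R) by rewrite subrK.
rewrite (rotated_sum_periodic j (fun w => logplus (cabs (g w)))) //; apply: gS.
rewrite subr_ge0 lerBlDr.
have e1 : pi *+ 2 * (j%:R / N%:R) = j%:R * (pi *+ 2 / N%:R) :> R by ring.
rewrite e1 j1 /=; move/ltW: j2; rewrite -natr1 mulrDl mul1r; lra.
Qed.

End RotatedSums.

(** * Iterated integrals *)

Section IteratedIntegral.
Variable R : realType.
Local Notation mR := (measurableTypeR R).
Local Notation leb := (@lebesgue_measure R).
Implicit Types (F G : seq R -> \bar R) (k : nat).
Local Open Scope ereal_scope.

Definition kmeas k F := measurable_fun setT (fun t : k.-tuple mR => F t).

Lemma iter_int_ge0 k F : (forall s, 0 <= F s) -> 0 <= iter_int k F.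
Proof.
elim: k F => [|k IH] F F0 //=; apply: integral_ge0 => t _; exact: IH.
Qed.

(** The parameter space is arbitrary so that the induction can move the first variable of
    integration into it and apply Tonelli's theorem. *)
Lemma measurable_iter_int (d : measure_display) (X : measurableType d) k
    (F : X -> seq R -> \bar R) : (forall x s, 0 <= F x s) ->
  measurable_fun setT (fun p : X * k.-tuple mR => F p.1 p.2) ->
  measurable_fun setT (fun x => iter_int k (F x)).
Proof.
elim: k d X F => [|k IH] d X F F0 mF /=.
  have m0 : measurable_fun setT (fun x : X => (x, [tuple] : 0.-tuple mR)).
    by apply/measurable_fun_pairP; split; [exact: measurable_id|exact: measurable_cst].
  exact: (measurableT_comp mF m0).
have m1 : measurable_fun setT (fun p : (X * mR) * k.-tuple mR =>
    (p.1.1, [the k.+1.-tuple mR of p.1.2 :: p.2])).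
  apply/measurable_fun_pairP; split.
    exact: (measurableT_comp measurable_fst measurable_fst).
  apply: measurable_cons; last exact: measurable_snd.
  exact: (measurableT_comp measurable_snd measurable_fst).
have m2 := IH _ (X * mR)%type (fun p s => F p.1 (p.2 :: s))
  (fun p s => F0 _ _) (measurableT_comp mF m1).
have F0' (x : X * mR) : 0 <= iter_int k (fun s => F x.1 (x.2 :: s)).
  exact: iter_int_ge0.
exact: (@measurable_fun_fubini_tonelli_F _ _ _ _ _ leb _ m2 F0').
Qed.

Lemma eq_iter_int k F G : (forall s, size s = k -> F s = G s) ->
  iter_int k F = iter_int k G.
Proof.
elim: k F G => [|k IH] F G FG /=; first exact: FG.
by apply: eq_integral => t _; apply: IH => s ss; apply: FG; rewrite /= ss.
Qed.

Lemma kmeas_cons k F t : kmeas k.+1 F -> kmeas k (fun s => F (t :: s)).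
Proof.
move=> mF.
have m1 : measurable_fun setT (fun p : k.-tuple mR => [the k.+1.-tuple mR of t :: p]).
  by apply: (@measurable_cons _ _ _ _ (fun=> t) k id); [exact: measurable_cst|exact: measurable_id].
exact: (measurableT_comp mF m1).
Qed.

Lemma kmeas_iter k F : (forall s, 0 <= F s) -> kmeas k.+1 F ->
  measurable_fun setT (fun t : mR => iter_int k (fun s => F (t :: s))).
Proof.
move=> F0 mF; apply: (@measurable_iter_int _ mR k (fun t s => F (t :: s))) => //.
have m1 : measurable_fun setT (fun p : mR * k.-tuple mR => [the k.+1.-tuple mR of p.1 :: p.2]).
  exact: (measurable_cons measurable_fst measurable_snd).
exact: (measurableT_comp mF m1).
Qed.

Lemma kmeas_iter2 k F : (forall s, 0 <= F s) -> kmeas k.+2 F ->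
  measurable_fun setT (fun p : mR * mR => iter_int k (fun s => F (p.1 :: p.2 :: s))).
Proof.
move=> F0 mF; apply: (@measurable_iter_int _ (mR * mR)%type k (fun p s => F (p.1 :: p.2 :: s))) => //.
have m1 : measurable_fun setT (fun p : (mR * mR) * k.-tuple mR =>
    [the k.+2.-tuple mR of p.1.1 :: [the k.+1.-tuple mR of p.1.2 :: p.2]]).
  apply: measurable_cons; first exact: (measurableT_comp measurable_fst measurable_fst).
  apply: measurable_cons; last exact: measurable_snd.
  exact: (measurableT_comp measurable_snd measurable_fst).
exact: (measurableT_comp mF m1).
Qed.

Lemma le_iter_int k F G : kmeas k F -> kmeas k G -> (forall s, 0 <= F s) ->
  (forall s, 0 <= G s) ->
  (forall s, size s = k -> F s <= G s) -> iter_int k F <= iter_int k G.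
Proof.
elim: k F G => [|k IH] F G mF mG F0 G0 FG /=; first exact: FG.
apply: ge0_le_integral => //.
- by move=> t _; exact: iter_int_ge0.
- exact: kmeas_iter.
- exact: kmeas_iter.
- move=> t _; apply: IH => //; try exact: kmeas_cons.
  by move=> s ss; apply: FG; rewrite /= ss.
Qed.

Lemma iter_intD k F G : kmeas k F -> kmeas k G -> (forall s, 0 <= F s) ->
  (forall s, 0 <= G s) ->
  iter_int k (fun s => F s + G s) = iter_int k F + iter_int k G.
Proof.
elim: k F G => [|k IH] F G mF mG F0 G0 //=.
rewrite -ge0_integralD //.
- by apply: eq_integral => t _; apply: IH => //; exact: kmeas_cons.
- by move=> t _; exact: iter_int_ge0.
- exact: kmeas_iter.
- by move=> t _; exact: iter_int_ge0.
- exact: kmeas_iter.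
Qed.

Lemma iter_intZl k F (c : \bar R) : kmeas k F -> (forall s, 0 <= F s) -> 0 <= c ->
  iter_int k (fun s => c * F s) = c * iter_int k F.
Proof.
elim: k F => [|k IH] F mF F0 c0 //=.
rewrite -ge0_integralZl //.
- by apply: eq_integral => t _; apply: IH => //; exact: kmeas_cons.
- exact: kmeas_iter.
- by move=> t _; exact: iter_int_ge0.
Qed.

Lemma iter_int_mct k (F : nat -> seq R -> \bar R) : (forall n, kmeas k (F n)) ->
  (forall n s, 0 <= F n s) -> (forall s, {homo F^~ s : n m / (n <= m)%N >-> n <= m}) ->
  iter_int k (fun s => limn (F^~ s)) = limn (fun n => iter_int k (F n)).
Proof.
elim: k F => [|k IH] F mF F0 homF //=.
have -> : \int[leb]_(t in setT) iter_int k (fun s => limn ((F ^~ (t :: s)))) =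
   \int[leb]_(t in setT) limn (fun n => iter_int k (fun s => F n (t :: s))).
  by apply: eq_integral => t _; rewrite (IH (fun n s => F n (t :: s))) // => n; exact: kmeas_cons.
rewrite (@monotone_convergence _ _ _ leb setT _ (fun n t => iter_int k (fun s => F n (t :: s)))) //.
- by move=> n; exact: kmeas_iter.
- by move=> n t _; exact: iter_int_ge0.
- move=> t _ n m nm; apply: le_iter_int => //; try exact: kmeas_cons.
  by move=> s _; exact: homF.
Qed.

End IteratedIntegral.

(** * Affine maps and rotations under iterated integrals *)

Section ChangeOfVariables.
Variable R : realType.
Local Notation mR := (measurableTypeR R).
Local Notation leb := (@lebesgue_measure R).
Implicit Types (F : seq R -> \bar R) (k : nat).

Lemma measurable_affine (c b : R) : measurable_fun [set: mR] (fun x : mR => c * x + b : mR).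
Proof.
have mid : measurable_fun [set: mR] (fun x : mR => x : R) by exact: measurable_id.
apply: (measurable_funD (f := fun x : mR => c * x : R) (g := fun=> b)).
  exact: (measurable_funM (measurable_cst _) mid).
exact: measurable_cst.
Qed.

(** [c] times the image of Lebesgue measure by the affine map agrees with Lebesgue measure on
    half-open intervals, hence is equal to it. *)
Lemma integral_affine (f : R -> \bar R) (c b : R) : 0 < c ->
  measurable_fun [set: mR] (f : mR -> \bar R) -> (forall x, 0 <= f x)%E ->
  (c%:E * \int[leb]_(x in setT) f (c * x + b)%R = \int[leb]_(x in setT) f x)%E.
Proof.
move=> c0 mf f0; have mphi := measurable_affine c b.
pose push : {measure set mR -> \bar R} :=
  measure_function_pushforward__canonical__measure_function_Measure leb mphi.
pose nu : {measure set mR -> \bar R} := mscale (NngNum (ltW c0)) push.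
have -> : (\int[leb]_(x in setT) f x = \int[nu]_(x in setT) f x)%E.
  apply: eq_measure_integral => A mA _; apply: lebesgue_measure_unique => //.
  move=> _ [[p q] _ <-] /=; rewrite /nu /= /mscale /= /push /= /pushforward.
  have -> : (fun x => c * x + b) @^-1` `]p, q] = `](p - b) / c, (q - b) / c]%classic.
    by apply/seteqP; split=> x /=; rewrite !in_itv /= ltr_pdivrMr // ler_pdivlMr //
      (mulrC x) ltrBlDr lerBrDr.
  rewrite !lebesgue_measure_itv /= !lte_fin ltr_pM2r ?invr_gt0 // ltrD2r.
  case: ifP => pq; last by rewrite mule0.
  by rewrite -!EFinD -EFinM; congr EFin; field; rewrite gt_eqF.
rewrite ge0_integral_mscale //; congr (_ * _)%E.
by rewrite ge0_integral_pushforward.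
Qed.

Definition affine_seq (c : R) (b s : seq R) : seq R :=
  [seq c * p.1 + p.2 | p <- zip s b].

Lemma iter_int_affine k F (c : R) (b : seq R) : 0 < c -> size b = k ->
  kmeas k F -> (forall s, 0 <= F s)%E ->
  ((c ^+ k)%:E * iter_int k (fun s => F (affine_seq c b s)) = iter_int k F)%E.
Proof.
elim: k F b => [|k IH] F [|b0 b] c0 //= bk mF F0; first by rewrite mul1e.
have cE : (c ^+ k.+1)%:E = (c%:E * (c ^+ k)%:E)%E by rewrite -EFinM exprS.
rewrite -(integral_affine b0 c0 (kmeas_iter F0 mF)); last first.
  by move=> x; exact: iter_int_ge0.
rewrite cE -muleA; congr (_ * _)%E.
have ck : ((c ^+ k)%:E * ((c ^+ k)^-1)%:E = 1 :> \bar R)%E.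
  by rewrite -EFinM mulfV // gt_eqF // exprn_gt0.
have -> : (\int[leb]_(t in setT) iter_int k (fun s => F (affine_seq c (b0 :: b) (t :: s))) =
   \int[leb]_(t in setT) (((c ^+ k)^-1)%:E * iter_int k (fun s => F ((c * t + b0)%R :: s))))%E.
  apply: eq_integral => t _; rewrite -(IH (fun s => F ((c * t + b0)%R :: s)) b) //.
  - by rewrite muleA [X in (X * _)%E]muleC ck mul1e.
  - by case: bk.
  - exact: kmeas_cons.
rewrite ge0_integralZl //.
- by rewrite muleA ck mul1e.
- have := measurableT_comp (kmeas_iter F0 mF) (measurable_affine c b0); exact.
- by move=> t _; exact: iter_int_ge0.
- by rewrite lee_fin invr_ge0 exprn_ge0 // ltW.
Qed.

Lemma integral2_shear (H : R -> R -> \bar R) (a : R) :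
  measurable_fun [set: mR * mR] (fun p : mR * mR => H p.1 p.2) ->
  (forall x y, 0 <= H x y)%E ->
  (\int[leb]_(x in setT) \int[leb]_(y in setT) H x (y + a * x)%R =
   \int[leb]_(x in setT) \int[leb]_(y in setT) H x y)%E.
Proof.
move=> mH H0; apply: eq_integral => x _.
have mHx : measurable_fun [set: mR] (fun y : mR => H x y).
  exact: (measurableT_comp mH (measurable_pair1 x)).
rewrite -(@integral_affine (H x) 1 (a * x)) // mul1e.
by apply: eq_integral => y _; rewrite mul1r.
Qed.

Lemma measurable_swap2 (H : R -> R -> \bar R) :
  measurable_fun [set: mR * mR] (fun p : mR * mR => H p.1 p.2) ->
  measurable_fun [set: mR * mR] (fun p : mR * mR => H p.2 p.1).
Proof.
move=> mH; have ms : measurable_fun [set: mR * mR] (fun p : mR * mR => (p.2, p.1)).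
  by apply/measurable_fun_pairP; split; [exact: measurable_snd|exact: measurable_fst].
exact: (measurableT_comp mH ms).
Qed.

Lemma integral2_swap (H : R -> R -> \bar R) :
  measurable_fun [set: mR * mR] (fun p : mR * mR => H p.1 p.2) ->
  (forall x y, 0 <= H x y)%E ->
  (\int[leb]_(x in setT) \int[leb]_(y in setT) H x y =
   \int[leb]_(y in setT) \int[leb]_(x in setT) H x y)%E.
Proof.
move=> mH H0; exact: (@fubini_tonelli _ _ _ _ _ leb leb _ mH (fun p => H0 p.1 p.2)).
Qed.

Lemma measurable_linear2 (H : R -> R -> \bar R) (a b c d : R) :
  measurable_fun [set: mR * mR] (fun p : mR * mR => H p.1 p.2) ->
  measurable_fun [set: mR * mR]
    (fun p : mR * mR => H (a * p.1 + b * p.2) (c * p.1 + d * p.2)).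
Proof.
move=> mH; have m1 : measurable_fun [set: mR * mR] (fun p => p.1 : R) by exact: measurable_fst.
have m2 : measurable_fun [set: mR * mR] (fun p => p.2 : R) by exact: measurable_snd.
have ml (u v : R) : measurable_fun [set: mR * mR] (fun p : mR * mR => (u * p.1 + v * p.2 : mR)).
  exact: (measurable_funD (measurable_funM (measurable_cst u) m1)
    (measurable_funM (measurable_cst v) m2)).
have ms : measurable_fun [set: mR * mR]
    (fun p : mR * mR => (a * p.1 + b * p.2 : mR, c * p.1 + d * p.2 : mR)).
  by apply/measurable_fun_pairP; split; exact: ml.
exact: (measurableT_comp mH ms).
Qed.

(* A rotation is a product of three shears, unless it is [-1], the square of a rotation. *)
Lemma integral2_rot (H : R -> R -> \bar R) (c s : R) : c ^+ 2 + s ^+ 2 = 1 ->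
  measurable_fun [set: mR * mR] (fun p : mR * mR => H p.1 p.2) ->
  (forall x y, 0 <= H x y)%E ->
  (\int[leb]_(x in setT) \int[leb]_(y in setT) H (c * x - s * y)%R (s * x + c * y)%R =
   \int[leb]_(x in setT) \int[leb]_(y in setT) H x y)%E.
Proof.
move=> cs1 mH H0.
have rot H' c' s' : c' ^+ 2 + s' ^+ 2 = 1 -> s' != 0 ->
  measurable_fun [set: mR * mR] (fun p : mR * mR => H' p.1 p.2) ->
  (forall x y, 0 <= H' x y)%E ->
  (\int[leb]_(x in setT) \int[leb]_(y in setT) H' (c' * x - s' * y)%R (s' * x + c' * y)%R =
   \int[leb]_(x in setT) \int[leb]_(y in setT) H' x y)%E.
  (* [al] is minus the tangent of half the angle: the rotation is a shear of slope [al] in [x], one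
     of slope [s'] in [y], then the first one again. *)
  move=> cs' s0 mH' H'0; pose al := (c' - 1) / s'.
  have xshear (K : R -> R -> \bar R) :
      measurable_fun [set: mR * mR] (fun p : mR * mR => K p.1 p.2) ->
      (forall x y, 0 <= K x y)%E ->
      (\int[leb]_(x in setT) \int[leb]_(y in setT) K (x + al * y)%R y =
       \int[leb]_(x in setT) \int[leb]_(y in setT) K x y)%E.
    move=> mK K0; rewrite (integral2_swap (H := fun x y => K (x + al * y) y)) //; last first.
      have := measurable_linear2 1 al 0 1 mK; congr (measurable_fun _ _).
      by apply/funext => p; rewrite mul0r add0r !mul1r.
    rewrite (integral2_swap mK) //.
    exact: (@integral2_shear (fun y x => K x y) al (measurable_swap2 mK) (fun x y => K0 y x)).
  apply: etrans (xshear H' mH' H'0).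
  pose K1 x y := H' (x + al * y) y.
  have mK1 : measurable_fun [set: mR * mR] (fun p : mR * mR => K1 p.1 p.2).
    have := measurable_linear2 1 al 0 1 mH'; congr (measurable_fun _ _).
    by apply/funext => p; rewrite /K1 mul0r add0r !mul1r.
  apply: etrans (@integral2_shear K1 s' mK1 (fun x y => H'0 _ _)).
  pose K2 x y := K1 x (y + s' * x).
  have mK2 : measurable_fun [set: mR * mR] (fun p : mR * mR => K2 p.1 p.2).
    have := measurable_linear2 1 0 s' 1 mK1; congr (measurable_fun _ _).
    by apply/funext => p; rewrite /K2 mul0r addr0 !mul1r addrC.
  apply: etrans (xshear K2 mK2 (fun x y => H'0 _ _)).
  apply: eq_integral => x _; apply: eq_integral => y _; rewrite /K2 /K1.
  have ale : al * s' = c' - 1 by rewrite /al divfK.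
  have e2 : y + s' * (x + al * y) = s' * x + c' * y.
    by rewrite mulrDr mulrA (mulrC s' al) ale; ring.
  rewrite e2; congr H'.
  have : al * (1 + c') = - s'.
    by apply: (mulIf s0); rewrite mulrAC ale; move: cs'; rewrite !expr2; lra.
  rewrite mulrDr mulr1 => e3.
  have -> : al * (s' * x + c' * y) = (al * s') * x + al * c' * y by ring.
  rewrite ale; have -> : al * c' = - s' - al by lra.
  ring.
have [s0|s0] := eqVneq s 0; last exact: rot.
have c1 : c ^+ 2 = 1 by rewrite -cs1 s0 expr0n addr0.
move/eqP: c1; rewrite sqrf_eq1 => /orP[/eqP ->|/eqP ->].
  by apply: eq_integral => x _; apply: eq_integral => y _; rewrite s0 !mul0r !mul1r subr0 add0r.
have e01 : (0 : R) ^+ 2 + 1 ^+ 2 = 1 by rewrite expr0n expr1n add0r.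
apply: etrans (rot H 0 1 e01 (oner_neq0 R) mH H0).
pose K x y := H (0 * x - 1 * y) (1 * x + 0 * y).
have mK : measurable_fun [set: mR * mR] (fun p : mR * mR => K p.1 p.2).
  have := measurable_linear2 0 (- 1) 1 0 mH; congr (measurable_fun _ _).
  by apply/funext => p; rewrite /K mulNr.
apply: etrans (rot K 0 1 e01 (oner_neq0 R) mK (fun x y => H0 _ _)).
apply: eq_integral => x _; apply: eq_integral => y _; rewrite /K s0.
by congr H; ring.
Qed.

(** Multiplication by [c + i s] of each complex coordinate, a coordinate being two consecutive
    entries as in [vec_of]. *)
Fixpoint rot_seq (c s : R) (l : seq R) : seq R :=
  if l is x :: y :: l' then (c * x - s * y) :: (s * x + c * y) :: rot_seq c s l'
  else l.

Lemma iter_int_rot m F (c s : R) : c ^+ 2 + s ^+ 2 = 1 ->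
  kmeas (2 * m) F -> (forall l, 0 <= F l)%E ->
  iter_int (2 * m) (fun l => F (rot_seq c s l)) = iter_int (2 * m) F.
Proof.
move=> cs1; elim: m F => [|m IH] F; rewrite ?muln0 // mulnS => mF F0 /=.
pose H x y := iter_int (2 * m) (fun l => F (x :: y :: l)).
rewrite -[RHS](@integral2_rot H c s) //.
- apply: eq_integral => x _; apply: eq_integral => y _; rewrite /H.
  exact: (IH _ (kmeas_cons (s * x + c * y) (kmeas_cons (c * x - s * y) mF)) (fun l => F0 _)).
- exact: (kmeas_iter2 F0 mF).
- by move=> x y; exact: iter_int_ge0.
Qed.

End ChangeOfVariables.

(** * Continuity and compactness on C^m *)

Section ContinuousFunctions.
Variable R : realType.
Variable m : nat.
Let K : numFieldType := R[i].
Local Notation V := 'rV[K]_m.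

(** By [vnbhsP] this is continuity for the topology of row vectors, stated with real bounds only. *)
Definition vcont (h : V -> R) := forall (z : V) (e : R), 0 < e ->
  exists2 d : R, 0 < d &
    forall w : V, (forall j, cabs (w 0 j - z 0 j) < d) -> `|h w - h z| < e.

Lemma vnbhsP (z : V) (A : set V) : nbhs z A <->
  exists2 d : R, 0 < d & forall w : V, (forall j, cabs (w 0 j - z 0 j) < d) -> A w.
Proof.
split.
  case/nbhs_ballP => e /= e0 eA.
  have [d dE] : exists d : R, e = d%:C%C by apply/complex_realP; rewrite gtr0_real.
  exists d; first by rewrite dE (ltcR 0) in e0.
  move=> w wz; apply: eA; split=> // i j; rewrite (ord1 i) /ball /= dE cabsE ltcR.
  by rewrite cabs_distC.
case=> d d0 dA; apply/nbhs_ballP; exists d%:C%C; first by rewrite /= (ltcR 0).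
move=> w [_ wz]; apply: dA => j; have := wz 0 j.
by rewrite /ball /= cabsE ltcR cabs_distC.
Qed.

Lemma entire_eps (f : V -> R[i]) : entire f -> forall (z : V) (e : R), 0 < e ->
  exists2 d : R, 0 < d &
    forall w : V, (forall j, cabs (w 0 j - z 0 j) < d) -> cabs (f w - f z) < e.
Proof.
move=> ef z e e0; have e0' : (0 : R[i]) < e%:C%C by rewrite (ltcR 0).
have /cvgrPdist_lt/(_ _ e0') := differentiable_continuous (ef z).
move/vnbhsP => [d d0 dP]; exists d => // w /dP.
by rewrite cabsE ltcR cabs_distC.
Qed.

Lemma compact_box (r : R) :
  compact [set z : V | forall j, `|Re (z 0 j)| <= r /\ `|Im (z 0 j)| <= r].
Proof.
pose A : set K := [set x : R[i] | `|Re x| <= r /\ `|Im x| <= r].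
suff cA : compact (A : set K) by exact: (@rV_compact K m (fun=> A) (fun=> cA)).
pose g (p : R * R) : K := (p.1 +i* p.2)%C.
have -> : A = g @` (`[- r, r] `*` `[- r, r]).
  apply/seteqP; split => [[x y] [/= xr yr]|_ [[x y] [/= xr yr] <-]].
    by exists (x, y) => //; split; rewrite /= in_itv /= -ler_norml.
  by rewrite !in_itv /= -!ler_norml in xr yr; split.
apply: continuous_compact; last by apply: compact_setX; exact: segment_compact.
apply: continuous_subspaceT => p; apply/cvgrPdist_lt => e e0.
have [d dE] : exists d : R, e = d%:C%C by apply/complex_realP; rewrite gtr0_real.
rewrite dE (ltcR 0) in e0; have d2 : 0 < d / 2 by rewrite divr_gt0.
have h1 : \forall q \near p, `|p.1 - q.1| < d / 2.
  have : (fun q : R * R => q.1) @ p --> p.1 by case: p => x y; exact: cvg_fst.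
  by move/cvgrPdist_lt; apply.
have h2 : \forall q \near p, `|p.2 - q.2| < d / 2.
  have : (fun q : R * R => q.2) @ p --> p.2 by case: p {h1} => x y; exact: cvg_snd.
  by move/cvgrPdist_lt; apply.
near=> q; rewrite dE cabsE ltcR; apply: le_lt_trans (cabs_ReIm _) _ => /=.
rewrite (splitr d); apply: ltrD.
  by near: q.
by near: q.
Unshelve. all: by end_near. Qed.

Lemma vcont_unif (h : V -> R) (r e : R) : vcont h -> 0 < e ->
  exists2 d : R, 0 < d & forall z w : V, (forall j, cabs (z 0 j) <= r) ->
    (forall j, cabs (w 0 j - z 0 j) < d) -> `|h w - h z| < e.
Proof.
move=> ch e0.
have /compact_near_coveringP/(_ R 0^'+ (fun d z => forall w : V,
  (forall j, cabs (w 0 j - z 0 j) < d) -> `|h w - h z| < e) _) := @compact_box r.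
case=> [z _|].
  have [d d0 dP] := ch z _ (divr_gt0 e0 (ltr0Sn R 1)).
  have d2 : 0 < d / 2 by rewrite divr_gt0.
  exists ([set w : V | forall j, cabs (w 0 j - z 0 j) < d / 2], [set t | t < d / 2]).
    by split => /=; [apply/vnbhsP; exists (d / 2)|exact: nbhs_right_lt].
  move=> [x t] [/= xz td] w wx.
  have zw : `|h w - h z| < e / 2.
    apply: dP => j; rewrite -[_ - _](subrKA (x 0 j)); apply: le_lt_trans (cabsD _ _) _.
    by rewrite (splitr d); apply: ltrD => //; exact: lt_trans (wx j) td.
  have zx : `|h x - h z| < e / 2.
    by apply: dP => j; apply: lt_trans (xz j) _; rewrite ltr_pdivrMr //; lra.
  have -> : h w - h x = (h w - h z) - (h x - h z) by ring.
  by apply: le_lt_trans (ler_normB _ _) _; rewrite (splitr e); exact: ltrD.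
move=> d /= d0 dP; exists (d / 2); first by rewrite divr_gt0.
move=> z w zr; apply: (dP (d / 2)) => /=.
- by rewrite /ball /= sub0r normrN gtr0_norm ?divr_gt0 // ltr_pdivrMr //; lra.
- by rewrite divr_gt0.
- by move=> j; split; [apply: le_trans (Re_cabs _) _|apply: le_trans (Im_cabs _) _].
Qed.

Lemma vcont_bounded (h : V -> R) (r : R) : vcont h ->
  exists M : R, forall z : V, (forall j, cabs (z 0 j) <= r) -> `|h z| <= M.
Proof.
move=> ch.
have /compact_near_coveringP/(_ R +oo (fun M z => `|h z| <= M) _) := @compact_box r.
case=> [z _|].
  have [d d0 dP] := ch z 1 ltr01.
  exists ([set w : V | forall j, cabs (w 0 j - z 0 j) < d], [set t | `|h z| + 1 < t]).
    by split => /=; [apply/vnbhsP; exists d|exact: nbhs_pinfty_gt].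
  move=> [x t] [/= /dP xz td]; apply: le_trans (ltW td).
  rewrite -lerBlDl; apply: le_trans (ltW xz).
  exact: lerB_dist.
move=> M [_ MP]; exists (M + 1) => z zr; apply: (MP (M + 1)) => /=; first by rewrite ltrDl.
by move=> j; split; [apply: le_trans (Re_cabs _) _|apply: le_trans (Im_cabs _) _].
Qed.

Lemma logplus_lip (x y : R) : `|logplus x - logplus y| <= `|x - y|.
Proof.
have H (u v : R) : u <= v -> logplus v - logplus u <= v - u.
  move=> uv; rewrite !logplusE.
  have mu : 0 < Num.max 1 u by rewrite lt_max ltr01.
  have mv : 0 < Num.max 1 v by rewrite lt_max ltr01.
  rewrite -ln_div ?posrE //; apply: (@le_trans _ _ (Num.max 1 v / Num.max 1 u - 1)).
    have -> : Num.max 1 v / Num.max 1 u = 1 + (Num.max 1 v / Num.max 1 u - 1) by ring.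
    rewrite [leRHS](_ : _ = Num.max 1 v / Num.max 1 u - 1); last by ring.
    by apply: le_ln1Dx; rewrite ltrBrDl subrr divr_gt0.
  set A := Num.max 1 u; set B := Num.max 1 v.
  have A1 : 1 <= A by rewrite le_max lexx.
  have AB : A <= B by rewrite ge_max !le_max lexx uv orbT.
  have BA : B - A <= v - u.
    have Au : u <= A by rewrite le_max lexx orbT.
    by move: A1 Au; rewrite /B; case: (leP 1 v) => v1; lra.
  apply: le_trans BA; rewrite -[X in _ - X](divff (lt0r_neq0 mu)) -mulrBl ler_pdivrMr //.
  by rewrite -/A -[leLHS]mulr1 ler_wpM2l // subr_ge0.
have mono (u v : R) : u <= v -> logplus u <= logplus v.
  move=> uv; rewrite !logplusE ler_ln ?posrE ?lt_max ?ltr01 //.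
  by rewrite ge_max !le_max lexx uv orbT.
have [xy|xy] := leP x y.
  by rewrite distrC (distrC x) !ger0_norm ?subr_ge0 ?mono //; exact: H.
move/ltW in xy.
by rewrite !ger0_norm ?subr_ge0 ?mono //; exact: H.
Qed.

Lemma vcont_logplus (f : V -> R[i]) : entire f -> vcont (fun z => logplus (cabs (f z))).
Proof.
move=> ef z e e0; have [d d0 dP] := entire_eps ef z e0.
exists d => // w /dP; apply: le_lt_trans; apply: le_trans (logplus_lip _ _) _.
rewrite ler_norml cabs_ge lerNl opprB cabs_distC cabs_ge //.
Qed.

End ContinuousFunctions.

Section MeasurableComposition.
Variable R : realType.

(** Rounding the arguments down to multiples of [1 / (n + 1)] gives functions with countably many
    values, measurable because their level sets are, which converge pointwise by continuity of
    [H]. *)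
Lemma measurable_fun_finite_cont (d : measure_display) (T : measurableType d)
    (I : finType) (y : I -> T -> R) (H : (I -> R) -> R) :
  (forall i, measurable_fun [set: T] (y i)) ->
  (forall (u : I -> R) (e : R), 0 < e -> exists2 d : R, 0 < d &
    forall v, (forall i, `|v i - u i| < d) -> `|H v - H u| < e) ->
  measurable_fun [set: T] (fun t => H (fun i => y i t)).
Proof.
move=> my cH.
pose g (n : nat) (t : T) := H (fun i => (Num.floor (y i t * n.+1%:R))%:~R / n.+1%:R).
apply: (@measurable_fun_cvg _ _ _ _ g) => [n|t _].
  move=> _ B mB; rewrite setTI.
  have -> : g n @^-1` B = \bigcup_(v in [set: {ffun I -> int}])
     (if pselect (B (H (fun i => (v i)%:~R / n.+1%:R))) then
       \bigcap_(i in [set: I]) [set t | Num.floor (y i t * n.+1%:R) = v i] else set0).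
    apply/seteqP; split=> [t Bt|t [v _]].
      exists [ffun i => Num.floor (y i t * n.+1%:R)] => //.
      case: pselect => [_ i _|]; first by rewrite /= ffunE.
      case; move: Bt; rewrite /= /g; congr (B (H _)).
      by apply/funext => i; rewrite ffunE.
    case: pselect => // Bv tv; rewrite /= /g.
    by rewrite (_ : (fun i => _) = fun i => (v i)%:~R / n.+1%:R) //; apply/funext => i; rewrite tv.
  apply: countable_bigcupT_measurable; first exact: countableP.
  move=> v; case: pselect => ?; last exact: measurable0.
  apply: fin_bigcap_measurable; first exact: finite_finset.
  move=> i _; rewrite (_ : mkset _ = (fun t => y i t * n.+1%:R) @^-1` `[(v i)%:~R, (v i + 1)%:~R[).
    rewrite -[X in measurable X]setTI.
    have mm : measurable_fun [set: T] (fun t => y i t * n.+1%:R : R).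
      by apply: measurable_funM => //; exact: measurable_cst.
    by apply: mm => //; exact: measurable_itv.
  apply/seteqP; split=> t /=; rewrite in_itv /=.
    by move=> <-; rewrite ge_floor ?num_real // floorD1_gt ?num_real.
  by move=> h; apply/eqP; rewrite floor_eq ?num_real.
apply/cvgrPdist_lt => e e0; have [dl d0 dP] := cH (fun i => y i t) e e0.
have [n0 n0P] : exists n0 : nat, dl^-1 < n0%:R.
  by exists (Num.truncn dl^-1).+1; rewrite truncnS_gt.
near=> n; rewrite distrC; apply: dP => i.
have n1 : 0 < n.+1%:R :> R by rewrite ltr0n.
have nd : dl^-1 < n.+1%:R.
  by apply: lt_trans n0P _; rewrite ltr_nat ltnS; near: n; exists n0.
have -> : (Num.floor (y i t * n.+1%:R))%:~R / n.+1%:R - y i t =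
  ((Num.floor (y i t * n.+1%:R))%:~R - y i t * n.+1%:R) / n.+1%:R.
  by rewrite mulrBl mulfK // gt_eqF.
rewrite normrM normfV (gtr0_norm n1) ltr_pdivrMr //.
have f1 := ge_floor (y i t * n.+1%:R) ; have f2 := floorD1_gt (y i t * n.+1%:R).
rewrite intrD in f2.
have : 1 < dl * n.+1%:R by rewrite mulrC -ltr_pdivrMr // div1r.
rewrite ltr_norml; lra.
Unshelve. all: by end_near. Qed.

Lemma measurable_vcont (d : measure_display) (T : measurableType d) (m : nat)
    (a b : 'I_m -> T -> R) (h : 'rV[R[i]]_m -> R) : vcont h ->
  (forall j, measurable_fun [set: T] (a j)) -> (forall j, measurable_fun [set: T] (b j)) ->
  measurable_fun [set: T] (fun t => h (\row_j (a j t +i* b j t)%C)).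
Proof.
move=> ch ma mb.
pose y (i : 'I_m + 'I_m) := match i with inl j => a j | inr j => b j end.
pose H (u : 'I_m + 'I_m -> R) := h (\row_j (u (inl j) +i* u (inr j))%C).
apply: (@measurable_fun_finite_cont _ T _ y H) => [[j|j]|u e e0]; [exact: ma|exact: mb|].
have [dl d0 dP] := ch (\row_j (u (inl j) +i* u (inr j))%C) e e0.
exists (dl / 2); first by rewrite divr_gt0.
move=> v uv; apply: dP => j; rewrite !mxE; apply: le_lt_trans (cabs_ReIm _) _ => /=.
by rewrite (splitr dl); apply: ltrD; exact: uv.
Qed.

End MeasurableComposition.

Section MeasurableOnCm.
Variable R : realType.
Variable m : nat.
Local Notation V := 'rV[R[i]]_m.
Local Notation mR := (measurableTypeR R).

(** No sigma-algebra is put on [V]: a function on [V] counts as measurable when its composite with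
    every map having measurable real coordinates is. Stability under affine maps and normalization
    is then immediate. *)
Definition vmap (d : measure_display) (T : measurableType d) (p : T -> V) :=
  forall j, measurable_fun [set: T] (fun t => Re (p t 0 j)) /\
            measurable_fun [set: T] (fun t => Im (p t 0 j)).

Definition rmeas (h : V -> R) :=
  forall (d : measure_display) (T : measurableType d) (p : T -> V),
    vmap p -> measurable_fun [set: T] (fun t => h (p t)).

Definition bmeas (D : V -> bool) :=
  forall (d : measure_display) (T : measurableType d) (p : T -> V),
    vmap p -> measurable_fun [set: T] (fun t => D (p t)).

Definition vmeas (phi : V -> \bar R) :=
  forall (d : measure_display) (T : measurableType d) (p : T -> V),
    vmap p -> measurable_fun [set: T] (fun t => phi (p t)).

Lemma rmeas_vcont (h : V -> R) : vcont h -> rmeas h.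
Proof.
move=> ch d T p mp.
have -> : (fun t => h (p t)) = (fun t => h (\row_j (Re (p t 0 j) +i* Im (p t 0 j))%C)).
  apply/funext => t; congr h; apply/rowP => j; rewrite mxE.
  by case: (p t 0 j).
by apply: measurable_vcont => // j; case: (mp j).
Qed.

Lemma rmeas_cst (c : R) : rmeas (fun=> c).
Proof. by move=> d T p mp; exact: measurable_cst. Qed.

Lemma rmeasD h k : rmeas h -> rmeas k -> rmeas (fun z => h z + k z).
Proof. by move=> mh mk d T p mp; apply: measurable_funD; [exact: mh|exact: mk]. Qed.

Lemma rmeasM h k : rmeas h -> rmeas k -> rmeas (fun z => h z * k z).
Proof. by move=> mh mk d T p mp; apply: measurable_funM; [exact: mh|exact: mk]. Qed.

Lemma rmeas_sum (I : Type) (s : seq I) (P : pred I) (h : I -> V -> R) :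
  (forall i, rmeas (h i)) -> rmeas (fun z => \sum_(i <- s | P i) h i z).
Proof.
move=> mh; elim: s => [|i s IH].
  rewrite (_ : (fun z => _) = fun=> 0); first exact: rmeas_cst.
  by apply/funext => z; rewrite big_nil.
case Pi : (P i); last first.
  rewrite (_ : (fun z => _) = fun z => \sum_(i <- s | P i) h i z) //.
  by apply/funext => z; rewrite big_cons Pi.
rewrite (_ : (fun z => _) = fun z => h i z + \sum_(i <- s | P i) h i z).
  exact: rmeasD.
by apply/funext => z; rewrite big_cons Pi.
Qed.

Lemma rmeas_homo (g : R -> R) h : {homo g : x y / x <= y} -> rmeas h ->
  rmeas (fun z => g (h z)).
Proof.
move=> hg mh d T p mp.
have mg : measurable_fun [set: R] g by apply: nondecreasing_measurable.
exact: (measurableT_comp mg (mh _ _ _ mp)).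
Qed.

Lemma rmeas_inv h : (forall z, 0 <= h z) -> rmeas h -> rmeas (fun z => (h z)^-1).
Proof.
move=> h0 mh d T p mp.
have -> : (fun t => (h (p t))^-1) = (fun t => h (p t) `^ (-1)).
  by apply/funext => t; rewrite powR_inv1.
have mpw : measurable_fun [set: R] (fun x : R => x `^ (-1)) by exact: measurable_powR.
exact: (measurableT_comp mpw (mh _ _ _ mp)).
Qed.

Lemma rmeas_Re j : rmeas (fun z => Re (z 0 j)).
Proof. by move=> d T p mp; case: (mp j). Qed.

Lemma rmeas_Im j : rmeas (fun z => Im (z 0 j)).
Proof. by move=> d T p mp; case: (mp j). Qed.

Lemma cabs_sqr (z : R[i]) : cabs z ^+ 2 = Re z ^+ 2 + Im z ^+ 2.
Proof. by case: z => x y /=; rewrite sqr_sqrtr // addr_ge0 ?sqr_ge0. Qed.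

Lemma rmeas_vnorm : rmeas (@vnorm R m).
Proof.
rewrite (_ : @vnorm R m = fun z => Num.sqrt (\sum_(j < m)
   (Re (z 0 j) * Re (z 0 j) + Im (z 0 j) * Im (z 0 j)))).
  apply: rmeas_homo; first by move=> x y xy; exact: ler_wsqrtr.
  apply: rmeas_sum => j; apply: rmeasD; apply: rmeasM; solve [exact: rmeas_Re|exact: rmeas_Im].
by apply/funext => z; congr Num.sqrt; apply: eq_bigr => j _; rewrite cabs_sqr !expr2.
Qed.

Lemma vnorm_ge0 (z : V) : 0 <= vnorm z.
Proof. exact: sqrtr_ge0. Qed.

Lemma bmeas_ler h k : rmeas h -> rmeas k -> bmeas (fun z => h z <= k z).
Proof. by move=> mh mk d T p mp; apply: measurable_fun_ler; [exact: mh|exact: mk]. Qed.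

Lemma bmeas_ltr h k : rmeas h -> rmeas k -> bmeas (fun z => h z < k z).
Proof. by move=> mh mk d T p mp; apply: measurable_fun_ltr; [exact: mh|exact: mk]. Qed.

Lemma bmeas_and (D E : V -> bool) : bmeas D -> bmeas E -> bmeas (fun z => D z && E z).
Proof. by move=> mh mk d T p mp; apply: measurable_and; [exact: mh|exact: mk]. Qed.

Lemma vmeas_EFin h : rmeas h -> vmeas (fun z => (h z)%:E).
Proof.
by move=> mh d T p mp; apply/measurable_EFinP; exact: (mh _ _ _ mp).
Qed.

Lemma vmeas_if (D : V -> bool) phi psi : bmeas D -> vmeas phi -> vmeas psi ->
  vmeas (fun z => if D z then phi z else psi z).
Proof.
by move=> mD mphi mpsi d T p mp; apply: measurable_fun_ifT; [exact: mD|exact: mphi|exact: mpsi].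
Qed.

Lemma vmeasD phi psi : vmeas phi -> vmeas psi -> vmeas (fun z => phi z + psi z)%E.
Proof.
by move=> mphi mpsi d T p mp; apply: emeasurable_funD; [exact: mphi|exact: mpsi].
Qed.

Lemma vmeasZ (c : \bar R) phi : vmeas phi -> vmeas (fun z => c * phi z)%E.
Proof.
move=> mphi d T p mp.
by apply: emeasurable_funM; [exact: measurable_cst|exact: mphi].
Qed.

Lemma vmap_affine (d : measure_display) (T : measurableType d) (p : T -> V)
    (z : V) (c : R[i]) : vmap p -> vmap (fun t => z + c *: p t).
Proof.
move=> mp j; have [mR mI] := mp j; case: c => a b.
have eR : (fun t => Re ((z + (a +i* b)%C *: p t) 0 j)) =
   (fun t => Re (z 0 j) + (a * Re (p t 0 j) + (- b) * Im (p t 0 j))).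
  apply/funext => t; rewrite !mxE; case: (z 0 j) (p t 0 j) => [x y] [u v].
  by simpc => /=; ring.
have eI : (fun t => Im ((z + (a +i* b)%C *: p t) 0 j)) =
   (fun t => Im (z 0 j) + (a * Im (p t 0 j) + b * Re (p t 0 j))).
  apply/funext => t; rewrite !mxE; case: (z 0 j) (p t 0 j) => [x y] [u v].
  by simpc => /=; ring.
split; rewrite ?eR ?eI; apply: measurable_funD => //; try exact: measurable_cst;
  by apply: measurable_funD; apply: measurable_funM => //; exact: measurable_cst.
Qed.

Lemma vmap_scale (d : measure_display) (T : measurableType d) (p : T -> V) (h : T -> R) :
  vmap p -> measurable_fun [set: T] h -> vmap (fun t => (h t)%:C%C *: p t).
Proof.
move=> mp mh j; have [mR mI] := mp j.
have eR : (fun t => Re (((h t)%:C%C *: p t) 0 j)) = (fun t => h t * Re (p t 0 j)).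
  by apply/funext => t; rewrite !mxE; case: (p t 0 j) => [u v]; simpc.
have eI : (fun t => Im (((h t)%:C%C *: p t) 0 j)) = (fun t => h t * Im (p t 0 j)).
  by apply/funext => t; rewrite !mxE; case: (p t 0 j) => [u v]; simpc.
by split; rewrite ?eR ?eI; apply: measurable_funM.
Qed.

Lemma vmeas_affine phi (z : V) (c : R[i]) : vmeas phi -> vmeas (fun x => phi (z + c *: x)).
Proof. by move=> mphi d T p mp; apply: mphi; exact: vmap_affine. Qed.

Lemma vmeas_scale phi (c : R[i]) : vmeas phi -> vmeas (fun x => phi (c *: x)).
Proof.
move=> mphi; have := vmeas_affine 0 c mphi; congr vmeas.
by apply/funext => x; rewrite add0r.
Qed.

Lemma vmeas_normalize phi : vmeas phi ->
  vmeas (fun x => phi (((vnorm x)^-1)%:C%C *: x)).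
Proof.
move=> mphi d T p mp; apply: mphi; apply: vmap_scale => //.
exact: (rmeas_inv vnorm_ge0 rmeas_vnorm mp).
Qed.

Lemma kmeas_vmeas phi : vmeas phi -> kmeas (2 * m) (fun s => phi (vec_of m s)).
Proof.
move=> mphi; apply: (mphi _ _ (fun t : (2 * m).-tuple mR => vec_of m t)) => j.
have H (k : nat) : (k < 2 * m)%N ->
    measurable_fun [set: (2 * m).-tuple mR] (fun t : (2 * m).-tuple mR => nth 0 t k : R).
  move=> km; have := @measurable_tnth _ mR _ (Ordinal km); congr measurable_fun.
  by apply/funext => t; rewrite (tnth_nth 0).
split.
- rewrite (_ : (fun t => _) = fun t : (2 * m).-tuple mR => nth 0 t (2 * j)).
    by apply: H; rewrite ltn_pmul2l.
  by apply/funext => t; rewrite mxE.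
- rewrite (_ : (fun t => _) = fun t : (2 * m).-tuple mR => nth 0 t (2 * j).+1).
    by apply: H; have := ltn_ord j; lia.
  by apply/funext => t; rewrite mxE.
Qed.

End MeasurableOnCm.

Section IntegralOnCm.
Variable R : realType.
Variable m : nat.
Local Notation V := 'rV[R[i]]_m.
Implicit Types (phi psi : V -> \bar R).

Definition gint phi : \bar R := iter_int (2 * m) (fun s => phi (vec_of m s)).

Lemma gint_ge0 phi : (forall x, 0 <= phi x)%E -> (0 <= gint phi)%E.
Proof. by move=> p0; exact: iter_int_ge0. Qed.

Lemma eq_gint phi psi : (forall x, phi x = psi x) -> gint phi = gint psi.
Proof. by move=> e; apply: eq_iter_int => s _; exact: e. Qed.

Lemma le_gint phi psi : vmeas phi -> vmeas psi -> (forall x, 0 <= phi x)%E ->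
  (forall x, 0 <= psi x)%E -> (forall x, phi x <= psi x)%E -> (gint phi <= gint psi)%E.
Proof. by move=> ? ? ? ? ?; apply: le_iter_int => //; exact: kmeas_vmeas. Qed.

Lemma gintD phi psi : vmeas phi -> vmeas psi -> (forall x, 0 <= phi x)%E ->
  (forall x, 0 <= psi x)%E ->
  (gint (fun x => phi x + psi x) = gint phi + gint psi)%E.
Proof.
move=> mp mq p0 q0.
exact: (iter_intD (kmeas_vmeas mp) (kmeas_vmeas mq) (fun s => p0 _) (fun s => q0 _)).
Qed.

Lemma gintZl phi (c : \bar R) : vmeas phi -> (forall x, 0 <= phi x)%E -> (0 <= c)%E ->
  (gint (fun x => c * phi x) = c * gint phi)%E.
Proof. by move=> mp p0; exact: (iter_intZl (kmeas_vmeas mp) (fun s => p0 _)). Qed.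

Lemma vmeas_cst (c : \bar R) : vmeas (fun _ : V => c).
Proof. by move=> d T p mp; exact: measurable_cst. Qed.

Lemma gint0 : gint (fun=> 0%E) = 0%E.
Proof.
have := @gintZl (fun=> 0%E) 0%E (@vmeas_cst 0%E) (fun=> lexx _) (lexx _).
by rewrite [RHS]mul0e => h; rewrite -[RHS]h; apply: eq_gint => x; rewrite mul0e.
Qed.

Lemma vmeas_sum (I : Type) (s : seq I) (phi : I -> V -> \bar R) :
  (forall i, vmeas (phi i)) -> vmeas (fun x => \sum_(i <- s) phi i x)%E.
Proof.
move=> mp; elim: s => [|i s IH].
  rewrite (_ : (fun z => _) = fun=> 0%E); first exact: vmeas_cst.
  by apply/funext => z; rewrite big_nil.
rewrite (_ : (fun z => _) = fun z => phi i z + \sum_(i <- s) phi i z)%E.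
  exact: vmeasD.
by apply/funext => z; rewrite big_cons.
Qed.

Lemma gint_sum (I : Type) (s : seq I) (phi : I -> V -> \bar R) :
  (forall i, vmeas (phi i)) -> (forall i x, 0 <= phi i x)%E ->
  (gint (fun x => \sum_(i <- s) phi i x) = \sum_(i <- s) gint (phi i))%E.
Proof.
move=> mp p0; elim: s => [|i s IH].
  by rewrite [RHS]big_nil -[RHS]gint0; apply: eq_gint => x; rewrite big_nil.
rewrite big_cons -IH -gintD //.
- by apply: eq_gint => x; rewrite big_cons.
- exact: vmeas_sum.
- by move=> x; apply: sume_ge0 => j _.
Qed.

Lemma mine_cvg (x : \bar R) : (0 <= x)%E ->
  (fun n : nat => Order.min x n%:R%:E) @ \oo --> x.
Proof.
case: x => [x|_|//].
  rewrite lee_fin => x0; apply: cvg_near_cst; exists (Num.truncn x).+1 => // n /= xn.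
  apply/min_idPl; rewrite lee_fin; apply: le_trans (ltW (truncnS_gt _)) _.
  by rewrite ler_nat.
have -> : (fun n : nat => Order.min (+oo : \bar R) n%:R%:E)%E = fun n => (n%:R : R)%:E.
  by apply/funext => n; apply/min_idPr; rewrite leey.
exact/cvgeryP/cvgr_idn.
Qed.

(** Monotone convergence; it extends estimates proved for bounded integrands to unbounded or
    infinite ones. *)
Lemma gint_trunc phi (Q : \bar R) : vmeas phi -> (forall x, 0 <= phi x)%E ->
  (forall n : nat, gint (fun x => Order.min (phi x) n%:R%:E) <= Q)%E -> (gint phi <= Q)%E.
Proof.
move=> mp p0 pQ.
pose F (n : nat) s : \bar R := Order.min (phi (vec_of m s)) n%:R%:E.
have mF n : kmeas (2 * m) (F n).
  apply: (@kmeas_vmeas R m (fun x => Order.min (phi x) n%:R%:E)).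
  by move=> d T p mpp; apply: measurable_mine; [exact: mp|exact: measurable_cst].
have F0 n s : (0 <= F n s)%E by rewrite le_min p0 lee_fin ler0n.
have hF s : {homo F^~ s : n k / (n <= k)%N >-> (n <= k)%E}.
  move=> n k nk; rewrite /F le_min !ge_min lexx /= lee_fin ler_nat nk orbT //.
have -> : gint phi = iter_int (2 * m) (fun s => limn (F^~ s)).
  apply: eq_iter_int => s _; apply/esym/cvg_lim => //; exact: mine_cvg.
rewrite iter_int_mct //; apply: lime_le.
  apply: ereal_nondecreasing_is_cvgn => n k nk.
  by apply: le_iter_int => // s _; exact: hF.
by apply: nearW => n; exact: pQ.
Qed.

Lemma vec_of_affine (c : R) (b s : seq R) : size s = (2 * m)%N -> size b = (2 * m)%N ->
  vec_of m (affine_seq c b s) = vec_of m b + c%:C%C *: vec_of m s.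
Proof.
move=> ss sb; apply/rowP => j; rewrite !mxE.
have H k : (k < 2 * m)%N -> nth 0 (affine_seq c b s) k = c * nth 0 s k + nth 0 b k.
  move=> km; rewrite (nth_map (0, 0)) ?size_zip ?ss ?sb ?minnn //.
  by rewrite nth_zip ?ss ?sb.
have jm := ltn_ord j.
rewrite !H; [|lia|lia].
by simpc => /=; congr Complex; rewrite addrC.
Qed.

Lemma vec_of_surj (z : V) : exists2 b : seq R, size b = (2 * m)%N & vec_of m b = z.
Proof.
pose g i := if insub (i./2) is Some j then
  (if odd i then Im (z 0 (j : 'I_m)) else Re (z 0 j)) else 0.
exists (mkseq g (2 * m)); first by rewrite size_mkseq.
apply/rowP => j; rewrite mxE; have jm := ltn_ord j.
rewrite !nth_mkseq; [|lia|lia].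
rewrite /g mul2n /= uphalf_double doubleK odd_double /=.
rewrite insubT /= (_ : Sub _ _ = j); last exact: val_inj.
by case: (z 0 j).
Qed.

Lemma vec_of_rot (c s : R) (l : seq R) : size l = (2 * m)%N ->
  vec_of m (rot_seq c s l) = (c +i* s)%C *: vec_of m l.
Proof.
move=> sl; apply/rowP => j; rewrite !mxE; have := ltn_ord j.
have : ((2 * j).+1 < size l)%N by rewrite sl; have := ltn_ord j; lia.
move: (nat_of_ord j) => k kl _.
suff [-> ->] : nth 0 (rot_seq c s l) (2 * k) = c * nth 0 l (2 * k) - s * nth 0 l (2 * k).+1 /\
   nth 0 (rot_seq c s l) (2 * k).+1 = s * nth 0 l (2 * k) + c * nth 0 l (2 * k).+1.
  by simpc => /=; congr Complex; ring.
elim: k l kl {sl} => [|k IH] [|x [|y l]] kl //.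
by rewrite mulnS /=; apply: IH; move: kl; rewrite mulnS.
Qed.

Lemma gint_affine phi (z : V) (c : R) : 0 < c -> vmeas phi -> (forall x, 0 <= phi x)%E ->
  ((c ^+ (2 * m))%:E * gint (fun x => phi (z + c%:C%C *: x)%R) = gint phi)%E.
Proof.
move=> c0 mp p0; have [b sb bz] := vec_of_surj z.
rewrite -[RHS](iter_int_affine c0 sb (kmeas_vmeas mp)) //; congr (_ * _)%E.
by apply: eq_iter_int => s ss; rewrite vec_of_affine // bz.
Qed.

Lemma gint_rot phi (u : R[i]) : cabs u = 1 -> vmeas phi -> (forall x, 0 <= phi x)%E ->
  gint (fun x => phi (u *: x)) = gint phi.
Proof.
case: u => c s cs mp p0.
have cs1 : c ^+ 2 + s ^+ 2 = 1 by have := cabs_sqr (c +i* s)%C; rewrite cs expr1n => <-.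
rewrite -[RHS](iter_int_rot cs1 (kmeas_vmeas mp)) //.
by apply: eq_iter_int => l sl; rewrite vec_of_rot.
Qed.

End IntegralOnCm.

(** * Averages over balls and spheres *)

Section BallVolume.
Variable R : realType.
Local Notation mR := (measurableTypeR R).
Local Notation leb := (@lebesgue_measure R).

(** Cubes have an explicit volume, which bounds that of the ball from both sides. *)
Definition boxb (a b : R) (s : seq R) : \bar R :=
  if all (fun x => a <= x <= b) s then 1%E else 0%E.

Lemma iter_int_box k (a b : R) : a <= b -> iter_int k (boxb a b) = ((b - a) ^+ k)%:E.
Proof.
move=> ab; elim: k => [|k IH] //=.
have -> : (fun t : mR => iter_int k (fun s => boxb a b (t :: s))) =
  (fun t => if t \in (`[a, b]%classic : set mR) then ((b - a) ^+ k)%:E else 0%E).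
  apply/funext => t; case: ifPn => [|/negP]; rewrite inE /= in_itv /= => tab.
    by rewrite -IH; apply: eq_iter_int => s _; rewrite /boxb /= tab.
  rewrite -[RHS](mul0e (iter_int k (fun=> 1%E))) -iter_intZl //.
  - apply: eq_iter_int => s _; rewrite /boxb /= mul0e.
    by move/negP/negbTE: tab => ->.
  - exact: measurable_cst.
have lab : leb `[a, b]%classic = (b - a)%:E.
  rewrite lebesgue_measure_itv /= lte_fin; case: ltP => // ba.
  by have -> : b = a by [apply/eqP; rewrite eq_le ba]; rewrite subrr.
transitivity (\int[leb]_(t in (`[a, b]%classic : set mR)) cst ((b - a) ^+ k)%:E t)%E.
  by rewrite [RHS]integral_mkcond.
have mi : measurable (`[a, b]%classic : set mR) by exact: measurable_itv.
rewrite (integral_cst leb mi) [X in (_ * X)%E]lab.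
by rewrite -EFinM exprSr.
Qed.

Lemma kmeas_box k (a b : R) : kmeas k (boxb a b).
Proof.
rewrite /kmeas; pose g (t : k.-tuple mR) : R := \sum_(i < k) (if a <= tnth t i <= b then 0 else 1).
have -> : (fun t : k.-tuple mR => boxb a b t) = (fun t => if g t <= 0 then 1%E else 0%E).
  apply/funext => t; rewrite /boxb; congr (if _ then _ else _).
  apply/allP/idP => [H|].
    by rewrite /g big1 // => i _; rewrite (H _ (mem_tnth i t)).
  rewrite /g => H x /tnthP [i ->]; apply/negPn/negP => N; move: H; apply/negP.
  rewrite -ltNge (bigD1 i) //= (negbTE N); apply: ltr_wpDr => //.
  by apply: sumr_ge0 => j _; case: ifP.
apply: measurable_fun_ifT; [|exact: measurable_cst|exact: measurable_cst].
apply: measurable_fun_ler; last exact: measurable_cst.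
apply: measurable_sum => i; apply: measurable_fun_ifT; [|exact: measurable_cst|exact: measurable_cst].
have mi : measurable_fun [set: k.-tuple mR] (fun t : k.-tuple mR => tnth t i : R).
  exact: measurable_tnth.
by apply: measurable_and; apply: measurable_fun_ler => //; exact: measurable_cst.
Qed.

Variable m : nat.
Local Notation V := 'rV[R[i]]_m.

(** [sphere_avg] integrates over this punctured ball, where [x] can be normalized, but divides by
    the volume of [cball]. *)
Definition pball (x : V) : bool := 0 < vnorm x <= 1.

Definition cball (x : V) : bool := vnorm x <= 1.

Definition ind (D : V -> bool) (x : V) : \bar R := if D x then 1%E else 0%E.

Lemma bmeas_pball : bmeas pball.
Proof.
apply: bmeas_and; first by apply: bmeas_ltr; [exact: rmeas_cst|exact: rmeas_vnorm].
by apply: bmeas_ler; [exact: rmeas_vnorm|exact: rmeas_cst].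
Qed.

Lemma bmeas_ball : bmeas cball.
Proof. by apply: bmeas_ler; [exact: rmeas_vnorm|exact: rmeas_cst]. Qed.

Lemma vmeas_ind D : bmeas D -> vmeas (ind D).
Proof. by move=> mD; apply: vmeas_if => //; exact: vmeas_cst. Qed.

Lemma ind_ge0 D x : (0 <= ind D x)%E.
Proof. by rewrite /ind; case: ifP. Qed.

Lemma cabs_le_vnorm (z : V) j : cabs (z 0 j) <= vnorm z.
Proof.
rewrite -(ger0_norm (cabs_ge0 (z 0 j))) -sqrtr_sqr ler_wsqrtr // (bigD1 j) //=.
by rewrite lerDl; apply: sumr_ge0 => i _; exact: sqr_ge0.
Qed.

Lemma vnormZ (c : R[i]) (z : V) : vnorm (c *: z) = cabs c * vnorm z.
Proof.
rewrite /vnorm -(ger0_norm (cabs_ge0 c)) -sqrtr_sqr -sqrtrM ?sqr_ge0 // mulr_sumr.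
by congr Num.sqrt; apply: eq_bigr => j _; rewrite mxE cabsM exprMn.
Qed.

Lemma vnorm_eq0 (z : V) : (vnorm z == 0) = (z == 0).
Proof.
apply/idP/eqP => [/eqP z0|->].
  apply/rowP => j; rewrite mxE; apply/eqP; rewrite -cabs_eq0 eq_le cabs_ge0 andbT -z0.
  exact: cabs_le_vnorm.
by rewrite /vnorm big1 ?sqrtr0 // => j _; rewrite mxE cabs0 expr0n.
Qed.

Lemma vol_fin : (gint (ind cball) < +oo)%E.
Proof.
apply: (@le_lt_trans _ _ (iter_int (2 * m) (boxb (- 1) 1))); last by rewrite iter_int_box // ltry.
apply: le_iter_int.
- exact: (kmeas_vmeas (vmeas_ind bmeas_ball)).
- exact: kmeas_box.
- by move=> s; exact: ind_ge0.
- by move=> s; rewrite /boxb; case: ifP.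
move=> s ss; rewrite /ind /boxb /cball; case: ifP => sv; last by case: ifP.
rewrite ifT //; apply/allP => x /(nthP 0) [k]; rewrite ss => km <-; rewrite -ler_norml.
have km2 : (k./2 < m)%N by lia.
have := cabs_le_vnorm (vec_of m s) (Ordinal km2) => /le_trans/(_ sv).
rewrite mxE /= => cv.
have [ok|ek] := boolP (odd k).
  have -> : k = (2 * k./2).+1 by rewrite mul2n -[LHS]odd_double_half ok.
  exact: le_trans (Im_cabs (_ +i* _)%C) cv.
have -> : k = (2 * k./2)%N by rewrite mul2n -[LHS]odd_double_half (negbTE ek).
exact: le_trans (Re_cabs (_ +i* _)%C) cv.
Qed.

Lemma vol_gt0 : (0 < m)%N -> (0 < gint (ind pball))%E.
Proof.
(* In the cube of side [[c / 2, c]] a complex coordinate has modulus at most [2 * c = 1 / (m + 1)],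
   so the cube lies in the ball; [c / 2 > 0] keeps it away from the origin. *)
move=> m0; pose c : R := (2 * m.+1%:R)^-1.
have c0 : 0 < c by rewrite invr_gt0 mulr_gt0 // ltr0n.
have c2 : c / 2 < c by rewrite ltr_pdivrMr //; lra.
apply: (@lt_le_trans _ _ (iter_int (2 * m) (boxb (c / 2) c))).
  by rewrite iter_int_box ?ltW // lte_fin exprn_gt0 // subr_gt0.
apply: le_iter_int.
- exact: kmeas_box.
- exact: (kmeas_vmeas (vmeas_ind bmeas_pball)).
- by move=> s; rewrite /boxb; case: ifP.
- by move=> s; exact: ind_ge0.
move=> s ss; rewrite /boxb; case: ifP => [/allP sb|_]; last exact: ind_ge0.
have sk k : (k < 2 * m)%N -> c / 2 <= nth 0 s k <= c.
  by move=> km; apply: sb; apply: mem_nth; rewrite ss.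
rewrite /ind ifT // /pball; apply/andP; split.
  apply: (@lt_le_trans _ _ (cabs (vec_of m s 0 (Ordinal m0)))); last exact: cabs_le_vnorm.
  rewrite cabs_gt0 mxE /= eq_complex /= negb_and; apply/orP; left.
  have /andP[h _] : c / 2 <= nth 0 s 0 <= c by apply: sk; lia.
  by rewrite gt_eqF //; apply: lt_le_trans h; rewrite divr_gt0.
rewrite -sqrtr1 ler_wsqrtr //.
apply: (@le_trans _ _ (\sum_(j < m) (2 * c) ^+ 2)).
  apply: ler_sum => j _; rewrite lerXn2r ?nnegrE ?cabs_ge0 ?mulr_ge0 ?(ltW c0) //.
  apply: le_trans (cabs_ReIm _) _; rewrite mxE /=; have jm := ltn_ord j.
  have /andP[a1 a2] : c / 2 <= nth 0 s (2 * j) <= c by apply: sk; lia.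
  have /andP[b1 b2] : c / 2 <= nth 0 s (2 * j).+1 <= c by apply: sk; lia.
  rewrite !ger0_norm; lra.
have M0 : 0 < m.+1%:R :> R by rewrite ltr0n.
have -> : 2 * c = m.+1%:R^-1 by rewrite /c invfM mulrA mulfV // mul1r.
rewrite sumr_const card_ord.
have -> : m.+1%:R^-1 ^+ 2 *+ m = m%:R / m.+1%:R ^+ 2 :> R by rewrite exprVn -[LHS]mulr_natl.
rewrite ler_pdivrMr ?exprn_gt0 // mul1r.
by rewrite -natrX ler_nat; lia.
Qed.

Lemma le_vol : (gint (ind pball) <= gint (ind cball))%E.
Proof.
apply: le_gint; try exact: ind_ge0; try exact: (vmeas_ind bmeas_pball).
  exact: (vmeas_ind bmeas_ball).
by move=> x; rewrite /ind /pball /cball; case: (vnorm x <= 1); rewrite ?andbF ?andbT //; case: ifP.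
Qed.

End BallVolume.

(** * Sub-mean value inequalities for log^+ of an entire function *)

Section SubmeanValue.
Variable R : realType.
Variable m : nat.
Local Notation V := 'rV[R[i]]_m.
Implicit Types (h : V -> R) (f : V -> R[i]).

Definition logp (f : V -> R[i]) (z : V) : R := logplus (cabs (f z)).

Lemma logp_ge0 f z : 0 <= logp f z. Proof. exact: logplus_ge0. Qed.

(** [N] depends on the uniform continuity of [logp f] on a bounded set, but not on the direction [v]
    nor on [l0], so that the inequality can be integrated over directions. *)
Lemma rot_pointwise (f : V -> R[i]) (z0 : V) (r eta : R) : entire f -> 0 < r -> 0 < eta ->
  exists2 N : nat, (0 < N)%N & forall (v : V) (l0 : R[i]),
    (forall j, cabs (v 0 j) <= 1) -> cabs l0 < r ->
    \sum_(k < N) logp f (z0 + (l0 * root1 R N k) *: v) <=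
    \sum_(k < N) logp f (z0 + (r%:C%C * root1 R N k) *: v) + N%:R * eta.
Proof.
move=> ef r0 eta0.
have [d d0 dP] := vcont_unif (vnorm z0 + r) (vcont_logplus ef) eta0.
have pi0 : 0 < pi *+ 2 :> R by rewrite mulrn_wgt0 // pi_gt0.
(* By [star_lip] the points of an arc of angle [2 pi / N] starting at [r] are within
   [2 * r * (2 pi / N)] of [r], which this [N] makes smaller than [d]. *)
pose N := (Num.truncn (2 * r * (pi *+ 2) / d)).+1.
have N0 : 0 < N%:R :> R by rewrite ltr0n.
have Nd : 2 * r * (pi *+ 2 / N%:R) < d.
  by rewrite mulrA ltr_pdivrMr // [ltRHS]mulrC -ltr_pdivrMr // truncnS_gt.
exists N => // v l0 v1 l0r.
have rot1 k : cabs (root1 R N k) = 1 by rewrite cabs_circ.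
have hg : holo (fun l => f (z0 + l *: v)) by exact: entire_line.
apply: (rotated_sum_le (N := N) _ hg l0r) => // t /andP[t0 tN].
have -> : N%:R * eta = \sum_(k < N) eta by rewrite sumr_const card_ord mulr_natl.
rewrite -big_split /=; apply: ler_sum => k _.
rewrite -lerBlDl; apply: le_trans (ler_norm _) _; apply/ltW/dP => j.
  rewrite !mxE; apply: le_trans (cabsD _ _) _; apply: lerD; first exact: cabs_le_vnorm.
  rewrite !cabsM rot1 cabs_real (gtr0_norm r0) mulr1 -[leRHS]mulr1 ler_wpM2l ?(ltW r0) //.
rewrite !mxE opprD addrACA subrr add0r -mulrBl -mulrBl !cabsM rot1 mulr1.
have H : cabs (circ r t - r%:C%C) <= 2 * r * t.
  have cr : cabs (0 : R[i]) < r by rewrite cabs0.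
  have := star_lip t 0 cr (lexx 0) (lexx 0).
  rewrite /star expR0 !add0r !mul1r !subr0 oppr0 normr0 add0r (ger0_norm t0).
  by rewrite /circ cos0 sin0 mulr1 mulr0.
apply: le_lt_trans Nd; rewrite -[leRHS]mulr1; apply: ler_pM; rewrite ?cabs_ge0 ?v1 //.
by apply: le_trans H _; rewrite ler_wpM2l // mulr_ge0 // ltW.
Qed.

Definition pint (h : V -> R) : \bar R :=
  gint (fun x => if pball x then (h x)%:E else 0%E).

Lemma vmeas_pint h : rmeas h -> vmeas (fun x => if pball x then (h x)%:E else 0%E).
Proof.
move=> mh; apply: vmeas_if; [exact: bmeas_pball|exact: vmeas_EFin|exact: vmeas_cst].
Qed.

Lemma pint_ge0 h : (forall x, 0 <= h x) -> (0 <= pint h)%E.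
Proof. by move=> h0; apply: gint_ge0 => x; case: ifP; rewrite ?lee_fin. Qed.

Lemma le_pint (h1 h2 : V -> R) : rmeas h1 -> rmeas h2 -> (forall x, 0 <= h1 x) ->
  (forall x, 0 <= h2 x) -> (forall x, pball x -> h1 x <= h2 x) -> (pint h1 <= pint h2)%E.
Proof.
move=> m1 m2 p1 p2 le; apply: le_gint; try exact: vmeas_pint;
  try by move=> x; case: ifP; rewrite ?lee_fin.
by move=> x; case: ifP => // px; rewrite lee_fin le.
Qed.

Lemma pintD (h1 h2 : V -> R) : rmeas h1 -> rmeas h2 -> (forall x, 0 <= h1 x) ->
  (forall x, 0 <= h2 x) -> (pint (fun x => h1 x + h2 x)%R = pint h1 + pint h2)%E.
Proof.
move=> m1 m2 p1 p2; rewrite -gintD; try exact: vmeas_pint;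
  try by move=> x; case: ifP; rewrite ?lee_fin.
by apply: eq_gint => x; case: ifP; rewrite ?adde0.
Qed.

Lemma pint_cst (c : R) : 0 <= c -> (pint (fun=> c) = c%:E * gint (ind (@pball R m)))%E.
Proof.
move=> c0; rewrite -gintZl ?lee_fin //; last 2 first.
- exact: (vmeas_ind (@bmeas_pball R m)).
- exact: ind_ge0.
by apply: eq_gint => x; rewrite /ind; case: ifP; rewrite ?mule0 ?mule1.
Qed.

Lemma pball_rot (u : R[i]) x : cabs u = 1 -> pball (u *: x : V) = pball x.
Proof. by move=> u1; rewrite /pball vnormZ u1 mul1r. Qed.

Lemma pint_rot h (u : R[i]) : cabs u = 1 -> rmeas h -> (forall x, 0 <= h x) ->
  pint (fun x => h (u *: x)) = pint h.
Proof.
move=> u1 mh h0; rewrite -[RHS](gint_rot u1 (vmeas_pint mh)).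
  by apply: eq_gint => x; rewrite pball_rot.
by move=> x; case: ifP; rewrite ?lee_fin.
Qed.

Lemma rmeas_scale h (u : R[i]) : rmeas h -> rmeas (fun x => h (u *: x)).
Proof.
move=> mh d T p mp; apply: mh; have := vmap_affine 0 u mp; congr vmap.
by apply/funext => t; rewrite add0r.
Qed.

Lemma pint_sum (I : Type) (s : seq I) (h : I -> V -> R) : (forall i, rmeas (h i)) ->
  (forall i x, 0 <= h i x) ->
  (pint (fun x => \sum_(i <- s) h i x)%R = \sum_(i <- s) pint (h i))%E.
Proof.
move=> mh h0; rewrite -gint_sum; last 2 first.
- by move=> i; exact: vmeas_pint.
- by move=> i x; case: ifP; rewrite ?lee_fin.
apply: eq_gint => x; case: ifP => px; first by rewrite sumEFin.
by rewrite big1.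
Qed.

Lemma vol_fin_num : gint (ind (@pball R m)) \is a fin_num.
Proof.
rewrite ge0_fin_numE; last by apply: gint_ge0; exact: ind_ge0.
by apply: le_lt_trans (le_vol R m) (vol_fin R m).
Qed.

(** By rotation invariance the [N] terms of a sum have the same integral; dividing by [N] leaves an
    error [eta * vol] with [eta] arbitrary. No integral over a circle is ever formed. *)
Lemma pint_rot_le (h1 h2 : V -> R) : rmeas h1 -> rmeas h2 -> (forall x, 0 <= h1 x) ->
  (forall x, 0 <= h2 x) ->
  (forall eta : R, 0 < eta -> exists2 N : nat, (0 < N)%N & forall x, pball x ->
     \sum_(k < N) h1 (root1 R N k *: x) <= \sum_(k < N) h2 (root1 R N k *: x) + N%:R * eta) ->
  (pint h1 <= pint h2)%E.
Proof.
move=> m1 m2 p1 p2 H.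
have vfin := vol_fin_num.
have v0 : 0 <= fine (gint (ind (@pball R m))).
  by apply: fine_ge0; apply: gint_ge0; exact: ind_ge0.
apply/lee_addgt0Pr => e e0.
pose v := fine (gint (ind (@pball R m))).
have v1 : 0 < v + 1 by rewrite ltr_wpDl.
have [N N0 HN] := H (e / (v + 1)) (divr_gt0 e0 v1).
have N0' : 0 < N%:R :> R by rewrite ltr0n.
have eta0 : 0 <= e / (v + 1) by rewrite divr_ge0 // ltW.
apply: (@le_trans _ _ (pint h2 + (e / (v + 1))%:E * gint (ind (@pball R m)))%E); last first.
  rewrite leeD2l // -(fineK vfin) -EFinM lee_fin -/v mulrAC ler_pdivrMr // ler_wpM2l ?(ltW e0) //.
  by rewrite lerDl.
have N1 : (0 < N%:R%:E :> \bar R)%E by rewrite lte_fin.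
rewrite -(@lee_pmul2l _ N%:R%:E) // -pint_cst //.
have sumE h : rmeas h -> (forall x, 0 <= h x) ->
    (N%:R%:E * pint h = pint (fun x => \sum_(k < N) h (root1 R N k *: x))%R)%E.
  move=> mh h0; rewrite (pint_sum _ (h := fun (k : 'I_N) x => h (root1 R N k *: x))) //.
    rewrite (eq_bigr (fun=> pint h)); last by move=> k _; rewrite pint_rot // cabs_circ.
    by rewrite sumr_const card_ord mule_natl.
  by move=> k; exact: rmeas_scale.
rewrite ge0_muleDr ?pint_ge0 // (sumE h1) // (sumE h2) // sumE //.
have mr h : rmeas h -> rmeas (fun x => \sum_(k < N) h (root1 R N k *: x)).
  by move=> mh; apply: rmeas_sum => k; exact: rmeas_scale.
have mc : rmeas (fun _ : V => \sum_(k < N) e / (v + 1)) by exact: rmeas_cst.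
rewrite -pintD; [|exact: mr|exact: mc|by move=> x; exact: sumr_ge0
  |by move=> x; exact: sumr_ge0].
apply: le_pint.
- exact: mr.
- by apply: rmeasD; [exact: mr|exact: mc].
- by move=> x; exact: sumr_ge0.
- by move=> x; rewrite addr_ge0 //; exact: sumr_ge0.
- by move=> x /HN; rewrite sumr_const card_ord mulr_natl.
Qed.

Lemma rmeas_logp f : entire f -> rmeas (logp f).
Proof. by move=> ef; apply: rmeas_vcont; exact: vcont_logplus. Qed.

Lemma rmeas_affine h (z : V) (c : R[i]) : rmeas h -> rmeas (fun x => h (z + c *: x)).
Proof. by move=> mh d T p mp; apply: mh; exact: vmap_affine. Qed.

Lemma rmeas_normalize h (r : R) : rmeas h ->
  rmeas (fun x => h (r%:C%C *: (((vnorm x)^-1)%:C%C *: x))).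
Proof.
move=> mh d T p mp; apply: (@rmeas_scale h r%:C%C mh d T (fun t => ((vnorm (p t))^-1)%:C%C *: p t)).
by apply: vmap_scale => //; exact: (rmeas_inv (@vnorm_ge0 R m) (@rmeas_vnorm R m) mp).
Qed.

(** The case [l0 = 0]: the centre of the disc of direction [x] through [z0]. *)
Lemma submean_ball (f : V -> R[i]) (z0 : V) (r : R) : entire f -> 0 < r ->
  ((logp f z0)%:E * gint (ind (@pball R m)) <= pint (fun x => logp f (z0 + r%:C%C *: x))%R)%E.
Proof.
move=> ef r0; rewrite -pint_cst ?logp_ge0 //; apply: pint_rot_le.
- exact: rmeas_cst.
- by apply: rmeas_affine; exact: rmeas_logp.
- by move=> x; exact: logp_ge0.
- by move=> x; exact: logp_ge0.
move=> eta eta0; have [N N0 HN] := rot_pointwise z0 ef r0 eta0.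
exists N => // x /andP[_ x1].
have xj j : cabs (x 0 j) <= 1 by apply: le_trans (cabs_le_vnorm _ _) x1.
have c0 : cabs (0 : R[i]) < r by rewrite cabs0.
have := HN x 0 xj c0; congr (_ <= _ + _); apply: eq_bigr => k _.
  by rewrite mul0r scale0r addr0.
by rewrite scalerA.
Qed.

(** On the complex line through the origin and [x], the point [s x] has parameter [s * vnorm x < r]
    in the unit direction [x / vnorm x]. *)
Lemma ball_le_sphere (f : V -> R[i]) (s r : R) : entire f -> 0 <= s -> s < r ->
  (pint (fun x => logp f (s%:C%C *: x)) <=
   pint (fun x => logp f (r%:C%C *: (((vnorm x)^-1)%:C%C *: x))))%E.
Proof.
move=> ef s0 sr; have r0 : 0 < r by exact: le_lt_trans sr.
apply: pint_rot_le.
- by apply: rmeas_scale; exact: rmeas_logp.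
- by apply: rmeas_normalize; exact: rmeas_logp.
- by move=> x; exact: logp_ge0.
- by move=> x; exact: logp_ge0.
move=> eta eta0; have [N N0 HN] := rot_pointwise 0 ef r0 eta0.
exists N => // x /andP[x0 x1]; have xn := lt0r_neq0 x0.
pose v := ((vnorm x)^-1)%:C%C *: x.
have vv : vnorm v = 1.
  by rewrite vnormZ cabs_real ger0_norm ?invr_ge0 ?vnorm_ge0 // mulVf.
have v1 j : cabs (v 0 j) <= 1 by rewrite -vv; exact: cabs_le_vnorm.
have l0r : cabs ((s * vnorm x)%:C%C : R[i]) < r.
  rewrite cabs_real ger0_norm ?mulr_ge0 ?vnorm_ge0 //.
  by apply: le_lt_trans sr; rewrite -[leRHS]mulr1 ler_wpM2l.
have := HN v _ v1 l0r; congr (_ <= _ + _); apply: eq_bigr => k _; congr (logp f _).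
  rewrite add0r /v !scalerA; congr (_ *: _).
  have e : (vnorm x)%:C%C * ((vnorm x)^-1)%:C%C = 1 :> R[i].
    by rewrite -rmorphM /= mulfV.
  rewrite rmorphM /= -[RHS]mulr1 -e; ring.
rewrite add0r /v vnormZ cabs_circ // mul1r !scalerA; congr (_ *: _).
by rewrite mulrAC -mulrA mulrC.
Qed.

End SubmeanValue.

Section LogIntegrals.
Variable R : realType.
Variable m : nat.
Hypothesis m_gt0 : (0 < m)%N.
Local Notation V := 'rV[R[i]]_m.
Local Notation vol := (gint (ind (@pball R m))).
Implicit Types (h : V -> R) (f g : V -> R[i]).

Lemma pint_fin h (M : R) : rmeas h -> (forall x, 0 <= h x) ->
  (forall x, pball x -> h x <= M) -> pint h \is a fin_num.
Proof.
move=> mh h0 hM; rewrite ge0_fin_numE ?pint_ge0 //.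
apply: (@le_lt_trans _ _ (pint (fun _ : V => `|M|))).
  apply: le_pint => //.
  by move=> x /hM /le_trans; apply; exact: ler_norm.
by rewrite pint_cst // -(fineK (vol_fin_num R m)) -EFinM ltry.
Qed.

Lemma vnorm_le_sum (z : V) : vnorm z <= \sum_j cabs (z 0 j).
Proof.
have s0 : 0 <= \sum_j cabs (z 0 j) by apply: sumr_ge0 => j _; exact: cabs_ge0.
rewrite -[leRHS](ger0_norm s0) -sqrtr_sqr ler_wsqrtr // expr2 mulr_suml.
apply: ler_sum => j _; rewrite expr2 ler_wpM2l ?cabs_ge0 // (bigD1 j) //= lerDl.
by apply: sumr_ge0 => i _; exact: cabs_ge0.
Qed.

Lemma vnorm_le_nat (z : V) (c : R) : (forall j, cabs (z 0 j) <= c) -> vnorm z <= m%:R * c.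
Proof.
move=> zc; apply: le_trans (vnorm_le_sum z) _.
apply: (@le_trans _ _ (\sum_(j < m) c)); first by apply: ler_sum => j _.
by rewrite sumr_const card_ord mulr_natl.
Qed.

(** The set is invariant under dilation by 2, which multiplies volumes by [2 ^+ (2 * m)], and its
    volume is finite. *)
Lemma gint_point : gint (ind (fun x : V => vnorm x <= 0)) = 0%E.
Proof.
set phi := ind _.
have mp : vmeas phi.
  by apply: vmeas_ind; apply: bmeas_ler; [exact: rmeas_vnorm|exact: rmeas_cst].
have p0 x : (0 <= phi x)%E by exact: ind_ge0.
have pfin : gint phi \is a fin_num.
  rewrite ge0_fin_numE ?gint_ge0 //; apply: le_lt_trans (vol_fin R m).
  apply: le_gint => //; first exact: (vmeas_ind (@bmeas_ball R m)); first exact: ind_ge0.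
  move=> x; rewrite /phi /ind /cball; case: ifP => [x0|_]; last by case: ifP.
  by rewrite (le_trans x0).
have := gint_affine 0 (ltr0Sn R 1) mp p0.
have -> : gint (fun x => phi (0 + (2%:R : R)%:C%C *: x)) = gint phi.
  apply: eq_gint => x; rewrite /phi /ind add0r vnormZ cabs_real ger0_norm //.
  by rewrite pmulr_rle0.
rewrite -(fineK pfin) -EFinM => -[] /eqP; rewrite -subr_eq0 -{2}(mul1r (fine _)) -mulrBl.
rewrite mulf_eq0 subr_eq0 => /orP[|/eqP ->] //.
rewrite pexprn_eq1 // => /orP[|/eqP h]; first by rewrite muln_eq0 /= -leqn0 leqNgt m_gt0.
by exfalso; lra.
Qed.

Lemma gint_cball h : rmeas h -> (forall x, 0 <= h x) ->
  gint (fun x => if cball x then (h x)%:E else 0%E) = pint h.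
Proof.
move=> mh h0; have mp : vmeas (ind (fun x : V => vnorm x <= 0)).
  by apply: vmeas_ind; apply: bmeas_ler; [exact: rmeas_vnorm|exact: rmeas_cst].
have -> : pint h = (pint h + (h 0)%:E * gint (ind (fun x : V => (vnorm x <= 0)%R)))%E.
  by rewrite gint_point mule0 adde0.
rewrite -gintZl //; last 2 first.
- exact: ind_ge0.
- by rewrite lee_fin.
rewrite -gintD; last 4 first.
- exact: vmeas_pint.
- exact: vmeasZ.
- by move=> x; case: ifP; rewrite ?lee_fin.
- by move=> x; rewrite mule_ge0 ?lee_fin // ind_ge0.
apply: eq_gint => x; rewrite /pball /cball /ind.
have [x0|x0] := leP (vnorm x) 0; last by rewrite /= mule0 adde0.
have -> : x = 0 by apply/eqP; rewrite -vnorm_eq0 eq_le x0 vnorm_ge0.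
have -> : vnorm (0 : V) = 0 by apply/eqP; rewrite vnorm_eq0.
by rewrite ler01 mule1 add0e.
Qed.

(** For [0 < t <= 1], this is [log^+ (1 / x)] cut at height [- ln t]; it is bounded even at
    [x = 0]. *)
Definition nlog (t x : R) : R := - ln (Num.max t (Num.min 1 x)).

Lemma nlog_ge0 t x : 0 < t <= 1 -> 0 <= nlog t x.
Proof.
move=> /andP[t0 t1]; rewrite oppr_ge0 ln_le0 // ge_max t1 /=.
by rewrite ge_min lexx.
Qed.

Lemma nlog_le t x : 0 < t <= 1 -> nlog t x <= - ln t.
Proof.
move=> /andP[t0 t1]; rewrite lerN2 ler_ln ?posrE ?le_max ?lexx //.
by rewrite lt_max t0.
Qed.

(** The substitute for [log x = log^+ x - log^+ (1 / x)], all terms being nonnegative and finite.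
    For [x = |g|] the last one is again [log^+] of an entire function, to which the sub-mean value
    inequalities apply. *)
Lemma nlogE t x : 0 < t <= 1 -> logplus x - ln t = nlog t x + logplus (x / t).
Proof.
move=> /andP[t0 t1]; rewrite /nlog !logplusE.
have [x1|x1] := leP 1 x.
  have tx : 1 <= x / t by rewrite ler_pdivlMr // mul1r (le_trans t1).
  have x0 : 0 < x by exact: lt_le_trans x1.
  rewrite (max_idPr t1) ln1 oppr0 add0r.
  by rewrite (max_idPr tx) ln_div ?posrE.
have [tx|tx] := leP t x.
  have x0 : 0 < x by exact: lt_le_trans tx.
  have tx1 : 1 <= x / t by rewrite ler_pdivlMr // mul1r.
  by rewrite (max_idPr tx1) ln_div ?posrE // ln1; lra.
have xt : x / t <= 1 by rewrite ler_pdivrMr // mul1r ltW.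
by rewrite (max_idPl xt) ln1; lra.
Qed.

Lemma entireM f g : entire f -> entire g -> entire (fun z => f z * g z).
Proof. by move=> ef eg z; exact: (differentiableM (ef z) (eg z)). Qed.

Lemma entire_cst (c : R[i]) : entire (fun _ : V => c).
Proof. by move=> z; exact: differentiable_cst. Qed.

Lemma logp_scale g (t : R) z : 0 < t ->
  logp (fun z => (t^-1)%:C%C * g z) z = logplus (cabs (g z) / t).
Proof.
move=> t0; rewrite /logp cabsM cabs_real ger0_norm ?invr_ge0 ?(ltW t0) //.
by rewrite mulrC.
Qed.

Lemma rmeas_nlog t g : 0 < t <= 1 -> entire g -> rmeas (fun z => nlog t (cabs (g z))).
Proof.
move=> t01 eg; have /andP[t0 _] := t01.
have -> : (fun z => nlog t (cabs (g z))) =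
    (fun z => logp g z + (- ln t) + (- 1) * logp (fun z => (t^-1)%:C%C * g z) z).
  by apply/funext => z; rewrite logp_scale // nlogE // mulN1r addrK.
apply: rmeasD; [apply: rmeasD|apply: rmeasM].
- exact: rmeas_logp.
- exact: rmeas_cst.
- exact: rmeas_cst.
- by apply: rmeas_logp; apply: entireM => //; exact: entire_cst.
Qed.

Definition onsphere (r : R) (x : V) : V := r%:C%C *: (((vnorm x)^-1)%:C%C *: x).

Lemma onsphere_bound r x : 0 <= r -> forall j, cabs (onsphere r x 0 j) <= r.
Proof.
move=> r0 j; apply: le_trans (cabs_le_vnorm _ _) _.
rewrite /onsphere !vnormZ !cabs_real ger0_norm // (ger0_norm (x := _^-1)) ?invr_ge0 ?vnorm_ge0 //.
rewrite -[leRHS]mulr1 ler_wpM2l //.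
by have [->|x0] := eqVneq (vnorm x) 0; rewrite ?mulr0 ?mulVf.
Qed.

Definition sph (r : R) h : \bar R := pint (fun x => h (onsphere r x)).

Lemma vbound_logp f r : entire f -> exists M : R, forall z : V, (forall j, cabs (z 0 j) <= r) ->
  logp f z <= M.
Proof.
move=> ef; have [M MP] := vcont_bounded r (vcont_logplus ef).
by exists M => z /MP; apply: le_trans; exact: ler_norm.
Qed.

Lemma sph_fin r f : 0 <= r -> entire f -> sph r (logp f) \is a fin_num.
Proof.
move=> r0 ef; have [M MP] := vbound_logp r ef.
apply: (pint_fin (M := M)).
- by apply: rmeas_normalize; exact: rmeas_logp.
- by move=> x; exact: logp_ge0.
- by move=> x _; apply: MP; exact: onsphere_bound.
Qed.

Lemma pint_nlogE (p : V -> V) t g : 0 < t <= 1 ->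
  rmeas (fun x => logp g (p x)) -> rmeas (fun x => nlog t (cabs (g (p x)))) ->
  rmeas (fun x => logp (fun z => (t^-1)%:C%C * g z) (p x)) ->
  (pint (fun x => logp g (p x)) + (- ln t)%:E * vol =
   pint (fun x => nlog t (cabs (g (p x)))) +
   pint (fun x => logp (fun z => ((t^-1)%:C%C * g z)%R) (p x)))%E.
Proof.
move=> t01 m1 m2 m3; have /andP[t0 t1] := t01.
have lt0 : 0 <= - ln t by rewrite oppr_ge0 ln_le0.
rewrite -pint_cst // -!pintD //; try by move=> x; exact: logp_ge0.
- by apply: eq_gint => x; rewrite logp_scale // -nlogE.
- by move=> x; exact: nlog_ge0.
Qed.

(** In [nlogE] over a ball centred at [z0], the mean of [log^+ |g / t|] is at least its value at
    [z0], which is [- ln t] up to a constant because [g z0 != 0]. So [- ln t] drops out and [C] does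
    not depend on [t]. *)
Lemma nlog_ball_bound g (z0 : V) : entire g -> g z0 != 0 ->
  exists2 C : R, 0 <= C & forall t, 0 < t <= 1 ->
    (pint (fun x => nlog t (cabs (g x))) <= C%:E)%E.
Proof.
(* The ball of centre [z0] and radius [rho] contains the unit ball; the factor [m] comes from
   bounding [vnorm] through the coordinates by [vnorm_le_nat]. *)
move=> eg gz0; pose rho := m%:R * (1 + vnorm z0).
have m1R : 1 <= m%:R :> R by rewrite ler1n.
have rho1 : 1 <= rho by have := vnorm_ge0 z0; rewrite /rho; nra.
have rho0 : 0 < rho by exact: lt_le_trans rho1.
pose p (x : V) := z0 + rho%:C%C *: x.
have [M MP] := vbound_logp (vnorm z0 + rho) eg.
have pb x : pball x -> forall j, cabs (p x 0 j) <= vnorm z0 + rho.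
  move=> /andP[_ x1] j; rewrite !mxE; apply: le_trans (cabsD _ _) _.
  apply: lerD; first exact: cabs_le_vnorm.
  rewrite cabsM cabs_real gtr0_norm // -[leRHS]mulr1 ler_wpM2l ?(ltW rho0) //.
  by apply: le_trans (cabs_le_vnorm _ _) x1.
have m1 : rmeas (fun x => logp g (p x)) by apply: rmeas_affine; exact: rmeas_logp.
have f1 : pint (fun x => logp g (p x)) \is a fin_num.
  by apply: (pint_fin (M := M)) => // [x|x /pb]; [exact: logp_ge0|exact: MP].
have vfin := vol_fin_num R m.
have v0 : 0 <= fine vol by apply: fine_ge0; apply: gint_ge0; exact: ind_ge0.
pose c0 : R := - ln (Num.min 1 (cabs (g z0))).
have c00 : 0 <= c0 by rewrite oppr_ge0 ln_le0 // ge_min lexx.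
pose C1 := fine (pint (fun x => logp g (p x))) + c0 * fine vol.
have C10 : 0 <= C1.
  by rewrite addr_ge0 ?mulr_ge0 //; apply: fine_ge0; apply: pint_ge0 => x; exact: logp_ge0.
exists (rho ^+ (2 * m) * C1); first by rewrite mulr_ge0 // exprn_ge0 // ltW.
move=> t t01; have /andP[t0 t1] := t01.
have egt : entire (fun z => (t^-1)%:C%C * g z) by apply: entireM => //; exact: entire_cst.
have m2 : rmeas (fun x => nlog t (cabs (g (p x)))).
  by apply: (rmeas_affine _ _ (h := fun z => nlog t (cabs (g z)))); exact: rmeas_nlog.
have m3 : rmeas (fun x => logp (fun z => (t^-1)%:C%C * g z) (p x)).
  by apply: rmeas_affine; exact: rmeas_logp.
have f2 : pint (fun x => nlog t (cabs (g (p x)))) \is a fin_num.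
  by apply: (pint_fin (M := - ln t)) => // x; [exact: nlog_ge0|move=> _; exact: nlog_le].
have step1 : (pint (fun x => nlog t (cabs (g (p x)))) <= C1%:E)%E.
  have E := pint_nlogE t01 m1 m2 m3.
  have S := submean_ball z0 egt rho0; rewrite -/p in S.
  have f3 : pint (fun x => logp (fun z => (t^-1)%:C%C * g z) (p x)) \is a fin_num.
    have fr (a b : R) (y : \bar R) : a%:E = (b%:E + y)%E -> y \is a fin_num by case: y.
    by move: E; rewrite -(fineK f1) -(fineK vfin) -(fineK f2) -EFinM -EFinD => /fr.
  move: E S; rewrite -(fineK f1) -(fineK vfin) -(fineK f2) -(fineK f3) -!EFinM -!EFinD.
  move=> [E]; rewrite !lee_fin /C1 => S.
  have : - ln t - logp (fun z => (t^-1)%:C%C * g z) z0 <= c0.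
    rewrite logp_scale //; have := nlogE (cabs (g z0)) t01.
    have : nlog t (cabs (g z0)) <= c0.
      rewrite lerN2 ler_ln ?posrE ?lt_max ?lt_min ?t0 ?ltr01 ?cabs_gt0 //.
      by rewrite le_max lexx orbT.
    by have := logplus_ge0 (cabs (g z0)); lra.
  move=> /(ler_wpM2r v0); rewrite mulrBl; lra.
rewrite EFinM; apply: le_trans (lee_wpmul2l _ step1); last by rewrite lee_fin exprn_ge0 // ltW.
have mn := rmeas_nlog t01 eg.
(* The affine change of variables moves the missing centre of [pball], so the domains are compared
   inside the full ball. *)
rewrite -(gint_cball m2); last by move=> x; exact: nlog_ge0.
rewrite -[leLHS](gint_affine z0 rho0 (vmeas_pint mn)); last first.
  by move=> x; case: ifP; rewrite ?lee_fin ?nlog_ge0.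
apply: lee_wpmul2l; first by rewrite lee_fin exprn_ge0 // ltW.
apply: le_gint.
- exact: (vmeas_affine z0 rho%:C%C (vmeas_pint mn)).
- apply: vmeas_if; [exact: bmeas_ball|exact: vmeas_EFin|exact: vmeas_cst].
- by move=> x; case: ifP; rewrite ?lee_fin ?nlog_ge0.
- by move=> x; case: ifP; rewrite ?lee_fin ?nlog_ge0.
move=> x; case: ifP => [/andP[_ px]|_]; last by case: ifP; rewrite ?lee_fin ?nlog_ge0.
rewrite ifT // /cball.
have -> : 1 = m%:R * (m%:R^-1) :> R by rewrite mulfV // pnatr_eq0 -lt0n.
apply: vnorm_le_nat => j.
have H : rho * cabs (x 0 j) <= 1 + vnorm z0.
  have -> : rho * cabs (x 0 j) = cabs (p x 0 j - z0 0 j).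
    by rewrite !mxE addrC addKr cabsM cabs_real gtr0_norm.
  apply: le_trans (cabsB _ _) _; apply: lerD; last exact: cabs_le_vnorm.
  exact: le_trans (cabs_le_vnorm _ _) px.
have z1 : 0 < 1 + vnorm z0 by rewrite ltr_wpDr ?vnorm_ge0.
rewrite -[leRHS]mul1r ler_pdivlMr ?ltr0n // -(ler_pM2r z1) mul1r.
by apply: le_trans H; rewrite le_eqVlt; apply/orP; left; apply/eqP; rewrite /rho; ring.
Qed.

End LogIntegrals.

(** * Growth of the characteristic *)

Section Growth.
Variable R : realType.
Variable m : nat.
Hypothesis m_gt0 : (0 < m)%N.
Local Notation V := 'rV[R[i]]_m.
Local Notation vol := (gint (ind (@pball R m))).
Implicit Types (h : V -> R) (f g : V -> R[i]).

(** Cancels the term [D], which stands for [- ln t * vol], between two instances of [nlogE];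
    extended reals allow it once all the terms are finite. *)
Lemma ereal_cancel (A B N N' A' B' D : \bar R) (C : R) :
  A \is a fin_num -> B \is a fin_num -> N \is a fin_num -> N' \is a fin_num ->
  A' \is a fin_num -> B' \is a fin_num -> D \is a fin_num ->
  (A + D = N + B -> A' + D = N' + B' -> B' <= B -> N' <= C%:E -> 0 <= A' ->
   N <= A + C%:E)%E.
Proof.
case: A B N N' A' B' D => [A| |] [B| |] [N| |] [N'| |] [A'| |] [B'| |] [D| |] //.
move=> _ _ _ _ _ _ _; rewrite -!EFinD => -[E] [E']; rewrite !lee_fin; lra.
Qed.

(** This is [m(r, 1/g) <= m(r, g) + O(1)] before the cut is removed. It compares [nlogE] on the
    sphere with [nlogE] on the unit ball, where [log^+ |g / t|] has the smaller integral by
    [ball_le_sphere]. *)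
Lemma sph_nlog_le g (z0 : V) : entire g -> g z0 != 0 ->
  exists2 C : R, 0 <= C & forall r t, 1 < r -> 0 < t <= 1 ->
    (sph r (fun z => nlog t (cabs (g z))) <= sph r (logp g) + C%:E)%E.
Proof.
move=> eg gz0; have [C C0 HC] := nlog_ball_bound m_gt0 eg gz0.
exists C => // r t r1 t01; have /andP[t0 t1] := t01; have r0 : 0 <= r by rewrite ltW // (lt_trans _ r1).
have egt : entire (fun z => (t^-1)%:C%C * g z) by apply: entireM => //; exact: entire_cst.
have mg := rmeas_logp eg; have mgt := rmeas_logp egt; have mn := rmeas_nlog t01 eg.
have E := pint_nlogE (p := onsphere r) t01 (rmeas_normalize r mg)
  (rmeas_normalize r mn) (rmeas_normalize r mgt).
have E' := pint_nlogE (p := fun x => 1%:C%C *: x) t01 (rmeas_scale _ mg)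
  (rmeas_scale _ mn) (rmeas_scale _ mgt).
have LE := ball_le_sphere egt ler01 r1.
have HC' : (pint (fun x => nlog t (cabs (g (1%:C%C *: x)))) <= C%:E)%E.
  by apply: le_trans (HC t t01); apply: le_gint => [||x|x|x];
    try (by apply: vmeas_pint; try exact: mn; apply: (rmeas_scale (h := fun z => nlog t (cabs (g z))))) ;
    try (by case: ifP; rewrite ?lee_fin ?nlog_ge0); rewrite scale1r.
have f1 : sph r (logp g) \is a fin_num by exact: sph_fin.
have f2 : sph r (logp (fun z => (t^-1)%:C%C * g z)) \is a fin_num by exact: sph_fin.
have f3 : sph r (fun z => nlog t (cabs (g z))) \is a fin_num.
  apply: (pint_fin (M := - ln t)); first exact: (rmeas_normalize r mn).
    by move=> x; exact: nlog_ge0.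
  by move=> x _; exact: nlog_le.
have f4 : pint (fun x => nlog t (cabs (g (1%:C%C *: x)))) \is a fin_num.
  apply: (pint_fin (M := - ln t)); first exact: (rmeas_scale _ mn).
    by move=> x; exact: nlog_ge0.
  by move=> x _; exact: nlog_le.
have vfin := vol_fin_num R m.
have [M MP] := vbound_logp 1 eg; have [M' MP'] := vbound_logp 1 egt.
have b1 x : pball x -> forall j, cabs ((1%:C%C *: x : V) 0 j) <= 1.
  by move=> /andP[_ x1] j; rewrite scale1r; apply: le_trans (cabs_le_vnorm _ _) x1.
have f5 : pint (fun x => logp g (1%:C%C *: x)) \is a fin_num.
  apply: (pint_fin (M := M)); first exact: (rmeas_scale _ mg).
    by move=> x; exact: logp_ge0.
  by move=> x /b1; exact: MP.
have f6 : pint (fun x => logp (fun z => (t^-1)%:C%C * g z) (1%:C%C *: x)) \is a fin_num.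
  apply: (pint_fin (M := M')); first exact: (rmeas_scale _ mgt).
    by move=> x; exact: logp_ge0.
  by move=> x /b1; exact: MP'.
have g5 : (0 <= pint (fun x => logp g (1%:C%C *: x)))%E.
  by apply: pint_ge0 => x; exact: logp_ge0.
have f7 : ((- ln t)%:E * vol)%E \is a fin_num by rewrite fin_numM.
exact: (ereal_cancel f1 f2 f3 f4 f5 f6 f7 E E' LE HC' g5).
Qed.

(** The ball of radius [rho] about [z0] lies in the ball of radius [S = 2 * m * rho] about the
    origin. [K] is the ratio of their volumes, the same for all [f] and [z0]. *)
Lemma logp_le_sph : exists2 K : R, 0 < K & forall f (z0 : V), entire f ->
  exists S : R, forall r, S < r -> ((logp f z0)%:E * vol <= K%:E * sph r (logp f))%E.
Proof.
pose c : R := 2 * m%:R.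
have m1R : 1 <= m%:R :> R by rewrite ler1n.
have c0 : 0 < c by rewrite /c; lra.
exists (c ^+ (2 * m)); first exact: exprn_gt0.
move=> f z0 ef; pose rho := 1 + vnorm z0.
have rho1 : 1 <= rho by rewrite lerDl vnorm_ge0.
have rho0 : 0 < rho by exact: lt_le_trans rho1.
pose S := c * rho; have S0 : 0 < S by rewrite mulr_gt0.
exists S => r Sr; have mf := rmeas_logp ef.
apply: le_trans (submean_ball z0 ef rho0) _.
apply: le_trans (lee_wpmul2l _ (ball_le_sphere ef (ltW S0) Sr)); last first.
  by rewrite lee_fin exprn_ge0 // ltW.
have msf : rmeas (fun x => logp f (S%:C%C *: x)) by exact: rmeas_scale.
rewrite -(gint_cball m_gt0 msf); last by move=> x; exact: logp_ge0.
pose phi (y : V) : \bar R := if vnorm y <= S then (logp f y)%:E else 0%E.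
have mphi : vmeas phi.
  apply: vmeas_if; [|exact: vmeas_EFin|exact: vmeas_cst].
  by apply: bmeas_ler; [exact: rmeas_vnorm|exact: rmeas_cst].
have phi0 y : (0 <= phi y)%E by rewrite /phi; case: ifP; rewrite ?lee_fin ?logp_ge0.
have r2 : 0 < rho ^+ (2 * m) by exact: exprn_gt0.
rewrite -(@lee_pmul2l _ (rho ^+ (2 * m))%:E) ?lte_fin //.
rewrite muleA -EFinM -exprMn [rho * c]mulrC -/S.
have -> : gint (fun x => if cball x then (logp f (S%:C%C *: x))%:E else 0%E) =
   gint (fun x => phi (0 + S%:C%C *: x)).
  apply: eq_gint => x; rewrite /phi /cball add0r vnormZ cabs_real gtr0_norm //.
  by have -> : (S * vnorm x <= S) = (vnorm x <= 1) by rewrite -[leRHS]mulr1 ler_pM2l.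
rewrite (gint_affine 0 S0 mphi phi0) -(gint_affine z0 rho0 mphi phi0).
apply: lee_wpmul2l; first by rewrite lee_fin ltW.
apply: le_gint => //.
- by apply: vmeas_pint; exact: rmeas_affine.
- exact: vmeas_affine.
- by move=> x; case: ifP; rewrite ?lee_fin ?logp_ge0.
move=> x; case: ifP => [/andP[_ x1]|] //; rewrite /phi ifT //.
apply: (@le_trans _ _ (m%:R * (vnorm z0 + rho))); last first.
  by rewrite /S /c /rho; have := vnorm_ge0 z0; nra.
apply: vnorm_le_nat => j; rewrite !mxE; apply: le_trans (cabsD _ _) _.
apply: lerD; first exact: cabs_le_vnorm.
rewrite cabsM cabs_real gtr0_norm // -[leRHS]mulr1 ler_wpM2l ?(ltW rho0) //.
exact: le_trans (cabs_le_vnorm _ _) x1.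
Qed.

(** At 0 the difference quotient of [G l ^+ 2 / l] is the square of that of [G]. Squaring thus
    avoids the removable singularity of [G l / l]; the convention [0 / 0 = 0] gives the right
    value. *)
Lemma holo_sqr_div (G : R[i] -> R[i]) : holo G -> G 0 = 0 -> holo (fun l => G l ^+ 2 / l).
Proof.
move=> hG G0 l; have [->|l0] := eqVneq l 0; last first.
  have hid : derivable (id : R[i]^o -> R[i]^o) l 1 by exact: derivable_id.
  have h1 : derivable ((fun l => G l ^+ 2) : R[i]^o -> R[i]^o) l 1 by exact: holo_exp.
  have h2 := @derivableV R[i] R[i]^o id l 1 l0 hid.
  exact: (derivableM h1 h2).
have /cvg_ex[D FD] := hG 0; apply/cvg_ex; exists (D * D).
pose q : R[i]^o -> R[i]^o := fun k => k^-1 *: ((G \o shift 0) (k *: 1) - G 0).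
pose p : R[i]^o -> R[i]^o := fun k =>
  k^-1 *: (((fun l => G l ^+ 2 / l) \o shift 0) (k *: 1) - G 0 ^+ 2 / 0).
have E : p = fun k => q k * q k.
  apply/funext => k; rewrite /p /q /= !scaler1 !addr0 !G0 !subr0 expr0n mul0r subr0.
  by rewrite /GRing.scale /= expr2; ring.
have H : q @ 0^' --> D := FD.
have H2 : (fun k => q k * q k) @ 0^' --> (D * D : R[i]^o) := cvgM H H.
rewrite -E in H2; exact: H2.
Qed.

(** With [G] the increment of [f] along a line, the maximum principle for [G l ^+ 2 / l] on the
    circle of radius [r] bounds its value at 1 by [(2 * M) ^+ 2 / r]. *)
Lemma liouville f (M : R) : entire f -> (forall z, cabs (f z) <= M) ->
  forall z, f z = f 0.
Proof.
move=> ef fM z.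
pose G (l : R[i]) := f (0 + l *: z) - f 0.
have hG : holo G.
  move=> l; have hcst : derivable (fun=> f 0 : R[i]^o) l 1 by exact: derivable_cst.
  have hf : derivable ((fun l => f (0 + l *: z)) : R[i]^o -> R[i]^o) l 1.
    exact: (@entire_line R m f 0 z ef l).
  have := derivableB hf hcst; exact.
have G0 : G 0 = 0 by rewrite /G scale0r addr0 subrr.
have GM l : cabs (G l) <= 2 * M.
  by apply: le_trans (cabsB _ _) _; rewrite mulr2n mulrDl mul1r lerD.
have M0 : 0 <= M by apply: le_trans (fM 0); exact: cabs_ge0.
have bnd r : 1 < r -> cabs (G 1) ^+ 2 <= (2 * M) ^+ 2 / r.
  move=> r1; have r0 : 0 < r by exact: lt_trans r1.
  have c1 : cabs (1 : R[i]) < r by rewrite cabs1.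
  have := max_principle (M := (2 * M) ^+ 2 / r) (holo_sqr_div hG G0) c1.
  rewrite divr1 cabsX; apply => t t0.
  rewrite cabsM cabsV cabs_circ ?(ltW r0) // cabsX ler_wpM2r ?invr_ge0 ?(ltW r0) //.
  by rewrite lerXn2r ?nnegrE ?cabs_ge0 // mulr_ge0.
suff : cabs (G 1) ^+ 2 <= 0.
  move=> h; have : cabs (G 1) == 0 by rewrite -sqrf_eq0 eq_le h sqr_ge0.
  by rewrite cabs_eq0 /G add0r scale1r subr_eq0 => /eqP.
apply/ler_addgt0Pr => e e0; rewrite add0r.
have r1 : 1 < (2 * M) ^+ 2 / e + 2.
  have : 0 <= (2 * M) ^+ 2 / e by rewrite divr_ge0 ?sqr_ge0 // ltW.
  lra.
apply: le_trans (bnd _ r1) _; rewrite ler_pdivrMr; last by exact: lt_trans r1.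
by rewrite mulrDr mulrCA mulfV ?gt_eqF // mulr1 lerDl mulr_ge0 // ltW.
Qed.

Lemma sph_unbounded f (B : R) : entire f -> nonconstant f ->
  exists r0 : R, forall r, r0 < r -> (B%:E <= sph r (logp f))%E.
Proof.
move=> ef nf; have [K K0 HK] := logp_le_sph.
have vfin := vol_fin_num R m.
have v0 : 0 < fine vol by rewrite fine_gt0 // (vol_gt0 R m_gt0) -ge0_fin_numE // ltW // vol_gt0.
have [z0 hz0] : exists z0, K * B / fine vol <= logp f z0.
  apply/not_existsP => H; apply: nf; exists (f 0).
  apply: (@liouville f (expR (Num.max 0 (K * B / fine vol)))) => // z.
  have /negP := H z; rewrite -ltNge /logp => lz.
  have [c1|c1] := leP (cabs (f z)) 1.
    by apply: le_trans c1 _; rewrite -expR0 ler_expR le_max lexx.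
  have c0 : 0 < cabs (f z) by exact: lt_trans c1.
  rewrite -[leLHS]lnK ?posrE // ler_expR le_max; apply/orP; right.
  by apply: le_trans (ltW lz); rewrite logplusE (max_idPr (ltW c1)).
have [S HS] := HK f z0 ef.
exists S => r /HS H; rewrite -(@lee_pmul2l _ K%:E) ?lte_fin //.
apply: le_trans H; rewrite -(fineK vfin) -!EFinM lee_fin.
by rewrite -ler_pdivrMr.
Qed.

End Growth.

(** * The auxiliary polynomial *)

Section Elimination.
Variables (R : realType) (m n : nat).
Local Notation V := 'rV[R[i]]_m.
Variable a : {ffun 'I_n -> nat} -> V -> R[i].
Local Notation P := (poly_in a).

Lemma poly_in_ext g h : (forall z, g z = h z) -> P g -> P h.
Proof. by move=> /funext ->. Qed.

Lemma poly_in_opp g : P g -> P (fun z => - g z).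
Proof.
move=> Pg; apply: (@poly_in_ext (fun z => -1 * g z)); first by move=> z; rewrite mulN1r.
by apply: poly_in_mul => //; exact: poly_in_cst.
Qed.

Lemma poly_in_sum (I : Type) (s : seq I) (Q : pred I) (g : I -> V -> R[i]) :
  (forall i, P (g i)) -> P (fun z => \sum_(i <- s | Q i) g i z).
Proof.
move=> Pg; elim: s => [|i s IH].
  by apply: (@poly_in_ext (fun=> 0)); [move=> z; rewrite big_nil|exact: poly_in_cst].
case Qi : (Q i); last by apply: poly_in_ext IH => z; rewrite big_cons Qi.
apply: (@poly_in_ext (fun z => g i z + \sum_(i <- s | Q i) g i z)).
  by move=> z; rewrite big_cons Qi.
exact: poly_in_add.
Qed.

(* Fraction-free Gaussian elimination, the pivots being absorbed into [b]. *)
Lemma poly_in_kernel (T : finType) (p : nat) (M : nat -> T -> V -> R[i])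
    (A : {set T}) (b : V -> R[i]) :
  (forall i j, P (M i j)) -> P b -> (exists z, b z != 0) -> (p < #|A|)%N ->
  exists u : T -> V -> R[i],
    [/\ forall j, P (u j), forall j z, j \notin A -> u j z = 0,
        exists z j, b z != 0 /\ u j z != 0 &
        forall i z, (i < p)%N -> \sum_j M i j z * u j z = 0].
Proof.
elim: p M A b => [|p IH] M A b PM Pb bz pA.
  have [j0 j0A] : exists j0, j0 \in A by apply/set0Pn; rewrite -card_gt0.
  exists (fun j => if j == j0 then fun=> 1 else fun=> 0); split.
  - by move=> j; case: ifP => _; exact: poly_in_cst.
  - by move=> j z jA; case: eqP => // jj; rewrite jj j0A in jA.
  - by have [z bz0] := bz; exists z, j0; rewrite eqxx oner_neq0.
  - by [].
(* If row [p] has a pivot where [b] does not vanish, column [l] leaves the unknowns and the pivot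
   joins [b], which makes the solution nonzero at a point where the pivots are. *)
have [[l [z [lA bz0 Mz0]]]|npiv] :=
    pselect (exists l z, [/\ l \in A, b z != 0 & M p l z != 0]).
  pose M' i j z := M p l z * M i j z + - (M i l z * M p j z).
  have PM' i j : P (M' i j).
    apply: poly_in_add; first exact: poly_in_mul.
    by apply: poly_in_opp; exact: poly_in_mul.
  have [||v [Pv vA [z1 [j1 [bz1 vz1]]] Mv]] :=
      IH M' (A :\ l) (fun z => b z * M p l z) PM' (poly_in_mul Pb (PM p l)).
  - by exists z; rewrite mulf_neq0.
  - by move: pA; rewrite (cardsD1 l A) lA.
  have vl z' : v l z' = 0 by apply: vA; rewrite !inE eqxx.
  exists (fun j => if j == l then fun z => - \sum_k M p k z * v k z
               else fun z => M p l z * v j z).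
  have rowE i z' : \sum_j M i j z' * (if j == l then fun z => - \sum_k M p k z * v k z
               else fun z => M p l z * v j z) z' = \sum_j M' i j z' * v j z'.
    have -> : \sum_j M' i j z' * v j z' =
       M p l z' * (\sum_j M i j z' * v j z') - M i l z' * (\sum_k M p k z' * v k z').
      rewrite !mulr_sumr -sumrB; apply: eq_bigr => j _; rewrite /M'; ring.
    rewrite (bigD1 l) //= eqxx (bigD1 l (P := predT) (F := fun j => M i j z' * v j z')) //=.
    rewrite vl mulr0 add0r mulrN addrC; congr (_ - _); rewrite mulr_sumr.
    by apply: eq_bigr => j /negbTE ->; rewrite mulrCA.
  split.
  - move=> j; case: ifP => _; last exact: poly_in_mul.
    by apply: poly_in_opp; apply: poly_in_sum => k; exact: poly_in_mul.
  - move=> j z' jA; case: eqP => [jl|_]; first by rewrite jl lA in jA.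
    by rewrite vA ?mulr0 // !inE negb_and jA orbT.
  - move: bz1; rewrite mulf_eq0 negb_or => /andP[bz1 Mz1].
    exists z1, j1; split=> //; case: ifPn => [/eqP jl|_]; last exact: mulf_neq0.
    by move: vz1; rewrite jl vl eqxx.
  - move=> i z'; rewrite ltnS leq_eqVlt rowE => /orP[/eqP ->|ip]; last exact: Mv.
    by rewrite big1 // => j _; rewrite /M' subrr mul0r.
(* Without a pivot, the entries of row [p] in the columns of [A] vanish wherever [b] does not, so
   [b] times a solution of the other rows solves row [p] too. *)
have [v [Pv vA [z1 [j1 [bz1 vz1]]] Mv]] := IH M A b PM Pb bz (ltnW pA).
exists (fun j z => b z * v j z); split.
- by move=> j; exact: poly_in_mul.
- by move=> j z jA; rewrite vA ?mulr0.
- by exists z1, j1; rewrite mulf_neq0.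
- move=> i z; rewrite ltnS leq_eqVlt => /orP[/eqP ->|ip].
    rewrite big1 // => j _; have [jA|jA] := boolP (j \in A); last by rewrite vA // !mulr0.
    have [b0|b0] := eqVneq (b z) 0; first by rewrite b0 mul0r mulr0.
    have [M0|M0] := eqVneq (M p j z) 0; first by rewrite M0 mul0r.
    by case: npiv; exists j, z.
  rewrite (eq_bigr (fun j => b z * (M i j z * v j z))); last by move=> j _; rewrite mulrCA.
  by rewrite -mulr_sumr Mv // mulr0.
Qed.

End Elimination.

(** * Weights of multi-indices and the count of unknowns *)

Section MultiIndices.
Local Open Scope nat_scope.

Lemma digits_lt n (B : nat) (x : 'I_n -> nat) : (forall i, x i < B) ->
  \sum_(i < n) B ^ i * x i < B ^ n.
Proof.
elim: n x => [|n IH] x xB; first by rewrite big_ord0 expn0.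
have := IH (fun i => x (widen_ord (leqnSn n) i)) (fun i => xB _).
rewrite big_ord_recr /= expnS => h; have := xB ord_max.
move: (x ord_max) (\sum_(i < n) _) h => y s h yB.
have : B ^ n * y.+1 <= B ^ n * B by rewrite leq_mul2l yB orbT.
rewrite mulnS mulnC; lia.
Qed.

Lemma digits_inj n (B : nat) (x y : 'I_n -> nat) : (forall i, x i < B) ->
  (forall i, y i < B) -> \sum_(i < n) B ^ i * x i = \sum_(i < n) B ^ i * y i -> x =1 y.
Proof.
elim: n x y => [|n IH] x y xB yB; first by move=> _ [].
have B0 : 0 < B by apply: leq_ltn_trans (xB ord0).
rewrite !big_ord_recl !expn0 !mul1n.
have E (z : 'I_n.+1 -> nat) : \sum_(i < n) B ^ lift ord0 i * z (lift ord0 i) =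
    B * \sum_(i < n) B ^ i * z (lift ord0 i).
  by rewrite big_distrr /=; apply: eq_bigr => i _; rewrite /bump /= add1n expnS mulnA.
rewrite !E => h.
have e0 : x ord0 = y ord0.
  have := congr1 (modn^~ B) h; rewrite /= ![_ + B * _]addnC ![B * _]mulnC !modnMDl.
  by rewrite !modn_small.
move: h; rewrite e0 => /addnI /eqP; rewrite eqn_pmul2l // => /eqP h i.
have [j ->|->//] := unliftP ord0 i.
exact: (IH (fun i => x (lift ord0 i)) (fun i => y (lift ord0 i)) (fun i => xB _)
  (fun i => yB _) h).
Qed.

(** A graded monomial order encoded by an integer: the total degree times [B ^ n], plus the number
    with base [B] digits [I i]. It is additive, and injective on exponents below [B]. *)
Definition wt n (B : nat) (I : {ffun 'I_n -> nat}) := \sum_(i < n) (B ^ n + B ^ i) * I i.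

Lemma wtE n B (I : {ffun 'I_n -> nat}) :
  wt B I = B ^ n * \sum_(i < n) I i + \sum_(i < n) B ^ i * I i.
Proof. by rewrite /wt big_distrr -big_split /=; apply: eq_bigr => i _; rewrite mulnDl. Qed.

Lemma wt_inj n B (I J : {ffun 'I_n -> nat}) : (forall i, I i < B) -> (forall i, J i < B) ->
  wt B I = wt B J -> I = J.
Proof.
move=> IB JB; rewrite !wtE => h; apply/ffunP; apply: (digits_inj IB JB).
have := congr1 (modn^~ (B ^ n)) h; rewrite /= ![B ^ n * _]mulnC !modnMDl.
by rewrite !modn_small ?digits_lt.
Qed.

Lemma wtD n B (I J K : {ffun 'I_n -> nat}) : (forall i, K i = I i + J i) ->
  wt B K = wt B I + wt B J.
Proof.
by move=> KE; rewrite /wt -big_split /=; apply: eq_bigr => i _; rewrite KE mulnDr.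
Qed.

Lemma wt_deg n B (I J : {ffun 'I_n -> nat}) : \sum_i J i < B -> wt B I <= wt B J ->
  \sum_i I i <= \sum_i J i.
Proof.
move=> JB; rewrite !wtE => h.
have JB' i : J i < B by apply: leq_ltn_trans JB; rewrite (bigD1 i) //= leq_addr.
have := digits_lt JB'; have B0 : 0 < B ^ n by rewrite expn_gt0 (leq_ltn_trans _ JB).
move=> h2; rewrite -ltnS -(ltn_pmul2l B0) mulnS.
by apply: leq_ltn_trans (leq_trans (leq_addr _ _) h) _; rewrite addnC ltn_add2r.
Qed.

Lemma expn_sub_le X e n : X ^ n <= (X - e) ^ n + n * e * X ^ n.-1.
Proof.
elim: n => [|n IH]; first by rewrite !expn0.
have IH' : X * X ^ n <= X * (X - e) ^ n + n * e * X ^ n.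
  case: n IH => [|n] IH; first by rewrite !expn0; lia.
  apply: leq_trans (leq_mul (leqnn X) IH) _; rewrite mulnDr leq_add2l /=.
  by rewrite mulnCA -expnS.
have le1 : (X - e) ^ n <= X ^ n by case: (n) => // k; rewrite leq_exp2r // leq_subr.
have X1 : X * (X - e) ^ n <= (X - e) * (X - e) ^ n + e * (X - e) ^ n.
  by rewrite -mulnDl leq_mul2r; apply/orP; right; lia.
have X2 : e * (X - e) ^ n <= e * X ^ n by rewrite leq_mul2l le1 orbT.
rewrite !expnS /= mulSn mulnDl; apply: leq_trans IH' _.
by rewrite addnA leq_add2r; apply: leq_trans X1 _; rewrite leq_add2l.
Qed.

(** With [X = q * Y], the loss [n * e * X ^ n.-1] is below [Y ^ n] as soon as
    [Y > n * e * q ^ n.-1]. *)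
Lemma box_count n e q : 0 < n -> 0 < q -> exists2 Y, 0 < Y &
  (q * Y) ^ n < (q * Y - e) ^ n + Y ^ n.
Proof.
move=> n0 q0; pose Y := (n * e * q ^ n.-1).+1; exists Y => //.
apply: leq_ltn_trans (expn_sub_le _ e _) _; rewrite ltn_add2l expnMn mulnA.
have -> : Y ^ n = Y * Y ^ n.-1 by rewrite -expnS prednK.
by rewrite ltn_pmul2r // expn_gt0.
Qed.

Lemma card_box n X K : K <= X ->
  #|[set L : {ffun 'I_n -> 'I_X} | [forall i, L i < K]]%SET| = K ^ n.
Proof.
move=> KX; transitivity (#|[pred j : 'I_X | j < K]| ^ #|'I_n|).
  rewrite -(card_ffun_on 'I_n [pred j : 'I_X | j < K]).
  apply: eq_card => L; rewrite [LHS]inE.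
  apply/idP/idP => [/forallP h|/ffun_onP h]; first by apply/ffun_onP => i; exact: h.
  by apply/forallP => i; exact: h.
by rewrite card_ord -sum1_card (big_ord_narrow KX) sum1_card card_ord.
Qed.

End MultiIndices.

Section AuxiliaryPolynomial.
Variables (R : realType) (m n : nat).
Local Notation V := 'rV[R[i]]_m.
Variable a : {ffun 'I_n -> nat} -> V -> R[i].

Definition msub (J L : {ffun 'I_n -> nat}) : {ffun 'I_n -> nat} := [ffun i => (J i - L i)%N].

(* coefficient of index [J] in the product of the polynomial of coefficients [u] and of the
   power series of coefficients [a] *)
Definition convol X (u : {ffun 'I_n -> 'I_X} -> V -> R[i]) (J : {ffun 'I_n -> nat})
    (z : V) : R[i] :=
  \sum_(L : {ffun 'I_n -> 'I_X})
    (if [forall i, (L i <= J i)%N] then a (msub J (multi_of L)) z else 0) * u L z.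

Lemma poly_in_convol X (u : {ffun 'I_n -> 'I_X} -> V -> R[i]) J :
  (forall L, poly_in a (u L)) -> poly_in a (convol u J).
Proof.
move=> Pu; apply: poly_in_sum => L; apply: poly_in_mul => //.
by case: [forall i, _]; [exact: poly_in_coef|exact: poly_in_cst].
Qed.

(* The coefficient of [I0 + L0] in the product, [I0] and [L0] being of minimal weight in the
   supports, consists of a single term. *)
Lemma aux_poly q : (0 < n)%N -> (0 < q)%N -> (exists I z, a I z != 0) ->
  exists Y (u : {ffun 'I_n -> 'I_(q * Y)} -> V -> R[i]),
  [/\ (0 < Y)%N, forall L, poly_in a (u L),
      forall (J : {ffun 'I_n -> nat}) z, (forall i, (J i < q * Y)%N) ->
        (exists i, (Y <= J i)%N) -> convol u J z = 0
    & exists (J : {ffun 'I_n -> nat}) z, (forall i, (J i < Y)%N) /\ convol u J z != 0].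
Proof.
move=> n0 q0 [I1 [z1 aI1]]; pose e := (\sum_i I1 i)%N.
have [Y Y0 cnt] := box_count e n0 q0.
set X := (q * Y)%N in cnt *.
have YX : (Y <= X)%N by rewrite leq_pmull.
(* [B] exceeds the exponents in the large box, for the injectivity of [wt B], and the degree [e] of
   [I1], so that [I0], of minimal weight, has degree at most [e]. *)
pose B := (maxn X e).+1.
have [I0 [z0 aI0] I0min] : exists2 I0, exists z, a I0 z != 0 &
    forall I, (exists z, a I z != 0) -> (wt B I0 <= wt B I)%N.
  pose W := fun k => `[< exists2 I, exists z, a I z != 0 & wt B I = k >].
  have exW : exists k, W k by exists (wt B I1); apply/asboolP; exists I1 => //; exists z1.
  case: (ex_minnP exW) => k /asboolP [I0 aI0 wI0] kmin.
  exists I0 => // I aI; rewrite wI0; apply: kmin; apply/asboolP; by exists I.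
have I0e : (\sum_i I0 i <= e)%N.
  apply: (@wt_deg n B); first by rewrite ltnS leq_maxr.
  by apply: I0min; exists z1.
have I0e' i : (I0 i <= e)%N by apply: leq_trans I0e; rewrite (bigD1 i) //= leq_addr.
pose Bad := [set J : {ffun 'I_n -> 'I_X} | ~~ [forall i, (J i < Y)%N]]%SET.
(* The unknowns stay [e] below the edge of the large box, so that adding [I0] does not leave it. *)
pose A := [set L : {ffun 'I_n -> 'I_X} | [forall i, (L i < X - e)%N]]%SET.
have cBad : (#|Bad| < #|A|)%N.
  rewrite /A card_box ?leq_subr //.
  have := cardsC [set J : {ffun 'I_n -> 'I_X} | [forall i, (J i < Y)%N]]%SET.
  rewrite card_box // card_ffun !card_ord.
  have -> : (~: [set J : {ffun 'I_n -> 'I_X} | [forall i, (J i < Y)%N]])%SET = Bad.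
    by apply/setP => J; rewrite !inE.
  by move: cnt; lia.
have X0 : (0 < X)%N by exact: leq_trans YX.
pose J0 : {ffun 'I_n -> 'I_X} := [ffun=> Ordinal X0].
pose M i (L : {ffun 'I_n -> 'I_X}) (z : V) :=
  let J := multi_of (nth J0 (enum Bad) i) in
  if [forall i, (L i <= J i)%N] then a (msub J (multi_of L)) z else 0.
have PM i L : poly_in a (M i L).
  by rewrite /M; case: [forall i, _]; [exact: poly_in_coef|exact: poly_in_cst].
(* Taking [a I0] for [b] yields one point [z2] where both [a I0] and some [u L2] are nonzero, as the
   product of the lowest terms requires. *)
have [u [Pu uA [z2 [L2 [aI2 uL2]]] Mu]] :=
  poly_in_kernel PM (poly_in_coef a I0) (ex_intro _ z0 aI0) cBad.
have bad (J : {ffun 'I_n -> 'I_X}) z : J \in Bad -> convol u (multi_of J) z = 0.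
  move=> JB; have jlt : (index J (enum Bad) < #|Bad|)%N by rewrite cardE index_mem mem_enum.
  rewrite -[RHS](Mu _ z jlt); apply: eq_bigr => L _; rewrite /M.
  by rewrite nth_index // mem_enum.
have badn (J : {ffun 'I_n -> nat}) z : (forall i, (J i < X)%N) -> (exists i, (Y <= J i)%N) ->
    convol u J z = 0.
  move=> JX [i Yi].
  have -> : J = multi_of [ffun i => Ordinal (JX i)] by apply/ffunP => k; rewrite !ffunE.
  apply: bad; rewrite inE; apply/forallPn; exists i.
  by rewrite ffunE /= -leqNgt.
exists Y, u; split=> //.
have [L0 uL0 L0min] : exists2 L0, u L0 z2 != 0 &
    forall L, u L z2 != 0 -> (wt B (multi_of L0) <= wt B (multi_of L))%N.
  have := @arg_minnP _ L2 (fun L => u L z2 != 0) (fun L => wt B (multi_of L)) uL2.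
  by case=> L0 h1 h2; exists L0.
pose J : {ffun 'I_n -> nat} := [ffun i => (I0 i + L0 i)%N].
have L0A : L0 \in A by apply: contraNT uL0 => /uA ->.
have JX i : (J i < X)%N.
  move: L0A; rewrite inE => /forallP /(_ i); rewrite ltn_subRL => h.
  by apply: leq_ltn_trans h; rewrite ffunE leq_add2r.
have cJ : convol u J z2 = a I0 z2 * u L0 z2.
  rewrite /convol (bigD1 L0) //= big1 ?addr0.
    rewrite ifT; last by apply/forallP => i; rewrite ffunE leq_addl.
    by congr (a _ z2 * _); apply/ffunP => i; rewrite !ffunE addnK.
  move=> L LL0; case: forallP => [LJ|_]; last by rewrite mul0r.
  have [->|uL] := eqVneq (u L z2) 0; first by rewrite mulr0.
  have [->|aL] := eqVneq (a (msub J (multi_of L)) z2) 0; first by rewrite mul0r.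
  have w1 := L0min L uL; have w2 : (wt B I0 <= wt B (msub J (multi_of L)))%N.
    by apply: I0min; exists z2.
  have e1 : wt B J = (wt B I0 + wt B (multi_of L0))%N.
    by apply: wtD => i; rewrite !ffunE.
  have e2 : wt B J = (wt B (msub J (multi_of L)) + wt B (multi_of L))%N.
    by apply: wtD => i; have := LJ i; rewrite !ffunE => h; rewrite subnK.
  have ltB (L' : {ffun 'I_n -> 'I_X}) i : (multi_of L' i < B)%N.
    rewrite ffunE ltnS; apply: leq_trans (leq_maxl _ _); exact: ltnW.
  have : multi_of L = multi_of L0 by apply: (@wt_inj n B) => //; lia.
  move=> /ffunP EL; case/eqP: LL0; apply/ffunP => i; apply: val_inj.
  by have := EL i; rewrite !ffunE.
have cJ0 : convol u J z2 != 0 by rewrite cJ mulf_neq0.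
(* [J] lies in the large box and its coefficient survives, so it is not among the cancelled
   indices. *)
exists J, z2; split=> // i; rewrite ltnNge; apply/negP => Yi.
by move: cJ0; rewrite badn ?eqxx //; exists i.
Qed.

End AuxiliaryPolynomial.

(** * Smallness of the auxiliary polynomial at a zero of the series *)

Section AuxiliaryBound.
Variables (R : realType) (m n : nat).
Local Notation V := 'rV[R[i]]_m.
Variable a : {ffun 'I_n -> nat} -> V -> R[i].

Lemma multi_sum_single (A : nmodType) (K : {ffun 'I_n -> nat}) (M : nat) (x : A) :
  (\sum_i K i < M)%N ->
  \sum_(d < M) \sum_(I : {ffun 'I_n -> 'I_d.+1} | (\sum_(i < n) (I i : nat))%N == d)
    (if multi_of I == K then x else 0) = x.
Proof.
move=> KM; pose d0 := Ordinal KM; rewrite (bigD1 d0) //= [X in _ + X]big1 ?addr0; last first.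
  move=> d dd0; rewrite big1 // => I /eqP Id; case: eqP => // IK.
  case/eqP: dd0; apply: val_inj; rewrite /= -Id -IK.
  by apply: eq_bigr => i _; rewrite ffunE.
have Kd i : (K i < (\sum_i K i).+1)%N by rewrite ltnS (bigD1 i) //= leq_addr.
pose I0 : {ffun 'I_n -> 'I_(\sum_i K i).+1} := [ffun i => Ordinal (Kd i)].
rewrite (bigD1 I0) /=; last by apply/eqP; apply: eq_bigr => i _; rewrite ffunE.
rewrite ifT; last by apply/eqP/ffunP => i; rewrite !ffunE.
rewrite big1 ?addr0 // => I /andP[_ II0]; case: eqP => // IK; case/eqP: II0.
apply/ffunP => i; apply: val_inj; rewrite ffunE /=.
by move/ffunP/(_ i): IK; rewrite ffunE.
Qed.

Lemma monom_cabs (w : 'I_n -> R[i]) (I : {ffun 'I_n -> nat}) :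
  cabs (monom w I) = \prod_(i < n) cabs (w i) ^+ I i.
Proof. by rewrite /monom cabs_prod; apply: eq_bigr => i _; rewrite cabsX. Qed.

Lemma monomD (w : 'I_n -> R[i]) (I J K : {ffun 'I_n -> nat}) :
  (forall i, K i = (I i + J i)%N) -> monom w K = monom w I * monom w J.
Proof.
by move=> KE; rewrite /monom -big_split /=; apply: eq_bigr => i _; rewrite KE exprD.
Qed.

Lemma monom_small (w : 'I_n -> R[i]) (K : {ffun 'I_n -> nat}) (rho : R) (X : nat) :
  (forall i, cabs (w i) <= 1) -> (forall i, cabs (w i) <= rho) ->
  (exists i, (X <= K i)%N) -> cabs (monom w K) <= rho ^+ X.
Proof.
move=> w1 wr [i Xi]; rewrite monom_cabs (bigD1 i) //= -[leRHS]mulr1.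
apply: ler_pM.
- by rewrite exprn_ge0 ?cabs_ge0.
- by apply: prodr_ge0 => j _; rewrite exprn_ge0 ?cabs_ge0.
- apply: (@le_trans _ _ (cabs (w i) ^+ X)).
    by apply: ler_wiXn2l => //; exact: cabs_ge0.
  by rewrite lerXn2r ?nnegrE ?cabs_ge0 // (le_trans (cabs_ge0 (w i))).
- by apply: prodr_ile1 => j _; rewrite exprn_ge0 ?cabs_ge0 //= exprn_ile1 ?cabs_ge0.
Qed.

Definition aux_val X (u : {ffun 'I_n -> 'I_X} -> V -> R[i]) (z : V) (w : 'I_n -> R[i]) :=
  \sum_(J : {ffun 'I_n -> 'I_X}) convol a u (multi_of J) z * monom w (multi_of J).

Lemma aux_val_split X (u : {ffun 'I_n -> 'I_X} -> V -> R[i]) z w M : (n * X < M)%N ->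
  aux_val u z w = \sum_L \sum_(d < M)
    \sum_(I : {ffun 'I_n -> 'I_d.+1} | (\sum_(i < n) (I i : nat))%N == d)
      (if [forall i, (multi_of I i + multi_of L i < X)%N] then
         u L z * (a (multi_of I) z * (monom w (multi_of I) * monom w (multi_of L))) else 0).
Proof.
move=> XM; rewrite /aux_val.
under eq_bigr => J _ do rewrite /convol mulr_suml.
rewrite exchange_big /=; apply: eq_bigr => L _.
pose G (I : {ffun 'I_n -> nat}) :=
  u L z * (a I z * (monom w I * monom w (multi_of L))).
have E d (I : {ffun 'I_n -> 'I_d.+1}) :
  (if [forall i, (multi_of I i + multi_of L i < X)%N] then G (multi_of I) else 0) =
  \sum_(J : {ffun 'I_n -> 'I_X})
    (if multi_of J == [ffun i => (multi_of I i + multi_of L i)%N] then G (multi_of I) else 0).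
  case: forallP => [h|h].
    pose J0 : {ffun 'I_n -> 'I_X} := [ffun i => Ordinal (h i)].
    rewrite (bigD1 J0) //= ifT; last first.
      by apply/eqP/ffunP => i; rewrite [LHS]ffunE [RHS]ffunE [J0 i]ffunE.
    rewrite big1 ?addr0 // => J JJ0; case: eqP => // JE; case/eqP: JJ0.
    by apply/ffunP => i; apply: val_inj; rewrite ffunE /=; move/ffunP/(_ i): JE; rewrite !ffunE.
  rewrite big1 // => J _; case: eqP => // JE; case: h => i.
  by move/ffunP/(_ i): JE; rewrite ffunE [in RHS]ffunE => <-.
under [RHS]eq_bigr => d _ do under eq_bigr => I _ do rewrite -/(G (multi_of I)) E.
under [RHS]eq_bigr => d _ do rewrite exchange_big /=.
rewrite [RHS]exchange_big /=; apply: eq_bigr => J _.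
case: forallP => [LJ|LJ]; last first.
  rewrite !mul0r big1 // => d _; rewrite big1 // => I _; case: eqP => // JE.
  by case: LJ => i; move/ffunP/(_ i): JE; rewrite !ffunE => ->; rewrite leq_addl.
pose K := msub (multi_of J) (multi_of L).
have KL i : multi_of J i = (K i + multi_of L i)%N.
  by have := LJ i; rewrite !ffunE => h; rewrite subnK.
have KM : (\sum_i K i < M)%N.
  apply: leq_ltn_trans XM; apply: (@leq_trans (\sum_(i < n) X)).
    apply: leq_sum => i _; apply: (@leq_trans (multi_of J i)); first by rewrite KL leq_addr.
    by rewrite ffunE ltnW.
  by rewrite sum_nat_const card_ord.
rewrite -[LHS](multi_sum_single _ KM); apply: eq_bigr => d _; apply: eq_bigr => I _.
have -> : (multi_of J == [ffun i => (multi_of I i + multi_of L i)%N]) = (multi_of I == K).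
  apply/eqP/eqP => [/ffunP JE|IK].
    apply/ffunP => i; have := JE i; rewrite [RHS]ffunE KL => /eqP.
    by rewrite eqn_add2r => /eqP.
  by apply/ffunP => i; rewrite [RHS]ffunE IK KL.
case: eqP => // ->; rewrite -/K (monomD w KL) /G; ring.
Qed.

(** [U] times a partial sum tends to 0 and equals [aux_val] plus terms with some exponent at least
    [X]. Such a term has a monomial of modulus at most [rho ^+ X], the remaining powers being of
    modulus at most 1. Since only partial sums occur, convergence by homogeneous parts suffices. *)
Lemma aux_val_bound X (u : {ffun 'I_n -> 'I_X} -> V -> R[i]) z w (s rho : R) :
  (fun N : nat => (\sum_(d < N) hpart a z w d : R[i]^o)) @ \oo --> (0 : R[i]^o) ->
  (abs_coef_sum a z <= s%:E)%E ->
  (forall i, cabs (w i) <= 1) -> (forall i, cabs (w i) <= rho) -> 0 <= rho ->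
  cabs (aux_val u z w) <= (\sum_L cabs (u L z)) * s * rho ^+ X.
Proof.
move=> ser sa w1 wr rho0; apply/ler_addgt0Pr => e e0.
pose U := \sum_L u L z * monom w (multi_of L).
have U1 : 0 < cabs U + 1 by rewrite ltr_wpDl // cabs_ge0.
have e1 : (0 : R[i]) < (e / (cabs U + 1))%:C%C by rewrite (ltcR 0) divr_gt0.
move/cvgrPdist_lt/(_ _ e1): ser => [M0 _ HM].
pose M := (maxn M0 (n * X)).+1.
have XM : (n * X < M)%N by rewrite ltnS leq_maxr.
have := HM M; rewrite /= => /(_ (leqW (leq_maxl _ _))).
rewrite sub0r normrN cabsE ltcR; set S := \sum_(d < M) _ => SM.
have US : U * S = \sum_L \sum_(d < M)
    \sum_(I : {ffun 'I_n -> 'I_d.+1} | (\sum_(i < n) (I i : nat))%N == d)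
         u L z * (a (multi_of I) z * (monom w (multi_of I) * monom w (multi_of L))).
  rewrite /U mulr_suml; apply: eq_bigr => L _; rewrite /S mulr_sumr.
  apply: eq_bigr => d _; rewrite /hpart mulr_sumr; apply: eq_bigr => I _; ring.
have -> : aux_val u z w = U * S - \sum_L \sum_(d < M)
    \sum_(I : {ffun 'I_n -> 'I_d.+1} | (\sum_(i < n) (I i : nat))%N == d)
      (if [forall i, (multi_of I i + multi_of L i < X)%N] then 0 else
         u L z * (a (multi_of I) z * (monom w (multi_of I) * monom w (multi_of L)))).
  rewrite (aux_val_split _ _ _ XM) US -sumrB; apply: eq_bigr => L _.
  rewrite -sumrB; apply: eq_bigr => d _; rewrite -sumrB; apply: eq_bigr => I _.
  by case: [forall i, _]; rewrite ?subr0 ?subrr.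
apply: le_trans (cabsB _ _) _; rewrite addrC; apply: lerD; last first.
  rewrite cabsM; apply: (@le_trans _ _ (cabs U * (e / (cabs U + 1)))).
    by rewrite ler_wpM2l ?cabs_ge0 // ltW.
  by rewrite mulrCA ler_piMr ?(ltW e0) // ler_pdivrMr // mul1r lerDl.
have sM : \sum_(d < M) \sum_(I : {ffun 'I_n -> 'I_d.+1} | (\sum_(i < n) (I i : nat))%N == d)
    cabs (a (multi_of I) z) <= s.
  rewrite -lee_fin; apply: le_trans sa; rewrite /abs_coef_sum -sumEFin.
  rewrite -(big_mkord xpredT (fun d => (\sum_(I : {ffun 'I_n -> 'I_d.+1} |
    (\sum_(i < n) (I i : nat))%N == d) cabs (a (multi_of I) z))%:E)).
  apply: nneseries_lim_ge => d *.
  by rewrite lee_fin; apply: sumr_ge0 => I _; exact: cabs_ge0.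
apply: le_trans (cabs_sum _ _ _) _; rewrite -mulrA mulr_suml; apply: ler_sum => L _.
apply: le_trans (cabs_sum _ _ _) _.
apply: (@le_trans _ _ (cabs (u L z) * ((\sum_(d < M) \sum_(I : {ffun 'I_n -> 'I_d.+1} |
   (\sum_(i < n) (I i : nat))%N == d) cabs (a (multi_of I) z)) * rho ^+ X))); last first.
  by rewrite ler_wpM2l ?cabs_ge0 // ler_wpM2r // exprn_ge0.
rewrite mulr_suml mulr_sumr; apply: ler_sum => d _.
apply: le_trans (cabs_sum _ _ _) _.
rewrite mulr_suml mulr_sumr; apply: ler_sum => I _.
case: forallP => h; first by rewrite cabs0 !mulr_ge0 ?cabs_ge0 ?exprn_ge0.
rewrite !cabsM ler_wpM2l ?cabs_ge0 // ler_wpM2l ?cabs_ge0 // -cabsM.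
rewrite -(@monomD w _ _ [ffun i => (multi_of I i + multi_of L i)%N]); last first.
  by move=> i; rewrite ffunE.
apply: monom_small => //; apply: contrapT => N; apply: h => i; rewrite ltnNge.
by apply/negP => h; apply: N; exists i; rewrite ffunE.
Qed.

End AuxiliaryBound.

(** * The Nevanlinna-theoretic estimates *)

Section SphereIntegrals.
Variables (R : realType) (m : nat).
Hypothesis m_gt0 : (0 < m)%N.
Local Notation V := 'rV[R[i]]_m.
Local Notation vol := (gint (ind (@pball R m))).
Implicit Types (phi psi : V -> \bar R).

Definition esph (r : R) phi : \bar R :=
  gint (fun x => if pball x then phi (onsphere r x) else 0%E).

Lemma vmeas_esph r phi : vmeas phi ->
  vmeas (fun x => if pball x then phi (onsphere r x) else 0%E).
Proof.
move=> mp; apply: vmeas_if; [exact: bmeas_pball| |exact: vmeas_cst].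
exact: (vmeas_normalize (vmeas_scale r%:C%C mp)).
Qed.

Lemma esph_ge0 r phi : (forall x, 0 <= phi x)%E -> (0 <= esph r phi)%E.
Proof. by move=> p0; apply: gint_ge0 => x; case: ifP. Qed.

Lemma le_esph r phi psi : vmeas phi -> vmeas psi -> (forall x, 0 <= phi x)%E ->
  (forall x, 0 <= psi x)%E -> (forall x, phi (onsphere r x) <= psi (onsphere r x))%E ->
  (esph r phi <= esph r psi)%E.
Proof.
move=> mp mq p0 q0 le; apply: le_gint; try exact: vmeas_esph;
  by move=> x; case: ifP.
Qed.

Lemma esphD r phi psi : vmeas phi -> vmeas psi -> (forall x, 0 <= phi x)%E ->
  (forall x, 0 <= psi x)%E -> (esph r (fun x => phi x + psi x) = esph r phi + esph r psi)%E.
Proof.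
move=> mp mq p0 q0; rewrite -gintD; try exact: vmeas_esph; try by move=> x; case: ifP.
by apply: eq_gint => x; case: ifP; rewrite ?adde0.
Qed.

Lemma esphZ r phi (c : R) : vmeas phi -> (forall x, 0 <= phi x)%E -> 0 <= c ->
  (esph r (fun x => c%:E * phi x) = c%:E * esph r phi)%E.
Proof.
move=> mp p0 c0; rewrite -gintZl ?lee_fin //; try exact: vmeas_esph;
  try by move=> x; case: ifP.
by apply: eq_gint => x; case: ifP; rewrite ?mule0.
Qed.

Lemma esph_cst r (c : R) : 0 <= c -> (esph r (fun=> c%:E) = c%:E * vol)%E.
Proof. by move=> c0; rewrite -pint_cst. Qed.

Lemma esph_sum r (I : Type) (s : seq I) (phi : I -> V -> \bar R) :
  (forall i, vmeas (phi i)) -> (forall i x, 0 <= phi i x)%E ->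
  (esph r (fun x => \sum_(i <- s) phi i x) = \sum_(i <- s) esph r (phi i))%E.
Proof.
move=> mp p0; rewrite -gint_sum; last 2 first.
- by move=> i; exact: vmeas_esph.
- by move=> i x; case: ifP.
by apply: eq_gint => x; case: ifP => // _; rewrite big1.
Qed.

Lemma esph_trunc r phi (Q : \bar R) : vmeas phi -> (forall x, 0 <= phi x)%E ->
  (forall k : nat, esph r (fun x => Order.min (phi x) k%:R%:E) <= Q)%E ->
  (esph r phi <= Q)%E.
Proof.
move=> mp p0 H; apply: gint_trunc; first exact: vmeas_esph.
  by move=> x; case: ifP.
move=> k; apply: le_trans (H k); apply: le_gint.
- move=> d T p mpp; apply: measurable_mine; last exact: measurable_cst.
  exact: (vmeas_esph r mp mpp).
- apply: (vmeas_esph r (phi := fun x => Order.min (phi x) k%:R%:E)) => d T p mpp.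
  by apply: measurable_mine; [exact: mp|exact: measurable_cst].
- by move=> x; rewrite le_min lee_fin ler0n andbT; case: ifP.
- by move=> x; case: ifP => // _; rewrite le_min lee_fin ler0n andbT.
- by move=> x; case: ifP => // _; rewrite ge_min lexx.
Qed.

Lemma mprox_eE r phi : mprox_e r phi =
  (esph r (fun x => elogplus (phi x)) / gint (ind (@cball R m)))%E.
Proof. by []. Qed.

Lemma elogplus_ge0 (x : \bar R) : (0 <= elogplus x)%E.
Proof. by case: x => [x| |] //=; rewrite lee_fin logplus_ge0. Qed.

Lemma measurable_elogplus : measurable_fun setT (@elogplus R).
Proof.
have -> : @elogplus R = fun x => if x == +oo%E then +oo%E else
    if x == -oo%E then 0%E else (logplus (fine x))%:E.
  by apply/funext => -[x| |].
have meq (y : \bar R) : measurable_fun setT (fun x : \bar R => x == y).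
  apply: (measurable_fun_bool true).
  rewrite (_ : _ `&` _ = [set y]); first exact: emeasurable_set1.
  by apply/seteqP; split => [x [_ /eqP]|x ->] //=; split=> //; rewrite eqxx.
apply: measurable_fun_ifT; [exact: meq|exact: measurable_cst|].
apply: measurable_fun_ifT; [exact: meq|exact: measurable_cst|].
apply/measurable_EFinP.
have ml : measurable_fun [set: R] (@logplus R).
  apply: nondecreasing_measurable => // x y xy; rewrite !logplusE.
  rewrite ler_ln ?posrE ?lt_max ?ltr01 //.
  by rewrite ge_max !le_max lexx xy orbT.
apply: (measurableT_comp ml); exact: fine_measurable.
Qed.

Lemma vmeas_elogplus phi : vmeas phi -> vmeas (fun x => elogplus (phi x)).
Proof. by move=> mp d T p mpp; apply: (measurableT_comp measurable_elogplus); exact: mp. Qed.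

Lemma vcont_cabs (f : V -> R[i]) : entire f -> vcont (fun z => cabs (f z)).
Proof.
move=> ef z e e0; have [d d0 dP] := entire_eps ef z e0.
exists d => // w /dP; apply: le_lt_trans.
by rewrite ler_norml cabs_ge lerNl opprB cabs_distC cabs_ge.
Qed.

Lemma vmeas_abs_coef_sum n (a : {ffun 'I_n -> nat} -> V -> R[i]) :
  (forall I, entire (a I)) -> vmeas (abs_coef_sum a).
Proof.
move=> ea d T p mp; apply: ge0_emeasurable_sum.
  by move=> k x _ _; rewrite lee_fin; apply: sumr_ge0 => I _; exact: cabs_ge0.
move=> k _.
have mk : rmeas (fun z => \sum_(I : {ffun 'I_n -> 'I_k.+1} |
    (\sum_(i < n) (I i : nat))%N == k) cabs (a (multi_of I) z)).
  by apply: rmeas_sum => I; apply: rmeas_vcont; exact: vcont_cabs.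
exact: (vmeas_EFin mk mp).
Qed.

Lemma abs_coef_sum_ge0 n (a : {ffun 'I_n -> nat} -> V -> R[i]) z : (0 <= abs_coef_sum a z)%E.
Proof.
apply: nneseries_ge0 => k _ _; rewrite lee_fin.
by apply: sumr_ge0 => I _; exact: cabs_ge0.
Qed.

Lemma entireD (f g : V -> R[i]) : entire f -> entire g -> entire (fun z => f z + g z).
Proof. by move=> ef eg z; exact: (differentiableD (ef z) (eg z)). Qed.

Lemma entire_sum (I : Type) (s : seq I) (Q : pred I) (f : I -> V -> R[i]) :
  (forall i, entire (f i)) -> entire (fun z => \sum_(i <- s | Q i) f i z).
Proof.
move=> ef; elim: s => [|i s IH].
  have -> : (fun z => \sum_(i <- [::] | Q i) f i z) = fun=> 0.
    by apply/funext => z; rewrite big_nil.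
  exact: entire_cst.
case Qi : (Q i); last first.
  have -> : (fun z => \sum_(i <- i :: s | Q i) f i z) = fun z => \sum_(i <- s | Q i) f i z.
    by apply/funext => z; rewrite big_cons Qi.
  exact: IH.
have -> : (fun z => \sum_(i <- i :: s | Q i) f i z) =
    fun z => f i z + \sum_(i <- s | Q i) f i z.
  by apply/funext => z; rewrite big_cons Qi.
exact: entireD.
Qed.

Lemma entireX (f : V -> R[i]) k : entire f -> entire (fun z => f z ^+ k).
Proof.
move=> ef; elim: k => [|k IH]; first exact: entire_cst.
have -> : (fun z => f z ^+ k.+1) = fun z => f z * f z ^+ k.
  by apply/funext => z; rewrite exprS.
exact: entireM.
Qed.

Lemma entire_prod (I : Type) (s : seq I) (f : I -> V -> R[i]) :
  (forall i, entire (f i)) -> entire (fun z => \prod_(i <- s) f i z).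
Proof.
move=> ef; elim: s => [|i s IH].
  have -> : (fun z => \prod_(i <- [::]) f i z) = fun=> 1.
    by apply/funext => z; rewrite big_nil.
  exact: entire_cst.
have -> : (fun z => \prod_(i <- i :: s) f i z) = fun z => f i z * \prod_(i <- s) f i z.
  by apply/funext => z; rewrite big_cons.
exact: entireM.
Qed.

Lemma entire_poly_in n (a : {ffun 'I_n -> nat} -> V -> R[i]) g :
  (forall I, entire (a I)) -> poly_in a g -> entire g.
Proof.
move=> ea; elim=> [c|I|g1 g2 _ e1 _ e2|g1 g2 _ e1 _ e2].
- exact: entire_cst.
- exact: ea.
- exact: entireD.
- exact: entireM.
Qed.

Lemma entire_aux_val n (a : {ffun 'I_n -> nat} -> V -> R[i]) X
    (u : {ffun 'I_n -> 'I_X} -> V -> R[i]) (f : 'I_n -> V -> R[i]) :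
  (forall I, entire (a I)) -> (forall L, poly_in a (u L)) -> (forall i, entire (f i)) ->
  entire (fun z => aux_val a u z (fun i => f i z)).
Proof.
move=> ea Pu ef; apply: entire_sum => J; apply: entireM.
  by apply: (entire_poly_in ea); exact: poly_in_convol.
by apply: entire_prod => i; exact: entireX.
Qed.

End SphereIntegrals.

(** * Pointwise inequalities between logarithms *)

Section LogBounds.
Variable R : realType.
Implicit Types x y : R.

Lemma le_logplus x y : x <= y -> logplus x <= logplus y.
Proof.
move=> xy; rewrite !logplusE ler_ln ?posrE ?lt_max ?ltr01 //.
by rewrite ge_max !le_max lexx xy orbT.
Qed.

Lemma ln_le_logplus x : 0 < x -> ln x <= logplus x.
Proof.
move=> x0; rewrite logplusE ler_ln ?posrE ?lt_max ?ltr01 //.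
by rewrite le_max lexx orbT.
Qed.

Lemma logplusM x y : 0 <= x -> 0 <= y -> logplus (x * y) <= logplus x + logplus y.
Proof.
move=> x0 y0; rewrite !logplusE -lnM ?posrE ?lt_max ?ltr01 //.
rewrite ler_ln ?posrE ?mulr_gt0 ?lt_max ?ltr01 // ge_max; apply/andP; split.
  by rewrite mulr_ege1 // le_max lexx.
by apply: ler_pM => //; rewrite le_max lexx orbT.
Qed.

Lemma logplusD x y : 0 <= x -> 0 <= y -> logplus (x + y) <= logplus x + logplus y + ln 2.
Proof.
move=> x0 y0; have mx : 1 <= Num.max 1 x by rewrite le_max lexx.
have my : 1 <= Num.max 1 y by rewrite le_max lexx.
have lx : x <= Num.max 1 x by rewrite le_max lexx orbT.
have ly : y <= Num.max 1 y by rewrite le_max lexx orbT.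
have px : 0 < Num.max 1 x by exact: lt_le_trans mx.
have py : 0 < Num.max 1 y by exact: lt_le_trans my.
rewrite !logplusE -!lnM ?posrE ?mulr_gt0 //.
by rewrite ler_ln ?posrE ?mulr_gt0 ?lt_max ?ltr01 // ge_max; apply/andP; split; nra.
Qed.

Lemma logplusX x k : 0 <= x -> logplus (x ^+ k) <= k%:R * logplus x.
Proof.
move=> x0; elim: k => [|k IH].
  by rewrite expr0 mul0r logplusE maxxx ln1.
rewrite exprS; apply: le_trans (logplusM x0 (exprn_ge0 _ x0)) _.
by rewrite -natr1 mulrDl mul1r addrC lerD2r.
Qed.

Lemma ln_prod_max (I : finType) (x : I -> R) :
  ln (\prod_i Num.max 1 (x i)) = \sum_i logplus (x i).
Proof.
rewrite ln_prod; last by move=> i; rewrite lt_max ltr01.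
by apply: eq_bigr => i _; rewrite logplusE.
Qed.

Lemma le_prod_max (I : finType) (x : I -> R) i : x i <= \prod_i Num.max 1 (x i).
Proof.
rewrite (bigD1 i) //= -[leLHS]mulr1; apply: (@le_trans _ _ (Num.max 1 (x i) * 1)).
  by rewrite !mulr1 le_max lexx orbT.
rewrite ler_wpM2l ?le_max ?ler01 //.
elim/big_ind: _ => [//|u v u1 v1|j _]; first exact: mulr_ege1.
by rewrite le_max lexx.
Qed.

Lemma prod_max_ge1 (I : finType) (x : I -> R) : 1 <= \prod_i Num.max 1 (x i).
Proof.
elim/big_ind: _ => [//|u v u1 v1|j _]; first exact: mulr_ege1.
by rewrite le_max lexx.
Qed.

Variables (m n : nat).
Local Notation V := 'rV[R[i]]_m.

Section Coefficients.
Variable a : {ffun 'I_n -> nat} -> V -> R[i].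

(** The mean of [log^+ h] is then a small quantity up to a constant: [s] is the sum of the [|a_I|],
    whose proximity function is small by assumption. *)
Definition logb (h : V -> R) := exists C k : R, [/\ 0 <= C, 0 <= k &
  forall z s, abs_coef_sum a z = s%:E -> logplus (h z) <= C + k * logplus s].

Lemma coef_le I z (s : R) : abs_coef_sum a z = s%:E -> cabs (a I z) <= s.
Proof.
move=> sa; rewrite -lee_fin -sa; pose M := (\sum_i I i).+1.
have E := @multi_sum_single n R I M (cabs (a I z)) (ltnSn _).
rewrite -{}E -sumEFin.
rewrite -(big_mkord xpredT (fun d => (\sum_(J : {ffun 'I_n -> 'I_d.+1} |
    (\sum_(i < n) (J i : nat))%N == d) (if multi_of J == I then cabs (a I z) else 0))%:E)).
apply: (@le_trans _ _ (\sum_(0 <= d < M) (\sum_(J : {ffun 'I_n -> 'I_d.+1} |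
    (\sum_(i < n) (J i : nat))%N == d) cabs (a (multi_of J) z))%:E)%E).
  apply: lee_sum => d _; rewrite lee_fin; apply: ler_sum => J _.
  by case: eqP => [->|_] //; exact: cabs_ge0.
apply: nneseries_lim_ge => d *.
by rewrite lee_fin; apply: sumr_ge0 => J _; exact: cabs_ge0.
Qed.

Lemma logbD h1 h2 : (forall z, 0 <= h1 z) -> (forall z, 0 <= h2 z) -> logb h1 -> logb h2 ->
  logb (fun z => h1 z + h2 z).
Proof.
move=> p1 p2 [C1 [k1 [C10 k10 H1]]] [C2 [k2 [C20 k20 H2]]].
have l2 : 0 <= ln 2 :> R by rewrite ln_ge0 // ler1n.
exists (C1 + C2 + ln 2), (k1 + k2); split; rewrite ?addr_ge0 //.
move=> z s sa; apply: le_trans (logplusD (p1 z) (p2 z)) _.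
by have := H1 z s sa; have := H2 z s sa; rewrite mulrDl; lra.
Qed.

Lemma logbM h1 h2 : (forall z, 0 <= h1 z) -> (forall z, 0 <= h2 z) -> logb h1 -> logb h2 ->
  logb (fun z => h1 z * h2 z).
Proof.
move=> p1 p2 [C1 [k1 [C10 k10 H1]]] [C2 [k2 [C20 k20 H2]]].
exists (C1 + C2), (k1 + k2); split; rewrite ?addr_ge0 //.
move=> z s sa; apply: le_trans (logplusM (p1 z) (p2 z)) _.
by have := H1 z s sa; have := H2 z s sa; rewrite mulrDl; lra.
Qed.

Lemma logb_le h1 h2 : (forall z, h1 z <= h2 z) -> logb h2 -> logb h1.
Proof.
move=> le [C [k [C0 k0 H]]]; exists C, k; split=> // z s sa.
exact: le_trans (le_logplus (le z)) (H z s sa).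
Qed.

Lemma logb_cst (c : R) : logb (fun=> c).
Proof.
exists (logplus c), 0; split; rewrite ?logplus_ge0 // => z s _.
by rewrite mul0r addr0.
Qed.

Lemma logb_poly_in g : poly_in a g -> logb (fun z => cabs (g z)).
Proof.
elim=> [c|I|g1 g2 _ e1 _ e2|g1 g2 _ e1 _ e2].
- exact: logb_cst.
- exists 0, 1; split=> // z s sa; rewrite add0r mul1r.
  by apply: le_logplus; exact: coef_le.
- by apply: logb_le (logbD _ _ e1 e2) => z; [exact: cabsD|exact: cabs_ge0|exact: cabs_ge0].
- by apply: logb_le (logbM _ _ e1 e2) => z; rewrite ?cabsM ?cabs_ge0.
Qed.

Lemma logb_sum (I : Type) (s : seq I) (g : I -> V -> R[i]) :
  (forall i, poly_in a (g i)) -> logb (fun z => \sum_(i <- s) cabs (g i z)).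
Proof.
move=> Pg; elim: s => [|i s IH].
  by apply: logb_le (logb_cst 0) => z; rewrite big_nil.
apply: logb_le (logbD _ _ (logb_poly_in (Pg i)) IH) => z.
- by rewrite big_cons.
- exact: cabs_ge0.
- by apply: sumr_ge0 => j _; exact: cabs_ge0.
Qed.

End Coefficients.

(** Where all [w i] are small the bound on [aux_val] controls [1 / w i0]; where some [w i] is large
    the quotients do. The minimum with [- ln t] matches the cut in [nlog]. *)
Lemma proximity_ineq (a : {ffun 'I_n -> nat} -> V -> R[i]) (i0 : 'I_n) X
    (u : {ffun 'I_n -> 'I_X} -> V -> R[i]) z (w : 'I_n -> R[i]) (s t : R) :
  (fun N : nat => (\sum_(d < N) hpart a z w d : R[i]^o)) @ \oo --> (0 : R[i]^o) ->
  abs_coef_sum a z = s%:E -> 0 < t <= 1 ->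
  Num.min (X%:R * logplus (cabs (w i0)^-1)) (- ln t) <=
  nlog t (cabs (aux_val a u z w)) + logplus (\sum_L cabs (u L z)) + logplus s +
  X%:R * \sum_i logplus (cabs (w i / w i0)).
Proof.
move=> ser sa t01; have /andP[t0 t1] := t01.
set P := cabs (aux_val _ _ _ _); set Su := \sum_L _; set K := \sum_i _.
have n0 := nlog_ge0 P t01; have lu := logplus_ge0 Su; have ls := logplus_ge0 s.
have K0 : 0 <= K by apply: sumr_ge0 => i _; exact: logplus_ge0.
have X0 : 0 <= X%:R :> R by rewrite ler0n.
have XK : 0 <= X%:R * K by rewrite mulr_ge0.
(* The inverse of 0 is 0, so the left-hand side is 0 here. *)
have [w0|w0] := eqVneq (w i0) 0.
  rewrite ge_min; apply/orP; left; rewrite w0 invr0 cabs0 /logplus ltr10 mulr0.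
  by rewrite !addr_ge0.
have c0 : 0 < cabs (w i0) by rewrite cabs_gt0.
(* If [|w i| > 1], then [1 / |w i0|] is at most [|w i / w i0|]. *)
have [[i wi]|nbig] := pselect (exists i, 1 < cabs (w i)).
  rewrite ge_min; apply/orP; left.
  have : logplus (cabs (w i0)^-1) <= K.
    apply: (@le_trans _ _ (logplus (cabs (w i / w i0)))).
      apply: le_logplus; rewrite cabsM cabsV -[leLHS]mul1r ler_wpM2r ?invr_ge0 ?cabs_ge0 //.
      exact: ltW.
    rewrite /K (bigD1 i) //= lerDl; apply: sumr_ge0 => j _; exact: logplus_ge0.
  by move=> /(ler_wpM2l X0); lra.
have w1 i : cabs (w i) <= 1 by rewrite leNgt; apply/negP => wi; apply: nbig; exists i.
pose Kp := \prod_i Num.max 1 (cabs (w i / w i0)).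
have Kp1 : 1 <= Kp by exact: prod_max_ge1.
have Kp0 : 0 < Kp by exact: lt_le_trans Kp1.
(* A common bound for all [|w i|] that differs from [|w i0|] by a factor whose logarithm is the sum
   of the [log^+] of the quotients. *)
pose rho := cabs (w i0) * Kp.
have rho0 : 0 < rho by rewrite mulr_gt0.
have wr i : cabs (w i) <= rho.
  have -> : cabs (w i) = cabs (w i0) * cabs (w i / w i0).
    by rewrite -cabsM mulrC divfK.
  rewrite ler_wpM2l ?cabs_ge0 //; exact: (le_prod_max (fun i => cabs (w i / w i0))).
have s0 : 0 <= s by rewrite -lee_fin -sa abs_coef_sum_ge0.
have Su0 : 0 <= Su by apply: sumr_ge0 => L _; exact: cabs_ge0.
have sa' : (abs_coef_sum a z <= s%:E)%E by rewrite sa.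
have Pb := aux_val_bound u ser sa' w1 wr (ltW rho0); rewrite -/P -/Su in Pb.
(* Below the cut [nlog] reaches its maximum [- ln t]; above it [P > 0] and logarithms can be
   taken. *)
have [Pt|Pt] := leP P t.
  rewrite ge_min; apply/orP; right.
  have -> : - ln t = nlog t P.
    rewrite /nlog; congr (- ln _); apply/esym/max_idPl.
    by rewrite ge_min Pt orbT.
  by rewrite -!addrA lerDl !addr_ge0.
rewrite ge_min; apply/orP; left.
have P0 : 0 < P by exact: lt_trans Pt.
have pX : 0 < rho ^+ X by exact: exprn_gt0.
have : 0 < Su * s * rho ^+ X by exact: lt_le_trans Pb.
rewrite pmulr_lgt0 // => Sus.
have Sup : 0 < Su by rewrite lt_neqAle Su0 andbT; apply: contraTneq Sus => <-; rewrite mul0r ltxx.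
have sp : 0 < s by rewrite pmulr_rgt0 in Sus.
have lnP : ln P <= ln Su + ln s + X%:R * (ln (cabs (w i0)) + K).
  have -> : K = ln Kp by rewrite ln_prod_max.
  rewrite -[ln (cabs _) + _]lnM ?posrE // -/rho mulr_natl -lnXn //.
  by rewrite -!lnM ?posrE ?mulr_gt0 // ler_ln ?posrE ?mulr_gt0.
have nP : - ln P <= nlog t P.
  rewrite lerN2 ler_ln ?posrE // ?lt_max ?t0 // ge_max (ltW Pt) /=.
  by rewrite ge_min lexx orbT.
have l1 := ln_le_logplus Sup; have l2 := ln_le_logplus sp.
rewrite {1}/logplus; case: ifP => wi1; last by rewrite mulr0 !addr_ge0.
rewrite cabsV lnV ?posrE // mulrN.
by move: lnP; rewrite mulrDr; lra.
Qed.

(** Only monomials of the small box survive; their total degree is at most [n * Y], and [Q] is at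
    least 1 and bounds every [|w i|]. *)
Lemma aux_val_logplus (a : {ffun 'I_n -> nat} -> V -> R[i]) (i0 : 'I_n) X Y
    (u : {ffun 'I_n -> 'I_X} -> V -> R[i]) z (w : 'I_n -> R[i]) :
  (forall (J : {ffun 'I_n -> nat}), (forall i, (J i < X)%N) -> (exists i, (Y <= J i)%N) ->
     convol a u J z = 0) -> w i0 != 0 ->
  logplus (cabs (aux_val a u z w)) <=
  logplus (\sum_(J : {ffun 'I_n -> 'I_X}) cabs (convol a u (multi_of J) z)) +
  (n * Y)%:R * (logplus (cabs (w i0)) + \sum_i logplus (cabs (w i / w i0))).
Proof.
move=> bad w0; pose Kp := \prod_i Num.max 1 (cabs (w i / w i0)).
have Kp1 : 1 <= Kp by exact: prod_max_ge1.
pose Q := Num.max 1 (cabs (w i0)) * Kp.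
have mx1 : 1 <= Num.max 1 (cabs (w i0)) by rewrite le_max lexx.
have Q1 : 1 <= Q by exact: mulr_ege1.
have Q0 : 0 <= Q by exact: le_trans Q1.
have wQ i : cabs (w i) <= Q.
  have -> : cabs (w i) = cabs (w i0) * cabs (w i / w i0).
    by rewrite -cabsM mulrC divfK.
  apply: ler_pM; rewrite ?cabs_ge0 ?le_max ?lexx ?orbT //.
  exact: (le_prod_max (fun i => cabs (w i / w i0))).
set Sc := \sum_J _.
have Sc0 : 0 <= Sc by apply: sumr_ge0 => J _; exact: cabs_ge0.
have le1 : cabs (aux_val a u z w) <= Sc * Q ^+ (n * Y).
  apply: le_trans (cabs_sum _ _ _) _; rewrite mulr_suml; apply: ler_sum => J _.
  rewrite cabsM; have [JY|JY] := boolP [forall i, (J i < Y)%N]; last first.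
    rewrite bad ?cabs0 ?mul0r //; first by move=> i; rewrite ffunE.
    by move/forallPn: JY => [j]; rewrite -leqNgt => Yj; exists j; rewrite ffunE.
  rewrite ler_wpM2l ?cabs_ge0 // monom_cabs.
  apply: (@le_trans _ _ (\prod_(i < n) Q ^+ Y)).
    apply: ler_prod => i _; rewrite exprn_ge0 ?cabs_ge0 //=.
    apply: (@le_trans _ _ (Q ^+ multi_of J i)).
      by rewrite lerXn2r ?nnegrE ?cabs_ge0.
    apply: ler_weXn2l => //; rewrite ffunE; apply: ltnW.
    by move/forallP: JY.
  by rewrite prodr_const card_ord -exprM mulnC.
apply: le_trans (le_logplus le1) _; apply: le_trans (logplusM Sc0 (exprn_ge0 _ Q0)) _.
rewrite lerD2l; apply: le_trans (logplusX _ Q0) _; rewrite ler_wpM2l ?ler0n //.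
rewrite -ln_prod_max -/Kp logplusE (max_idPr Q1) /Q lnM ?posrE //; last 2 first.
- exact: lt_le_trans mx1.
- exact: lt_le_trans Kp1.
by rewrite logplusE.
Qed.

End LogBounds.

Section IntegratedInequalities.
Variables (R : realType) (m n : nat).
Hypothesis m_gt0 : (0 < m)%N.
Local Notation V := 'rV[R[i]]_m.
Local Notation vol := (gint (ind (@pball R m))).
Implicit Types (phi al S g : V -> \bar R).

Lemma le_esph_comb r phi al S g (C k c : R) :
  vmeas phi -> vmeas al -> vmeas S -> vmeas g ->
  (forall z, 0 <= phi z)%E -> (forall z, 0 <= al z)%E -> (forall z, 0 <= S z)%E ->
  (forall z, 0 <= g z)%E -> 0 <= C -> 0 <= k -> 0 <= c ->
  (forall z, phi z <= al z + (C%:E + (k%:E * S z + c%:E * g z)))%E ->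
  (esph r phi <= esph r al + (C%:E * vol + (k%:E * esph r S + c%:E * esph r g)))%E.
Proof.
move=> mphi mal mS mg p0 a0 S0 g0 C0 k0 c0 le.
have mkS : vmeas (fun z => k%:E * S z)%E by exact: vmeasZ.
have mcg : vmeas (fun z => c%:E * g z)%E by exact: vmeasZ.
have mC : vmeas (fun _ : V => C%:E) by exact: vmeas_cst.
have m1 : vmeas (fun z => k%:E * S z + c%:E * g z)%E by exact: vmeasD.
have m2 : vmeas (fun z => C%:E + (k%:E * S z + c%:E * g z))%E by exact: vmeasD.
have kS0 z : (0 <= k%:E * S z)%E by rewrite mule_ge0 ?lee_fin.
have cg0 z : (0 <= c%:E * g z)%E by rewrite mule_ge0 ?lee_fin.
have n1 z : (0 <= k%:E * S z + c%:E * g z)%E by rewrite adde_ge0.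
have n2 z : (0 <= C%:E + (k%:E * S z + c%:E * g z))%E by rewrite adde_ge0 ?lee_fin.
rewrite -(esphZ r mS S0 k0) -(esphZ r mg g0 c0) -(esphD r mkS mcg kS0 cg0).
rewrite -(esph_cst m r C0) -(esphD r mC m1) //.
rewrite -(esphD r mal m2) //; apply: le_esph => //.
- exact: vmeasD.
- by move=> z; rewrite adde_ge0.
Qed.

Lemma sph_esph r (h : V -> R) : sph r h = esph r (fun z => (h z)%:E).
Proof. by []. Qed.

Lemma rmeas_logplus (h : V -> R) : rmeas h -> rmeas (fun z => logplus (h z)).
Proof. by move=> mh; apply: rmeas_homo mh => x y; exact: le_logplus. Qed.

Lemma rmeas_cabs_inv (f : V -> R[i]) : entire f -> rmeas (fun z => cabs (f z)^-1).
Proof.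
move=> ef; have -> : (fun z => cabs (f z)^-1) = fun z => (cabs (f z))^-1.
  by apply/funext => z; rewrite cabsV.
apply: rmeas_inv; first by move=> z; exact: cabs_ge0.
by apply: rmeas_vcont; exact: vcont_cabs.
Qed.

Lemma rmeas_cabs_div (f g : V -> R[i]) : entire f -> entire g ->
  rmeas (fun z => cabs (f z / g z)).
Proof.
move=> ef eg; have -> : (fun z => cabs (f z / g z)) = fun z => cabs (f z) * cabs (g z)^-1.
  by apply/funext => z; rewrite cabsM.
apply: rmeasM; last exact: rmeas_cabs_inv.
by apply: rmeas_vcont; exact: vcont_cabs.
Qed.

(** On the zeros [nlog t] is equal to [- ln t], while its integral is bounded independently of [t].
    The integrand is infinite so that it can be added to a bound that fails on the zeros. *)
Lemma zero_set_null r (f : V -> R[i]) (z0 : V) : 1 < r -> entire f -> f z0 != 0 ->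
  esph r (fun z => if cabs (f z) <= 0 then +oo%E else 0%E) = 0%E.
Proof.
move=> r1 ef fz0; have [C C0 HC] := sph_nlog_le m_gt0 ef fz0.
have r0 : 0 <= r by rewrite ltW // (lt_trans _ r1).
pose Z z : \bar R := if cabs (f z) <= 0 then +oo%E else 0%E.
have mZ : vmeas Z.
  apply: vmeas_if; [|exact: vmeas_cst|exact: vmeas_cst].
  apply: bmeas_ler; last exact: rmeas_cst.
  by apply: rmeas_vcont; exact: vcont_cabs.
have Z0 z : (0 <= Z z)%E by rewrite /Z; case: ifP.
apply/eqP; rewrite eq_le (esph_ge0 r Z0) andbT.
apply: (esph_trunc mZ Z0) => k; apply/lee_addgt0Pr => e e0; rewrite add0e.
have Tf := sph_fin r0 ef; have T0 : (0 <= sph r (logp f))%E.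
  by rewrite sph_esph esph_ge0 // => z; rewrite lee_fin logp_ge0.
have [T TE] : exists T, sph r (logp f) = T%:E by exists (fine (sph r (logp f))); rewrite fineK.
rewrite TE lee_fin in T0.
pose L := (k%:R * (T + C)) / e + 1.
have L1 : 1 <= L by rewrite lerDr divr_ge0 ?(ltW e0) // mulr_ge0 ?ler0n // addr_ge0.
have L0 : 0 < L by exact: lt_le_trans L1.
pose t := expR (- L).
have t01 : 0 < t <= 1 by rewrite expR_gt0 /= -expR0 ler_expR oppr_le0 ltW.
have lt : - ln t = L by rewrite expRK opprK.
have mn : vmeas (fun z => (nlog t (cabs (f z)))%:E) by apply: vmeas_EFin; exact: rmeas_nlog.
have nn z : (0 <= (nlog t (cabs (f z)))%:E)%E by rewrite lee_fin nlog_ge0.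
have kL : 0 <= k%:R / L by rewrite divr_ge0 ?ler0n // ltW.
apply: (@le_trans _ _ ((k%:R / L)%:E * esph r (fun z => (nlog t (cabs (f z)))%:E))%E).
  rewrite -esphZ //; apply: le_esph.
  - move=> d U p mp; apply: measurable_mine; last exact: measurable_cst.
    exact: (mZ _ _ _ mp).
  - exact: vmeasZ.
  - by move=> z; rewrite le_min Z0 lee_fin ler0n.
  - by move=> z; rewrite mule_ge0 ?lee_fin // nlog_ge0.
  - move=> z; rewrite /Z; case: ifP => fz; last first.
      by rewrite ge_min mule_ge0 // lee_fin.
    rewrite ge_min -EFinM lee_fin.
    have -> : nlog t (cabs (f (onsphere r z))) = L.
      rewrite -lt /nlog; congr (- ln _); apply/max_idPl.
      rewrite ge_min; apply/orP; right; apply: le_trans fz _.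
      by case/andP: t01 => /ltW.
    by rewrite divfK ?lexx ?orbT // gt_eqF.
apply: (@le_trans _ _ ((k%:R / L)%:E * (T + C)%:E)%E).
  by rewrite lee_wpmul2l ?lee_fin // -sph_esph EFinD -TE HC.
rewrite -EFinM lee_fin mulrAC ler_pdivrMr //.
by rewrite /L [e * _]mulrDr mulr1 [e * _]mulrC divfK ?gt_eqF // lerDl ltW.
Qed.

Variable a : {ffun 'I_n -> nat} -> V -> R[i].
Hypothesis ea : forall I, entire (a I).
Variable f : 'I_n -> V -> R[i].
Hypothesis ef : forall i, entire (f i).
Variable i0 : 'I_n.

Local Notation A r := (esph r (fun z => elogplus (abs_coef_sum a z))).
Local Notation B r := (\sum_i esph r (fun z => (logplus (cabs (f i z / f i0 z)))%:E))%E.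

Let mquot i : vmeas (fun z => (logplus (cabs (f i z / f i0 z)))%:E).
Proof. by apply: vmeas_EFin; apply: rmeas_logplus; exact: rmeas_cabs_div. Qed.

Let quot0 i z : (0 <= (logplus (cabs (f i z / f i0 z)))%:E)%E.
Proof. by rewrite lee_fin logplus_ge0. Qed.

Lemma proximity_le X (u : {ffun 'I_n -> 'I_X} -> V -> R[i]) (z0 : V) :
  (forall L, poly_in a (u L)) ->
  (forall z : V, (fun N : nat => (\sum_(d < N) hpart a z (fun i => f i z) d : R[i]^o))
       @ \oo --> (0 : R[i]^o)) ->
  aux_val a u z0 (fun i => f i z0) != 0 ->
  exists C k : R, [/\ 0 <= C, 0 <= k & forall r, 1 < r ->
   (X%:R%:E * esph r (fun z => (logplus (cabs (f i0 z)^-1))%:E) <=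
   sph r (logp (fun z => aux_val a u z (fun i => f i z))) + (C%:E + (k%:E * A r + X%:R%:E * B r)))%E].
Proof.
move=> Pu ser Pz0; pose P z := aux_val a u z (fun i => f i z).
have eP : entire P by exact: entire_aux_val.
have [C0 C00 HC0] := sph_nlog_le m_gt0 eP Pz0.
have [C1 [k1 [C10 k10 Hu]]] := logb_sum (index_enum _) Pu.
have vf := vol_fin_num R m.
have v0 : 0 <= fine vol by apply: fine_ge0; apply: gint_ge0; exact: ind_ge0.
(* The extra 1 accounts for [logplus s]; being positive, [k1 + 1] also makes the right-hand side
   infinite where the sum of coefficients diverges. *)
exists (C0 + C1 * fine vol), (k1 + 1); split; rewrite ?addr_ge0 ?mulr_ge0 //.
move=> r r1; have X0 : 0 <= X%:R :> R by rewrite ler0n.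
have ml : rmeas (fun z => logplus (cabs (f i0 z)^-1)).
  by apply: rmeas_logplus; exact: rmeas_cabs_inv.
have ml' : vmeas (fun z => (logplus (cabs (f i0 z)^-1))%:E) by exact: vmeas_EFin.
have l0 z : (0 <= (logplus (cabs (f i0 z)^-1))%:E)%E by rewrite lee_fin logplus_ge0.
rewrite -(esphZ r ml' l0 X0); apply: esph_trunc.
- exact: vmeasZ.
- by move=> z; rewrite mule_ge0 ?lee_fin // logplus_ge0.
(* Truncating the left-hand side at [k] corresponds to the cut with [- ln t = k]. *)
move=> k; pose t : R := expR (- k%:R).
have t01 : 0 < t <= 1 by rewrite expR_gt0 /= -expR0 ler_expR oppr_le0 ler0n.
have lt : - ln t = k%:R by rewrite expRK opprK.
have H := @le_esph_comb r
  (fun z => Order.min (X%:R%:E * (logplus (cabs (f i0 z)^-1))%:E) k%:R%:E)%E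
  (fun z => (nlog t (cabs (P z)))%:E) (fun z => elogplus (abs_coef_sum a z))
  (fun z => \sum_i (logplus (cabs (f i z / f i0 z)))%:E)%E C1 (k1 + 1) X%:R.
apply: (le_trans (H _ _ _ _ _ _ _ _ _ _ _ _)) => {H} //.
- move=> d U p mp; apply: measurable_mine; last exact: measurable_cst.
  exact: (vmeasZ X%:R%:E ml' mp).
- by apply: vmeas_EFin; exact: rmeas_nlog.
- by apply: vmeas_elogplus; exact: vmeas_abs_coef_sum.
- by apply: vmeas_sum => i; exact: mquot.
- by move=> z; rewrite le_min mule_ge0 ?lee_fin ?ler0n ?logplus_ge0.
- by move=> z; rewrite lee_fin nlog_ge0.
- by move=> z; exact: elogplus_ge0.
- by move=> z; apply: sume_ge0.
- by rewrite addr_ge0.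
- move=> z; rewrite sumEFin; case sa : (abs_coef_sum a z) => [s| |].
  + rewrite /= -!EFinM -!EFinD -EFin_min lee_fin -lt.
    have := proximity_ineq i0 u (ser z) sa t01.
    have := Hu z s sa; rewrite -/(P z) mulrDl mul1r; lra.
  + by rewrite /= gt0_muley ?lte_fin ?ltr_wpDl // -EFinM addye // !addey // leey.
  + by have := abs_coef_sum_ge0 a z; rewrite sa.
have -> : esph r (fun z => \sum_i (logplus (cabs (f i z / f i0 z)))%:E)%E = B r.
  exact: (esph_sum r (index_enum _) mquot quot0).
rewrite [(C0 + _)%:E]EFinD EFinM fineK // -(addeA C0%:E) [leRHS]addeA.
by rewrite leeD2r // HC0.
Qed.

Lemma characteristic_le X Y (u : {ffun 'I_n -> 'I_X} -> V -> R[i]) (z0 : V) :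
  (forall L, poly_in a (u L)) ->
  (forall (J : {ffun 'I_n -> nat}) z, (forall i, (J i < X)%N) -> (exists i, (Y <= J i)%N) ->
     convol a u J z = 0) ->
  f i0 z0 != 0 ->
  exists C k : R, [/\ 0 <= C, 0 <= k & forall r, 1 < r ->
   (sph r (logp (fun z => aux_val a u z (fun i => f i z))) <=
    C%:E + (k%:E * A r + (n * Y)%:R%:E * (sph r (logp (f i0)) + B r)))%E].
Proof.
move=> Pu bad fz0; pose P z := aux_val a u z (fun i => f i z).
have eP : entire P by exact: entire_aux_val.
have [C1 [k1 [C10 k10 Hc]]] := logb_sum (index_enum {ffun 'I_n -> 'I_X})
  (fun J => poly_in_convol (multi_of J) Pu).
have vf := vol_fin_num R m.
have v0 : 0 <= fine vol by apply: fine_ge0; apply: gint_ge0; exact: ind_ge0.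
(* [k1] may be 0, and [0 * +oo] is 0; [k1 + 1] keeps the right-hand side infinite where the sum of
   coefficients diverges. *)
exists (C1 * fine vol), (k1 + 1); split; rewrite ?addr_ge0 ?mulr_ge0 //.
move=> r r1.
have mf : vmeas (fun z => (logp (f i0) z)%:E) by apply: vmeas_EFin; exact: rmeas_logp.
have f0 z : (0 <= (logp (f i0) z)%:E)%E by rewrite lee_fin logp_ge0.
have mB : vmeas (fun z => \sum_i (logplus (cabs (f i z / f i0 z)))%:E)%E.
  by apply: vmeas_sum => i; exact: mquot.
have B0 z : (0 <= \sum_i (logplus (cabs (f i z / f i0 z)))%:E)%E by apply: sume_ge0.
(* [aux_val_logplus] does not apply on the zeros of [f i0]; an infinite term there makes the
   inequality trivial and, by [zero_set_null], costs nothing. *)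
have H := @le_esph_comb r (fun z => (logp P z)%:E)
  (fun z => if cabs (f i0 z) <= 0 then +oo%E else 0%E)
  (fun z => elogplus (abs_coef_sum a z))
  (fun z => (logp (f i0) z)%:E + \sum_i (logplus (cabs (f i z / f i0 z)))%:E)%E
  C1 (k1 + 1) (n * Y)%:R.
apply: (le_trans (H _ _ _ _ _ _ _ _ _ _ _ _)) => {H} //.
- by apply: vmeas_EFin; exact: rmeas_logp.
- apply: vmeas_if; [|exact: vmeas_cst|exact: vmeas_cst].
  apply: bmeas_ler; last exact: rmeas_cst.
  by apply: rmeas_vcont; exact: vcont_cabs.
- by apply: vmeas_elogplus; exact: vmeas_abs_coef_sum.
- exact: vmeasD.
- by move=> z; rewrite lee_fin logp_ge0.
- by move=> z; case: ifP.
- by move=> z; exact: elogplus_ge0.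
- by move=> z; rewrite adde_ge0.
- by rewrite addr_ge0.
- move=> z; rewrite sumEFin; case: ifP => fz.
    rewrite addye ?leey // -EFinD -EFinM.
    by have := elogplus_ge0 (abs_coef_sum a z); case: (elogplus _) => [s| |] //=;
       rewrite ?gt0_muley ?lte_fin ?ltr_wpDl.
  rewrite add0e; case sa : (abs_coef_sum a z) => [s| |].
  + rewrite /= -(EFinD (logp _ _)) -!EFinM -!EFinD lee_fin.
    have w0 : f i0 z != 0 by rewrite -cabs_gt0 ltNge fz.
    have := @aux_val_logplus _ _ _ a i0 X Y u z (fun i => f i z) (fun J => bad J z) w0.
    have := Hc z s sa; have := logplus_ge0 s; rewrite -/(P z) mulrDl mul1r /logp; lra.
  + by rewrite /= gt0_muley ?lte_fin ?ltr_wpDl // -EFinD -EFinM addye // !addey // leey.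
  + by have := abs_coef_sum_ge0 a z; rewrite sa.
rewrite (zero_set_null r1 (ef i0) fz0) add0e (esphD r mf mB f0 B0).
have -> : esph r (fun z => \sum_i (logplus (cabs (f i z / f i0 z)))%:E)%E = B r.
  exact: (esph_sum r (index_enum _) mquot quot0).
by rewrite EFinM fineK.
Qed.

End IntegratedInequalities.

Section SmallQuantities.
Variable R : realType.
Local Notation mu := (@lebesgue_measure R).

Lemma finite_measure_avoid (E : set R) (r0 : R) : measurable E -> (mu E < +oo)%E ->
  exists2 r, r0 < r & ~ E r.
Proof.
move=> mE fE; apply: contrapT => N.
have sub : `]r0, +oo[ `<=` E.
  move=> r /=; rewrite in_itv /= andbT => r0r; apply: contrapT => Er.
  by apply: N; exists r.
have mi : measurable (`]r0, +oo[ : set R) by exact: measurable_itv.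
have li : mu `]r0, +oo[ = +oo%E by rewrite lebesgue_measure_itv /= ltry addye.
have : (mu `]r0, +oo[ <= mu E)%E by exact: (le_measure mu (mem_set mi) (mem_set mE) sub).
by rewrite li => /le_lt_trans /(_ fE); rewrite ltxx.
Qed.

(** A finite union of exceptional sets has finite measure, hence misses arbitrarily large radii. *)
Lemma small_rel_common (I : finType) (T : R -> \bar R) (phi : I -> R -> \bar R) (eps r0 : R) :
  (forall i, small_rel T (phi i)) -> 0 < eps ->
  exists2 r, r0 < r & forall i, (`|phi i r| <= eps%:E * T r)%E.
Proof.
move=> sm e0.
suff [E [r1 [mE fE HE]]] : exists (E : set R) (r1 : R), [/\ measurable E, (mu E < +oo)%E &
    forall r, r1 < r -> ~ E r -> forall i, i \in enum I -> (`|phi i r| <= eps%:E * T r)%E].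
  have [r rr Er] := finite_measure_avoid (Num.max r0 r1) mE fE.
  move: rr; rewrite gt_max => /andP[rr0 rr1].
  by exists r => // i; apply: HE => //; rewrite mem_enum.
elim: (enum I) => [|i s [E [r1 [mE fE HE]]]].
  by exists set0, 0; split=> //; rewrite measure0.
have [F [mF [fF HF]]] := sm i; have [r2 H2] := HF eps e0.
exists (F `|` E), (Num.max r1 r2); split.
- exact: measurableU.
- have le : (mu (F `|` E) <= mu F + mu E)%E by exact: (measureU2 mu mF mE).
  by apply: le_lt_trans le _; exact: lte_add_pinfty.
- move=> r; rewrite gt_max => /andP[h1 h2] FE j.
  rewrite inE => /predU1P[->|js].
    by apply: H2 => // Fr; apply: FE; left.
  by apply: HE => // Er; apply: FE; right.
Qed.

Lemma liminf_gt0 (h : R -> \bar R) : (0 < liminf_pinfty h)%E ->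
  exists2 c : R, 0 < c & exists r0 : R, forall r, r0 <= r -> (c%:E <= h r)%E.
Proof.
move=> /ereal_sup_gt[_ [r0 _ <-]] h0.
have lb r : r0 <= r -> (ereal_inf [set h r | r in [set r | (r0 <= r)%R]] <= h r)%E.
  by move=> r0r; apply: ereal_inf_lbound; exists r.
move: h0 lb; case: (ereal_inf _) => [d| |] // d0 lb.
  by exists d => //; exists r0.
exists 1 => //; exists r0 => r /lb; rewrite leye_eq => /eqP ->; exact: leey.
Qed.

End SmallQuantities.

Lemma nonconstant_dim_gt0 (R : realType) (m : nat) (f : 'rV[R[i]]_m -> R[i]) :
  nonconstant f -> (0 < m)%N.
Proof.
case: m f => // f nf; case: nf; exists (f 0) => z; congr (f _).
by apply/rowP => -[].
Qed.

Lemma nonconstant_neq0 (R : realType) (m : nat) (f : 'rV[R[i]]_m -> R[i]) :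
  nonconstant f -> exists z, f z != 0.
Proof.
move=> nf; apply: contrapT => N; apply: nf; exists 0 => z.
by apply/eqP; apply: contrapT => fz; apply: N; exists z; apply/negP.
Qed.

Section Normalization.
Variables (R : realType) (m : nat).
Hypothesis m_gt0 : (0 < m)%N.
Local Notation V := 'rV[R[i]]_m.

Lemma cball_vol : exists2 v : R, 0 < v & gint (ind (@cball R m)) = v%:E.
Proof.
have v0 : (0 < gint (ind (@cball R m)))%E by exact: lt_le_trans (vol_gt0 R m_gt0) (le_vol R m).
have := vol_fin R m; move: v0; case: (gint _) => [v| |] // v0 _.
by exists v.
Qed.

Lemma mprox_e_small (phi : V -> \bar R) (f : V -> R[i]) (e r : R) :
  (`|mprox_e r phi| <= e%:E * Tchar f r)%E ->
  (esph r (fun z => elogplus (phi z)) <= e%:E * sph r (logp f))%E.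
Proof.
have [v v0 vE] := cball_vol.
rewrite /Tchar /mprox !mprox_eE vE inver gt_eqF // => H.
have := le_trans (lee_abs _) H; rewrite lee_pdivrMr // -muleA -muleA -EFinM mulVf ?gt_eqF //.
by rewrite mule1.
Qed.

Lemma mprox_large (f : V -> R[i]) (c r t : R) : 0 < t -> sph r (logp f) = t%:E ->
  (c%:E <= mprox r (fun z => ((f z)^-1)%R) / Tchar f r)%E ->
  ((c * t)%:E <= esph r (fun z => (logplus (cabs (f z)^-1)%R)%:E))%E.
Proof.
have [v v0 vE] := cball_vol.
move=> t0 tE; have -> : Tchar f r = (t / v)%:E.
  rewrite /Tchar /mprox mprox_eE vE inver gt_eqF // EFinM -tE.
  by [].
rewrite /mprox mprox_eE vE !inver !gt_eqF ?divr_gt0 // lee_pdivlMr ?divr_gt0 //.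
rewrite lee_pdivlMr // -!EFinM -mulrA divfK ?gt_eqF //.
Qed.

End Normalization.

Section Vanishing.
Variables (R : realType) (m n : nat).
Hypothesis m_gt0 : (0 < m)%N.
Local Notation V := 'rV[R[i]]_m.
Variables (a : {ffun 'I_n.+1 -> nat} -> V -> R[i]) (f : 'I_n.+1 -> V -> R[i]).
Hypothesis ea : forall I, entire (a I).
Hypothesis ef : forall i, entire (f i).
Hypothesis nf : nonconstant (f ord0).
Hypothesis squot : forall i, small_rel (Tchar (f ord0))
  (fun r => mprox r (fun z => f i z / f ord0 z)).
Hypothesis scoef : small_rel (Tchar (f ord0)) (fun r => mprox_e r (abs_coef_sum a)).
Hypothesis ser : forall z : V,
  (fun N : nat => (\sum_(d < N) hpart a z (fun i => f i z) d : R[i]^o)) @ \oo --> (0 : R[i]^o).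

Lemma le_fin_exists (x : \bar R) (y : R) : (0 <= x)%E -> (x <= y%:E)%E ->
  exists x', [/\ x = x'%:E, 0 <= x' & x' <= y].
Proof. by case: x => [x| |] //; rewrite !lee_fin => x0 xy; exists x. Qed.

(* Otherwise [q Y m(r,1/f_1) <= m(r,1/P) + S(r) <= m(r,P) + S(r) <= (n+1) Y T(r) + S(r)]
   for [P] the value of the auxiliary polynomial, contradicting the choice of [q]. *)
Lemma aux_val_eq0 (c rd : R) (q Y : nat) (u : {ffun 'I_n.+1 -> 'I_(q * Y)} -> V -> R[i]) z0 :
  0 < c -> (forall r, rd <= r ->
    (c%:E <= mprox r (fun z => ((f ord0 z)^-1)%R) / Tchar (f ord0) r)%E) ->
  n.+1%:R + 2 <= q%:R * c -> (0 < Y)%N ->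
  (forall L, poly_in a (u L)) ->
  (forall (J : {ffun 'I_n.+1 -> nat}) z, (forall i, (J i < q * Y)%N) ->
    (exists i, (Y <= J i)%N) -> convol a u J z = 0) ->
  aux_val a u z0 (fun i => f i z0) = 0.
Proof.
move=> c0 Hd Hq Y0 Pu bad; apply/eqP; apply: contrapT => /negP Pz0.
have [z1 fz1] := nonconstant_neq0 nf.
have [C1 [k1 [C10 k10 H1]]] := proximity_le m_gt0 ea ef ord0 Pu ser Pz0.
have [C2 [k2 [C20 k20 H2]]] := characteristic_le m_gt0 ea ef Pu bad fz1.
set X := (q * Y)%N in H1 H2; set Z := (n.+1 * Y)%N in H2.
(* [K] collects the coefficients of the small quantities in both inequalities; with
   [e = 1 / (1 + K)] they add up to at most [t]. *)
pose K : R := k1 + k2 + (X%:R + Z%:R) * n.+1%:R.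
have K0 : 0 <= K by rewrite addr_ge0 ?addr_ge0 // mulr_ge0 ?addr_ge0 ?ler0n.
pose e := (1 + K)^-1.
have e0 : 0 < e by rewrite invr_gt0 ltr_wpDr.
have eK : e * K <= 1 by rewrite mulrC ler_pdivrMr ?ltr_wpDr // mul1r lerDr.
have [r1 Hr1] := sph_unbounded m_gt0 (C1 + C2 + 1) (ef ord0) nf.
pose phi (o : option 'I_n.+1) r := if o is Some i then
  mprox r (fun z => f i z / f ord0 z) else mprox_e r (abs_coef_sum a).
have sm o : small_rel (Tchar (f ord0)) (phi o) by case: o => [i|]; [exact: squot|exact: scoef].
have [r] := small_rel_common (Num.max 1 (Num.max rd r1)) sm e0.
rewrite !gt_max => /andP[r_1 /andP[r_d r_1']] Hr.
have r0 : 0 <= r by rewrite ltW // (lt_trans _ r_1).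
have [t tE] : exists t, sph r (logp (f ord0)) = t%:E.
  by exists (fine (sph r (logp (f ord0)))); rewrite fineK // sph_fin.
have [p pE] : exists p, sph r (logp (fun z => aux_val a u z (fun i => f i z))) = p%:E.
  have pf := sph_fin r0 (entire_aux_val ea Pu ef).
  by exists (fine (sph r (logp (fun z => aux_val a u z (fun i => f i z))))); rewrite fineK.
have tC : C1 + C2 + 1 <= t by have := Hr1 r r_1'; rewrite tE lee_fin.
have t0 : 0 < t by rewrite (lt_le_trans _ tC) // ltr_wpDl // addr_ge0.
have := mprox_e_small m_gt0 (Hr None); rewrite tE -EFinM => hA.
have [A [AE A0 At]] :=
  le_fin_exists (esph_ge0 r (fun z => elogplus_ge0 (abs_coef_sum a z))) hA.
have HB i : exists b, esph r (fun z => (logplus (cabs (f i z / f ord0 z)))%:E) = b%:E /\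
    0 <= b <= e * t.
  have := mprox_e_small m_gt0 (Hr (Some i)); rewrite tE -EFinM => h.
  have h0 : (0 <= esph r (fun z => elogplus (cabs (f i z / f ord0 z))%:E))%E.
    by apply: esph_ge0 => z; exact: elogplus_ge0.
  by have [b [bE b0 bt]] := le_fin_exists h0 h; exists b; rewrite b0 bt.
have [b Hb] := choice HB.
have BE : (\sum_i esph r (fun z => (logplus (cabs (f i z / f ord0 z)))%:E) = (\sum_i b i)%:E)%E.
  by rewrite -sumEFin; apply: eq_bigr => i _; case: (Hb i).
have B0 : 0 <= \sum_i b i by apply: sumr_ge0 => i _; case: (Hb i) => _ /andP[].
have Bt : \sum_i b i <= n.+1%:R * (e * t).
  rewrite -[n.+1 in leRHS]card_ord mulr_natl -sumr_const; apply: ler_sum => i _.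
  by case: (Hb i) => _ /andP[].
move: B0 Bt BE; set B := \sum_i b i => B0 Bt BE.
have I1 := mprox_large m_gt0 t0 tE (Hd r (ltW r_d)).
have h2 := H2 r r_1; rewrite AE BE pE tE in h2.
have {}h2 : p <= C2 + (k2 * A + Z%:R * (t + B)) by rewrite -lee_fin.
have h1 := H1 r r_1; rewrite AE BE pE in h1.
have X0 : 0 <= X%:R :> R by rewrite ler0n.
have : (X%:R%:E * (c * t)%:E <= (p + (C1 + (k1 * A + X%:R * B)))%:E)%E.
  by apply: le_trans h1; rewrite lee_wpmul2l ?lee_fin.
rewrite -EFinM lee_fin => {}h1.
have Y1 : 1 <= Y%:R :> R by rewrite ler1n.
have XE : X%:R = q%:R * Y%:R :> R by rewrite natrM.
have ZE : Z%:R = n.+1%:R * Y%:R :> R by rewrite natrM.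
have Z0 : 0 <= Z%:R :> R by rewrite ler0n.
have s1 : (n.+1%:R + 2) * (Y%:R * t) <= X%:R * (c * t).
  have -> : X%:R * (c * t) = q%:R * c * (Y%:R * t) by rewrite XE; ring.
  by rewrite ler_wpM2r // mulr_ge0 ?ler0n // ltW.
have s2 : (k1 + k2) * A <= (k1 + k2) * (e * t) by rewrite ler_wpM2l ?addr_ge0.
have s3 : (X%:R + Z%:R) * B <= (X%:R + Z%:R) * (n.+1%:R * (e * t)) by rewrite ler_wpM2l ?addr_ge0.
have s4 : K * (e * t) <= t.
  by rewrite mulrA [K * e]mulrC -[leRHS]mul1r ler_wpM2r // ltW.
have s5 : t <= Y%:R * t by rewrite -[leLHS]mul1r ler_wpM2r // ltW.
have s6 : (k1 + k2) * (e * t) + (X%:R + Z%:R) * (n.+1%:R * (e * t)) = K * (e * t).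
  by rewrite /K; ring.
have s7 : Z%:R * t = n.+1%:R * (Y%:R * t) by rewrite ZE; ring.
(* Altogether [(n.+1 + 2) Y t <= n.+1 Y t + t + C1 + C2], against [C1 + C2 + 1 <= t <= Y t]: of the
   constant 2, one unit pays for the small terms and one for the bounded terms. *)
move: h1 h2 s1 s2 s3 s4 s5 s6 tC; rewrite [Z%:R * (t + B)]mulrDr s7 !mulrDl.
lra.
Qed.

End Vanishing.

(* f_1, ..., f_n are indexed by 'I_n.+1 (so n+1 >= 1 functions); f_1 = f ord0.
   The power series G has coefficients a_I, I : {ffun 'I_n.+1 -> nat}. *)
Theorem mainTheorem7 (R : realType) (m n : nat)
  (f : 'I_n.+1 -> 'rV[R[i]]_m -> R[i])
  (a : {ffun 'I_n.+1 -> nat} -> 'rV[R[i]]_m -> R[i]) :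
  (forall i, entire (f i)) ->
  (forall i, nonconstant (f i)) ->
  (forall i, small_rel (Tchar (f ord0))
               (fun r => mprox r (fun z => f i z / f ord0 z))) ->
  (forall I, entire (a I)) ->
  (exists I z, a I z != 0) ->
  small_rel (Tchar (f ord0)) (fun r => mprox_e r (abs_coef_sum a)) ->
  (* G(z, f_1(z), ..., f_n(z)) converges for every z, with sum 0 *)
  (forall z : 'rV[R[i]]_m,
     (fun N : nat => (\sum_(d < N) hpart a z (fun i => f i z) d : R[i]^o))
       @ \oo --> (0 : R[i]^o)) ->
  (0 < deficiency0 (f ord0))%E ->
  exists (c : {ffun 'I_n.+1 -> nat} -> 'rV[R[i]]_m -> R[i]) (N : nat),
    (forall J, poly_in a (c J)) /\
    (forall J : {ffun 'I_n.+1 -> nat}, (exists i, (N < J i)%N) -> forall z, c J z = 0) /\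
    (exists J z, c J z != 0) /\
    (forall z : 'rV[R[i]]_m,
       \sum_(J : {ffun 'I_n.+1 -> 'I_N.+1})
          c (multi_of J) z * monom (fun i => f i z) (multi_of J) = 0).
Proof.
move=> ef nf squot ea nza scoef ser def.
have m_gt0 := nonconstant_dim_gt0 (nf ord0).
have [c c0 [rd Hd]] := liminf_gt0 def.
have [q q0 Hq] : exists2 q : nat, (0 < q)%N & n.+1%:R + 2 <= q%:R * c.
  have h0 : 0 <= (n.+1%:R + 2) / c :> R by rewrite divr_ge0 ?ltW // addr_gt0.
  exists (Num.bound ((n.+1%:R + 2) / c)).
    by rewrite -(@ltr0n R); exact: le_lt_trans (archi_boundP h0).
  by rewrite -ler_pdivrMr // ltW // archi_boundP.
have [Y [u [Y0 Pu bad [J0 [z1 [J0Y J0z]]]]]] := aux_poly (ltn0Sn n) q0 nza.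
have Xp : ((q * Y).-1.+1 = q * Y)%N by rewrite prednK // muln_gt0 q0.
have Pzero z : aux_val a u z (fun i => f i z) = 0.
  exact: (aux_val_eq0 m_gt0 ea ef (nf ord0) squot scoef ser z c0 Hd Hq Y0 Pu bad).
(* Outside the large box [convol] need not vanish; the polynomial keeps the indices inside. *)
pose C (J : {ffun 'I_n.+1 -> nat}) z :=
  if [forall i, (J i < q * Y)%N] then convol a u J z else 0.
exists C, (q * Y).-1; split; [|split; [|split]].
- move=> J; rewrite /C; case: [forall i, _]; first exact: poly_in_convol.
  exact: poly_in_cst.
- move=> J [j hj] z; rewrite /C ifF //; apply/negP => /forallP/(_ j).
  by rewrite ltnNge -Xp hj.
- exists J0, z1; rewrite /C ifT //; apply/forallP => j.
  by apply: leq_trans (J0Y j) _; rewrite leq_pmull.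
(* [u] and all that depends on it are generalized, so that [q * Y] can be rewritten as a successor
   in the index types. *)
- move=> z; rewrite -[RHS](Pzero z) /aux_val; move: u Pu bad J0z Pzero @C => {J0Y}.
  rewrite -Xp => u Pu bad J0z Pzero C; apply: eq_bigr => J _; rewrite /C ifT //.
  by apply/forallP => j; rewrite ffunE.
Qed.
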